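(* (1) The planar $5$ body problem with masses $m=(-1/4,1,1,1,1)$ restricted to the vector space $$W=\{q\in\mathbb{R}^{10}:\ q_{1,1}=q_{1,2}=q_{2,1}+q_{4,1}=q_{2,2}+q_{4,2}=q_{3,1}+q_{5,1}=q_{3,2}+q_{5,2}=0\}$$ is integrable in the Liouville sense. (2) Let $c=(c_1,\dots,c_n)$ be a central configuration of $n$ bodies with masses $(m_1,\dots,m_n)$ in the plane, lying on the unit circle and with center of mass at $0$, and let $\alpha$ be chosen such that the configuration $c$ together with an additional central mass $-\alpha$ at $0$ is an absolute equilibrium. Then the spatial $n+3$ body problem with masses $(m_1,\dots,m_n,-\alpha,4\alpha,4\alpha)$ restricted to the vector space $$W=\{q\in\mathbb{R}^{3(n+3)}:\ q_{n+1,1}=q_{n+1,2}=q_{n+1,3}=q_{n+2,1}=q_{n+2,2}=q_{n+3,1}=q_{n+3,2}=q_{n+2,3}+q_{n+3,3}=0,$$ $$q_{i,3}=0\ (i=1,\dots,n),\quad (q_i)_{i=1,\dots,n}=\beta R_\theta c,\ \ \beta,\theta\in\mathbb{R}\}$$ is integrable in the Liouville sense, where $R_\theta$ denotes the rotation of angle $\theta$ in the plane containing $c$ (the plane of the first two coordinates).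
   Context: The $N$ body problem in dimension $d$ with (possibly negative) nonzero masses $m_1,\dots,m_N$ is the Hamiltonian system $$H=\sum_{i=1}^N\frac{\|p_i\|^2}{2m_i}+V_{N,d}(q),\qquad V_{N,d}(q)=\sum_{1\le i<j\le N}\frac{m_im_j}{\|q_i-q_j\|},\qquad q_i=(q_{i,1},\dots,q_{i,d}),\ p_i\in\mathbb{R}^d .$$ Planar means $d=2$, spatial means $d=3$. A configuration $c$ is a central configuration if there exist a vector $g$ and a scalar $\alpha_0$ (the multiplier) with $\frac1{m_i}\frac{\partial V}{\partial q_i}(c)=\alpha_0(c_i-g)$ for all $i$; it is an absolute equilibrium if $\alpha_0=0$, i.e. all forces vanish. A vector space $W\subset\mathbb{R}^{Nd}$ is invariant if for all $q\in W$ the vector $\left(\frac1{m_i}\frac{\partial V_{N,d}}{\partial q_i}(q)\right)_i$ lies in $W$; then the equations of motion preserve $\{q\in W,\dot q\in W\}$, and the problem restricted to $W$ is the resulting Hamiltonian system with $\dim W$ degrees of freedom, whose potential is $V_{N,d}|_W$ and whose kinetic energy is the restriction to $W$ of $\frac12\sum_i m_i\|\dot q_i\|^2$. It is integrable in the Liouville sense if it has $\dim W$ functionally independent first integrals pairwise in involution. *)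

(* Defs.v *)
(* MathComp world, with MathComp-Analysis over an arbitrary R : realType. *)
From HB Require Import structures.
From mathcomp Require Export all_boot all_order all_algebra.
From mathcomp Require Export all_classical all_reals all_analysis.
Export numFieldNormedType.Exports.
Export Order.TTheory GRing.Theory Num.Theory.

Set Implicit Arguments.
Unset Strict Implicit.
Unset Printing Implicit Defensive.

Local Open Scope classical_set_scope.
Local Open Scope ring_scope.

Section NBody.
Variables (R : realType) (N d : nat).
Implicit Types (m : 'rV[R]_N) (q : 'M[R]_(N, d)).

(* The norm of the normed module 'rV[R]_d is the sup norm, hence this one. *)
Definition enorm (v : 'rV[R]_d) : R := Num.sqrt (\sum_k v 0 k ^+ 2).

(* A configuration is a matrix whose row i is the position of body i. *)
Definition collision_free q : Prop :=
  forall i j : 'I_N, i != j -> row i q != row j q.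

Definition potential m q : R :=
  \sum_(i < N) \sum_(j < N | (i < j)%N)
    m 0 i * m 0 j / enorm (row i q - row j q).

Definition scaled_gradient m q : 'M[R]_(N, d) :=
  \matrix_(i < N, k < d) ((m 0 i)^-1 * 'D_(delta_mx i k) (potential m) q).

Definition central_config_mult m q (a0 : R) : Prop :=
  collision_free q /\
  exists g : 'rV[R]_d,
    forall i, row i (scaled_gradient m q) = a0 *: (row i q - g).

Definition central_configuration m q : Prop :=
  exists a0 : R, central_config_mult m q a0.

Definition absolute_equilibrium m q : Prop := central_config_mult m q 0.

Definition total_mass m : R := \sum_(i < N) m 0 i.

(* Meaningful only if total_mass m != 0, as 0^-1 = 0. *)
Definition center_of_mass m q : 'rV[R]_d := (total_mass m)^-1 *: (m *m q).

Definition invariant_subspace m (W : set 'M[R]_(N, d)) : Prop :=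
  forall q, W q -> collision_free q -> W (scaled_gradient m q).

Definition lincomb k (B : 'I_k -> 'M[R]_(N, d)) (x : 'rV[R]_k) : 'M[R]_(N, d) :=
  \sum_(a < k) x 0 a *: B a.

Definition basis_of_set k (B : 'I_k -> 'M[R]_(N, d)) (W : set 'M[R]_(N, d)) :
    Prop :=
  injective (lincomb B) /\ range (lincomb B) = W.

(* Matrix, in the basis B, of the form (u, v) |-> \sum_i m_i <u_i, v_i>. It may
   be degenerate since masses may be negative. *)
Definition kinetic_matrix m k (B : 'I_k -> 'M[R]_(N, d)) : 'M[R]_k :=
  \matrix_(a < k, b < k) \sum_(i < N) m 0 i * \sum_(l < d) B a i l * B b i l.

(* With q = \sum_a x_a B_a, the kinetic energy is (x' G x'^T) / 2 where G is the
   kinetic matrix, and the momentum conjugate to x is p = x' G. *)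
Definition restricted_hamiltonian m k (B : 'I_k -> 'M[R]_(N, d))
    (z : 'rV[R]_k * 'rV[R]_k) : R :=
  (z.2 *m invmx (kinetic_matrix m B) *m z.2^T) 0 0 / 2
  + potential m (lincomb B z.1).

Definition phase_space k (B : 'I_k -> 'M[R]_(N, d)) :
    set ('rV[R]_k * 'rV[R]_k) :=
  [set z | collision_free (lincomb B z.1)].

End NBody.

Section Liouville.
Variable R : realType.

(* For D open: f is of class C^r on D when r successive directional derivatives
   can be taken, the function being differentiable on D at each of these stages
   and continuous on D at the last one. *)
Fixpoint class_C (r : nat) (E : normedModType R) (D : set E) (f : E -> R) :
    Prop :=
  if r is r'.+1 then
    (forall z, D z -> differentiable f z) /\
    (forall v : E, class_C r' D (fun z => 'D_v f z))
  else forall z, D z -> {for z, continuous f}.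

Definition smooth (E : normedModType R) (D : set E) (f : E -> R) : Prop :=
  forall r, class_C r D f.

Variable k : nat.
Local Notation phase := ('rV[R]_k * 'rV[R]_k)%type.
Implicit Types (D : set phase) (F G H : phase -> R).

Definition poisson F G (z : phase) : R :=
  \sum_(a < k)
    ('D_((delta_mx 0 a, 0) : phase) F z * 'D_((0, delta_mx 0 a) : phase) G z
     - 'D_((0, delta_mx 0 a) : phase) F z * 'D_((delta_mx 0 a, 0) : phase) G z).

Definition independent_at (F : 'I_k -> phase -> R) (z : phase) : Prop :=
  forall a : 'I_k -> R,
    (forall v : phase, \sum_(j < k) a j * 'd (F j) z v = 0) ->
    forall j, a j = 0.

(* The integrals are required to exist on the whole of D; functional
   independence means independence of the differentials on a dense subset of D. *)
Definition liouville_integrable D H : Prop :=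
  exists F : 'I_k -> phase -> R,
    [/\ forall j, smooth D (F j),
        forall j z, D z -> poisson (F j) H z = 0,
        forall i j z, D z -> poisson (F i) (F j) z = 0
      & D `<=` closure (D `&` [set z | independent_at F z])].

End Liouville.

(* The choice of B is immaterial: changing the basis of W induces a linear
   symplectic change of the coordinates (x, p). *)
Definition restriction_integrable (R : realType) (N d : nat) (m : 'rV[R]_N)
    (W : set 'M[R]_(N, d)) : Prop :=
  exists (k : nat) (B : 'I_k -> 'M[R]_(N, d)),
    [/\ basis_of_set B W,
        invariant_subspace m W,
        kinetic_matrix m B \in unitmx
      & liouville_integrable (phase_space B) (restricted_hamiltonian m B)].

(* R_theta acts on column vectors; the rows of c are rotated by *m rotation^T. *)
Definition rotation (R : realType) (theta : R) : 'M[R]_2 :=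
  \matrix_(i < 2, j < 2)
    (if i == j then cos theta else if i == 0 then - sin theta else sin theta).

(* Main.v *)
From HB Require Import structures.
Require Import Defs.
From mathcomp Require Import ring lra.

(** Both restrictions reduce to explicit Hamiltonians of few degrees of freedom.

    For the five bodies, the four unit masses form a parallelogram with sides
    2s and 2t centred at the mass -1/4. The forces exerted by the central mass
    cancel those between opposite bodies, because
    - 2 (1/4) / |u| + 1 / |2u| = 0 on each half-diagonal u, and what remains is
    |p|^2 / 8 + 1/|s| + 1/|t|: two uncoupled planar Kepler problems, integrated
    by their two energies and their two angular momenta
    ([parallelogram_potential], [two_kepler_integrable]).

    For the ring, put the plane of c in complex notation, so that W is
    described by a complex number w (the ring is w c) and a height z (the two
    masses 4 alpha sit at z and - z). Being an absolute equilibrium, the ring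
    with its central mass exerts no force on itself, the central mass also
    cancels the force between the two axial masses, and with
    M = m_1 + ... + m_n and rho^2 = |w|^2 + z^2 one is left with
      H = |p_w|^2 / (2 M) + p_z^2 / (16 alpha) + 8 alpha M / rho
    ([ring_potential]). This is a Kepler problem only if M = 8 alpha; otherwise
    it is anisotropic. H and the angular momentum L about the axis are the
    obvious integrals; a third one is not given by a formula, but exists because
    collisions are removed from phase space: z never vanishes, so
    dp_z / dt = 8 alpha M z / rho^3 has a constant sign and no orbit recurs.

    The third integral is built in the invariants xi = |w|^2, eta = w.v,
    zeta = |v|^2, z and y = p_z / (8 alpha) of the rotations, v = p_w / M, with y
    as the time. A function with small support on a slice y = t0 is transported
    along the orbits and extended by 0 outside of the tube of orbits that meet
    its support. The result is smooth when that tube is closed, which is to say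
    when orbits between a neighbourhood of any point and the support stay in a
    compact set. As long as y keeps away from 0, energy and angular momentum
    give such a confinement ([curve_bounded]); the passage through y = 0 is
    dealt with by moving the slice slightly: near any point one finds another
    whose neighbours either never reach y = 0, or all cross it together
    ([proper_dense]). Smoothness of the transport is the smooth dependence of
    solutions on initial conditions, proved by induction on the order of
    differentiability through the tangent system ([flow_smooth]).

    At some point arbitrarily near any given one, such an integral varies along
    a vector that is tangent to the levels of H and of L
    ([good_integral_near]). Independence on a dense set then follows from adding
    countably many of them with coefficients decreasing fast enough for the
    series to be smooth, and chosen one after the other so as not to cancel any
    of these variations ([dense_gluing]). *)

Set Implicit Arguments.
Unset Strict Implicit.
Unset Printing Implicit Defensive.

Local Open Scope classical_set_scope.
Local Open Scope ring_scope.

(** * Calculus of smooth functions *)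

Section Differentiability.
Variables (R : realType) (E : normedModType R).
Implicit Types (f g : E -> R).

Lemma near_translate (z : E) (P : set E) :
  (\forall y \near z, P y) <-> (\forall h \near (0 : E), P (h + z)).
Proof. by rewrite (near_shift 0 z) subr0. Qed.

Lemma near_dist_lt (z : E) (e : R) : 0 < e -> \forall y \near z, `|y - z| < e.
Proof.
move=> e0; have /cvgrPdist_lt/(_ e e0) := @cvg_id _ (nbhs z).
by apply: filterS => y; rewrite distrC.
Qed.

(** Epsilon form of differentiability, through which the differentials of
    flows and of series are identified. *)
Lemma is_diff_eps (L : {linear E -> R}) f z : continuous L ->
  (forall e, 0 < e -> \forall y \near z,
     `|f y - f z - L (y - z)| <= e * `|y - z|) ->
  differentiable f z /\ 'd f z = L :> (E -> R).
Proof.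
move=> cL H.
have K : f \o shift z = cst (f z) + L +o_ 0 id.
  apply/eqaddoP => _/posnumP[e].
  have /near_translate := H e%:num ltac:(by []).
  by apply: filterS => h; rewrite addrK /= !fctE /cst opprD addrA.
have D := diff_unique cL K; split => //.
by apply/diff_locallyP; rewrite D.
Qed.

Lemma diff_eps f z : differentiable f z -> forall e, 0 < e ->
  \forall y \near z, `|f y - f z - 'd f z (y - z)| <= e * `|y - z|.
Proof.
move=> df e e0; apply/near_translate.
have /eqaddoP/(_ _ e0) := diff_locally df.
by apply: filterS => h; rewrite addrK /= !fctE /cst opprD addrA.
Qed.

Lemma near_eq_differentiable f g z :
  (\forall y \near z, f y = g y) -> differentiable f z -> differentiable g z.
Proof.
move=> fg df.
suff [] : differentiable g z /\ 'd g z = 'd f z :> (E -> R) by [].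
apply: is_diff_eps; first exact: diff_continuous.
move=> e e0; have fgz := nbhs_singleton fg.
near=> y; rewrite -fgz -(_ : f y = g y); last by near: y.
by near: y; exact: diff_eps.
Unshelve. all: by end_near. Qed.

End Differentiability.

Section ClassC.
Variables (R : realType) (E : normedModType R).
Implicit Types (D : set E) (f g : E -> R) (r : nat).

Lemma class_C_differentiable r D f z :
  class_C r.+1 D f -> D z -> differentiable f z.
Proof. by move=> [+ _]; apply. Qed.

Lemma class_C_derive r D f v : class_C r.+1 D f -> class_C r D ('D_v f).
Proof. by move=> [_]; apply. Qed.

Lemma class_C_continuous r D f z :
  class_C r D f -> D z -> {for z, continuous f}.
Proof.
case: r => [|r] Cf Dz; first exact: Cf.
exact/differentiable_continuous/(class_C_differentiable Cf).
Qed.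

Lemma class_CS r D f : class_C r.+1 D f -> class_C r D f.
Proof.
elim: r f => [|r IH] f Cf; first by move=> z; apply: class_C_continuous Cf.
by split=> [z|v]; [exact: class_C_differentiable Cf|exact/IH/class_C_derive].
Qed.

(** Functions defined piecewise over open sets are treated with this. *)
Lemma class_C_local r D f :
  (forall z, D z -> exists D', [/\ D' z, open D' & class_C r D' f]) ->
  class_C r D f.
Proof.
elim: r f => [|r IH] f H.
  by move=> z /H[D' [D'z _ Cf]]; exact: class_C_continuous Cf D'z.
split=> [z /H[D' [D'z _ Cf]]|v]; first exact: class_C_differentiable Cf D'z.
apply: IH => z /H[D' [D'z oD' Cf]]; exists D'; split=> //.
exact: class_C_derive.
Qed.

Lemma class_C_sub r D D' f : D' `<=` D -> class_C r D f -> class_C r D' f.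
Proof.
elim: r f => [|r IH] f sD Cf; first by move=> z Dz; apply: Cf; exact: sD.
split=> [z Dz|v]; first exact: (class_C_differentiable Cf (sD z Dz)).
by apply: IH => //; exact: class_C_derive.
Qed.

Lemma class_C_ext r D f g : open D -> (forall z, D z -> f z = g z) ->
  class_C r D f -> class_C r D g.
Proof.
move=> oD; elim: r f g => [|r IH] f g fg Cf.
  move=> z Dz; have /(_ _) Cz := Cf z Dz.
  rewrite /prop_for /continuous_at -fg //.
  apply: cvg_trans Cz; apply: near_eq_cvg.
  by apply: filterS (open_nbhs_nbhs (conj oD Dz)) => y /fg.
have fgz z : D z -> \forall y \near z, f y = g y.
  by move=> Dz; apply: filterS (open_nbhs_nbhs (conj oD Dz)) => y /fg.
split=> [z Dz|v].
  exact: near_eq_differentiable (fgz z Dz) (class_C_differentiable Cf Dz).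
apply: (IH ('D_v f)) => [z Dz|]; first exact: near_eq_derive (fgz z Dz).
exact: class_C_derive.
Qed.

Lemma class_C_cst r D (a : R) : class_C r D (fun=> a).
Proof.
elim: r a => [|r IH] a; first by move=> z _; exact: cst_continuous.
split=> [z _|v]; first exact: differentiable_cst.
by rewrite (_ : 'D_v _ = fun=> 0) //; apply/funext => z; exact: derive_cst.
Qed.

Lemma class_C_linear r D (L : {linear E -> R}) : open D ->
  continuous L -> class_C r D L.
Proof.
move=> oD cL; case: r => [|r]; first by move=> z _; exact: cL.
split=> [z _|v]; first exact: linear_differentiable.
apply: (@class_C_ext _ _ (fun=> L v)) => //; last exact: class_C_cst.
move=> z _; rewrite deriveE; last exact: linear_differentiable.
by rewrite diff_lin.
Qed.

Lemma class_CD r D f g : open D ->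
  class_C r D f -> class_C r D g -> class_C r D (fun z => f z + g z).
Proof.
move=> oD; elim: r f g => [|r IH] f g Cf Cg.
  by move=> z Dz; apply: cvgD; [exact: Cf|exact: Cg].
split=> [z Dz|v].
  by apply: differentiableD; [exact: (class_C_differentiable Cf)|exact: (class_C_differentiable Cg)].
apply: (@class_C_ext _ _ (fun z => 'D_v f z + 'D_v g z)) => //.
  by move=> z Dz; rewrite deriveD//; apply: diff_derivable;
     [exact: (class_C_differentiable Cf)|exact: (class_C_differentiable Cg)].
by apply: IH; exact: class_C_derive.
Qed.

Lemma class_CM r D f g : open D ->
  class_C r D f -> class_C r D g -> class_C r D (fun z => f z * g z).
Proof.
move=> oD; elim: r f g => [|r IH] f g Cf Cg.
  by move=> z Dz; apply: cvgM; [exact: Cf|exact: Cg].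
split=> [z Dz|v].
  by apply: differentiableM; [exact: (class_C_differentiable Cf)|exact: (class_C_differentiable Cg)].
apply: (@class_C_ext _ _ (fun z => f z * 'D_v g z + g z * 'D_v f z)) => //.
  by move=> z Dz; rewrite deriveM//; apply: diff_derivable;
     [exact: (class_C_differentiable Cf)|exact: (class_C_differentiable Cg)].
by apply: class_CD => //; apply: IH; (exact: class_C_derive || exact: class_CS).
Qed.

Lemma class_CZ r D (a : R) f : open D ->
  class_C r D f -> class_C r D (fun z => a * f z).
Proof. by move=> oD Cf; apply: class_CM => //; exact: class_C_cst. Qed.

Lemma class_CN r D f : open D -> class_C r D f -> class_C r D (fun z => - f z).
Proof.
move=> oD Cf; apply: (@class_C_ext _ _ (fun z => -1 * f z)) => //.
  by move=> z _; rewrite mulN1r.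
exact: class_CZ.
Qed.

Lemma class_CB r D f g : open D ->
  class_C r D f -> class_C r D g -> class_C r D (fun z => f z - g z).
Proof. by move=> oD Cf Cg; apply: class_CD => //; exact: class_CN. Qed.

Lemma class_CX r D n f : open D ->
  class_C r D f -> class_C r D (fun z => f z ^+ n).
Proof.
move=> oD Cf; elim: n => [|n IH]; first exact: class_C_cst.
apply: (@class_C_ext _ _ (fun z => f z * f z ^+ n)) => //.
  by move=> z _; rewrite exprS.
exact: class_CM.
Qed.

Lemma class_C_sum r D (I : Type) (s : seq I) (P : pred I) (F : I -> E -> R) :
  open D -> (forall i, P i -> class_C r D (F i)) ->
  class_C r D (fun z => \sum_(i <- s | P i) F i z).
Proof.
move=> oD CF; elim: s => [|i s IH].
  by apply: (@class_C_ext _ _ (fun=> 0)) => // [z _|]; [rewrite big_nil|exact: class_C_cst].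
have [Pi|nPi] := boolP (P i).
  apply: (@class_C_ext _ _ (fun z => F i z + \sum_(i <- s | P i) F i z)) => //.
    by move=> z _; rewrite big_cons Pi.
  by apply: class_CD => //; exact: CF.
apply: class_C_ext IH => // z _.
by rewrite big_cons (negbTE nPi).
Qed.

Lemma class_C_prod r D (I : Type) (s : seq I) (F : I -> E -> R) :
  open D -> (forall i, class_C r D (F i)) ->
  class_C r D (fun z => \prod_(i <- s) F i z).
Proof.
move=> oD CF; elim: s => [|i s IH].
  by apply: (@class_C_ext _ _ (fun=> 1)) => // [z _|]; [rewrite big_nil|exact: class_C_cst].
apply: (@class_C_ext _ _ (fun z => F i z * \prod_(i <- s) F i z)) => //.
  by move=> z _; rewrite big_cons.
by apply: class_CM => //; exact: CF.
Qed.

Lemma class_CV r D f : open D -> (forall z, D z -> f z != 0) ->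
  class_C r D f -> class_C r D (fun z => (f z)^-1).
Proof.
move=> oD f0; elim: r => [|r IH] Cf.
  by move=> z Dz; apply: cvgV; [exact: f0|exact: Cf].
split=> [z Dz|v].
  by apply: differentiableV; [exact: (class_C_differentiable Cf)|exact: f0].
apply: (@class_C_ext _ _ (fun z => - ((f z)^-1 * (f z)^-1 * 'D_v f z))) => //.
  move=> z Dz; rewrite deriveV ?f0//; last first.
    exact/diff_derivable/(class_C_differentiable Cf).
  by rewrite scaleNr -invfM -expr2.
apply: class_CN => //; apply: class_CM => //; last exact: class_C_derive.
by apply: class_CM => //; apply: IH; exact: class_CS.
Qed.

End ClassC.

Section ChainRule.
Variables (R : realType) (E F : normedModType R) (m : nat) (e : 'I_m -> F).

Lemma differentiable_lincomb (p : 'I_m -> E -> R) z :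
  (forall i, differentiable (p i) z) ->
  differentiable (fun x => \sum_i p i x *: e i) z /\
  forall v, 'D_v (fun x => \sum_i p i x *: e i) z = \sum_i 'D_v (p i) z *: e i.
Proof.
move=> dp.
have dpe i : differentiable (fun x => p i x *: e i) z by exact: differentiableZl.
have E1 : (fun x => \sum_i p i x *: e i) = \sum_i (fun x => p i x *: e i).
  by apply/funext => x; rewrite fct_sumE.
split; first by rewrite E1; exact: differentiable_sum.
move=> v; rewrite E1 derive_sum => [|i]; last exact: diff_derivable.
apply: eq_bigr => i _.
by rewrite deriveE// diffZl// deriveE.
Qed.

Lemma continuous_lincomb (p : 'I_m -> E -> R) z :
  (forall i, {for z, continuous (p i)}) ->
  {for z, continuous (fun x => \sum_i p i x *: e i)}.
Proof.
move=> cp; elim: (index_enum _) => [|i s IH].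
  rewrite (_ : (fun x => _) = cst 0); first exact: cst_continuous.
  by apply/funext => x; rewrite big_nil.
rewrite (_ : (fun x => _) = (fun x => p i x *: e i) \+
  (fun x => \sum_(j <- s) p j x *: e j)); last first.
  by apply/funext => x; rewrite big_cons.
apply: cvgD => //; apply: cvgZ; [exact: cp|exact: cvg_cst].
Qed.

(** Writing the inner map in a finite family of vectors makes its components
    ordinary real functions, so that the induction on r stays within real-valued
    functions. *)
Lemma class_C_comp r (D : set E) (D' : set F) (g : F -> R) (p : 'I_m -> E -> R) :
  open D -> (forall i, class_C r D (p i)) ->
  (forall z, D z -> D' (\sum_i p i z *: e i)) -> class_C r D' g ->
  class_C r D (fun z => g (\sum_i p i z *: e i)).
Proof.
move=> oD; elim: r g p => [|r IH] g p Cp sD Cg.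
  move=> z Dz.
  apply: (@continuous_comp _ _ _ (fun x => \sum_i p i x *: e i) g); last exact/Cg/sD.
  by apply: continuous_lincomb => i; exact: Cp.
have dp z : D z -> forall i, differentiable (p i) z.
  by move=> Dz i; exact: (class_C_differentiable (Cp i)).
have dg z : D z -> differentiable g (\sum_i p i z *: e i).
  by move=> Dz; exact: (class_C_differentiable Cg (sD z Dz)).
split=> [z Dz|v].
  apply: (@differentiable_comp _ _ _ _ (fun x => \sum_i p i x *: e i) g).
    by have [] := differentiable_lincomb (dp z Dz).
  exact: dg.
apply: (@class_C_ext _ _ _ _ (fun z => \sum_i 'D_v (p i) z * 'D_(e i) g (\sum_i p i z *: e i))) => //.
  move=> z Dz; have [dP DP] := differentiable_lincomb (dp z Dz).
  rewrite [RHS]deriveE; last exact: (differentiable_comp dP (dg z Dz)).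
  rewrite (diff_comp dP (dg z Dz)).
  rewrite /= -(deriveE v dP) DP linear_sum; apply: eq_bigr => i _.
  by rewrite linearZ /= (deriveE _ (dg z Dz)).
apply: class_C_sum => // i _; apply: class_CM => //; first exact: class_C_derive.
apply: (IH ('D_(e i) g) p) => // [j|]; [exact/class_CS/Cp|exact: class_C_derive].
Qed.

End ChainRule.

Section DeriveRules.
Variables (R : realType) (E : normedModType R).
Implicit Types (f g : E -> R) (x v : E) (a b : R).

Lemma is_derive_const x v a : is_derive x v (fun=> a) 0.
Proof. exact: (is_derive_cst a x v). Qed.

Lemma is_derive_add f g x v a b : is_derive x v f a -> is_derive x v g b ->
  is_derive x v (fun y => f y + g y) (a + b).
Proof. exact: is_deriveD. Qed.

Lemma is_derive_opp f x v a : is_derive x v f a ->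
  is_derive x v (fun y => - f y) (- a).
Proof. exact: is_deriveN. Qed.

Lemma is_derive_sub f g x v a b : is_derive x v f a -> is_derive x v g b ->
  is_derive x v (fun y => f y - g y) (a - b).
Proof. exact: is_deriveB. Qed.

Lemma is_derive_mul f g x v a b : is_derive x v f a -> is_derive x v g b ->
  is_derive x v (fun y => f y * g y) (a * g x + f x * b).
Proof.
move=> df dg; apply: (is_derive_eq (is_deriveM df dg)).
by rewrite addrC [X in X + _]mulrC.
Qed.

Lemma is_derive_scale f x v a b : is_derive x v f a ->
  is_derive x v (fun y => b * f y) (b * a).
Proof.
move=> df; apply: (is_derive_eq (is_derive_mul (is_derive_cst b x v) df)).
by rewrite mul0r add0r.
Qed.

Lemma is_derive_exp f n x v a : is_derive x v f a ->
  is_derive x v (fun y => f y ^+ n) (n%:R * f x ^+ n.-1 * a).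
Proof.
by move=> df; rewrite -exprfctE; exact: is_deriveX.
Qed.

Lemma is_derive_inv f x v a : f x != 0 -> is_derive x v f a ->
  is_derive x v (fun y => (f y)^-1) (- (f x ^- 2) * a).
Proof.
move=> f0 df; constructor; first by apply: derivableV => //; case: df.
by rewrite deriveV //; case: df => _ ->.
Qed.

Lemma is_derive_bigsum (I : Type) (s : seq I) (P : pred I) (F : I -> E -> R)
    (dF : I -> R) x v :
  (forall i, P i -> is_derive x v (F i) (dF i)) ->
  is_derive x v (fun y => \sum_(i <- s | P i) F i y) (\sum_(i <- s | P i) dF i).
Proof.
move=> dFi; elim: s => [|i s IH].
  rewrite big_nil (_ : (fun y => _) = cst 0); first exact: is_derive_cst.
  by apply/funext => y; rewrite big_nil.
have [Pi|nPi] := boolP (P i).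
  rewrite big_cons Pi (_ : (fun y => _) =
    (fun y => F i y + \sum_(i <- s | P i) F i y)).
    by apply: is_derive_add => //; exact: dFi.
  by apply/funext => y; rewrite big_cons Pi.
rewrite big_cons (negbTE nPi) (_ : (fun y => _) =
    (fun y => \sum_(i <- s | P i) F i y)) //.
by apply/funext => y; rewrite big_cons (negbTE nPi).
Qed.

Lemma is_derive_comp_real (g : R -> R) f x v a b :
  is_derive (f x) 1 g b -> differentiable f x -> is_derive x v f a ->
  is_derive x v (fun y => g (f y)) (b * a).
Proof.
move=> dg df dfa; have dg' : differentiable g (f x).
  by apply/derivable1_diffP; case: dg.
have D := differentiable_comp df dg'.
apply: DeriveDef; first exact: diff_derivable.
rewrite deriveE// diff_comp//= -(deriveE v df) (@derive_val _ _ _ _ _ _ _ dfa).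
rewrite -[X in 'd g _ X]mulr1 -[X in 'd g _ X]/(a *: (1 : R)) linearZ /=.
by rewrite -(deriveE _ dg') (@derive_val _ _ _ _ _ _ _ dg) [LHS]mulrC.
Qed.

Lemma is_derive_diff f x v : differentiable f x ->
  is_derive x v f ('d f x v).
Proof.
by move=> df; apply: DeriveDef; [exact: diff_derivable|rewrite deriveE].
Qed.

Lemma is_derive_linear (L : {linear E -> R}) x v : continuous L ->
  is_derive x v L (L v).
Proof.
move=> cL; have dL := linear_differentiable x cL.
by apply: (is_derive_eq (is_derive_diff v dL)); rewrite diff_lin.
Qed.

End DeriveRules.

Section RealVariable.
Variable R : realType.
Implicit Types (D : set R) (f df : R -> R).

Lemma class_C_is_derive r D f df : open D ->
  (forall x, D x -> is_derive x 1 f (df x)) ->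
  class_C r D df -> class_C r.+1 D f.
Proof.
move=> oD fdf Cdf; have dff x : D x -> differentiable f x.
  by move=> /fdf[? _]; exact/derivable1_diffP.
split=> // v; apply: (@class_C_ext _ _ _ _ (fun x => v * df x)) => //; last exact: class_CZ.
move=> x Dx; rewrite deriveE; last exact: dff.
rewrite -[X in 'd f x X]mulr1 [LHS](_ : _ = v *: (df x)) // -[v * 1]/(v *: (1 : R)) linearZ.
by rewrite -deriveE ?(@derive_val _ _ _ _ _ _ _ (fdf x Dx))//; exact: dff.
Qed.

Lemma class_C_id r D : open D -> class_C r D (fun x : R => x).
Proof.
move=> oD; case: r => [|r]; first by move=> x _; exact: cvg_id.
apply: (@class_C_is_derive _ _ _ (fun=> 1)) => //; exact: class_C_cst.
Qed.

Lemma class_C_comp_real (E : normedModType R) r (D : set E) (D' : set R)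
    (g : R -> R) (p : E -> R) :
  open D -> class_C r D p -> (forall z, D z -> D' (p z)) -> class_C r D' g ->
  class_C r D (fun z => g (p z)).
Proof.
move=> oD Cp sD Cg.
have pE z : \sum_(i < 1) p z *: (1 : R) = p z.
  by rewrite big_ord1 -[_ *: _]/(p z * 1) mulr1.
apply: (@class_C_ext _ _ _ _ (fun z => g (\sum_(i < 1) p z *: (1 : R)))) => //.
  by move=> z _; rewrite pE.
apply: (@class_C_comp _ E R 1 (fun=> 1) r D D' g (fun=> p)) => // z Dz.
by rewrite pE; exact: sD.
Qed.

Lemma class_C_comp_rV (E : normedModType R) n r (D : set E) (D' : set 'rV[R]_n)
    (g : 'rV[R]_n -> R) (p : 'I_n -> E -> R) :
  open D -> (forall i, class_C r D (p i)) ->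
  (forall z, D z -> D' (\row_i p i z)) -> class_C r D' g ->
  class_C r D (fun z => g (\row_i p i z)).
Proof.
move=> oD Cp sD Cg.
have pE z : \sum_i p i z *: delta_mx 0 i = \row_i p i z.
  by rewrite [RHS]row_sum_delta; apply: eq_bigr => i _; rewrite mxE.
apply: (@class_C_ext _ _ _ _ (fun z => g (\sum_i p i z *: delta_mx 0 i))) => //.
  by move=> z _; rewrite pE.
apply: (@class_C_comp _ E _ n (fun i => delta_mx 0 i) r D D' g p) => // z Dz.
by rewrite pE; exact: sD.
Qed.

Lemma class_C_sqrt r : class_C r [set x : R | 0 < x] Num.sqrt.
Proof.
have oD : open [set x : R | 0 < x] by exact: open_gt.
elim: r => [|r IH]; first by move=> x _; exact: sqrt_continuous.
apply: (@class_C_is_derive _ _ _ (fun x => (2 * Num.sqrt x)^-1)) => //.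
apply: class_CV => // [z z0|]; last exact: class_CZ.
by rewrite mulf_neq0// gt_eqF// sqrtr_gt0.
Qed.

(** The functions x^-n exp(-1/x), extended by 0 to x <= 0: the family is
    closed under differentiation up to linear combinations, which makes each
    of its members smooth. *)
Definition flat n (x : R) : R := if 0 < x then x^-1 ^+ n * expR (- x^-1) else 0.

Lemma flat_ge0 n x : 0 <= flat n x.
Proof.
rewrite /flat; case: ifPn => // x0.
by rewrite mulr_ge0 ?expR_ge0// exprn_ge0// invr_ge0 ltW.
Qed.

Lemma flat_gt0 n x : 0 < x -> 0 < flat n x.
Proof. by move=> x0; rewrite /flat x0 mulr_gt0 ?expR_gt0// exprn_gt0// invr_gt0. Qed.

Lemma flat_le0 n x : x <= 0 -> flat n x = 0.
Proof. by rewrite /flat leNgt => /negbTE->. Qed.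

(** From exp(1/x) >= (1/x)^(n+2) / (n+2)!; it makes [flat n] differentiable
    at 0. *)
Lemma flat_le n x : flat n x <= n.+2`!%:R * x ^+ 2.
Proof.
rewrite /flat; case: ifPn => [x0|_]; last by rewrite mulr_ge0 ?sqr_ge0.
have u0 : 0 < x^-1 by rewrite invr_gt0.
have := @expR_ge1Dxn _ x^-1 n.+1 (ltW u0) => H.
rewrite expRN ler_pdivrMr ?expR_gt0//.
have H2 : x^-1 ^+ n.+2 / n.+2`!%:R <= expR x^-1 by apply: le_trans H; rewrite lerDr.
have f0 : 0 < n.+2`!%:R :> R by rewrite ltr0n fact_gt0.
rewrite ler_pdivrMr// in H2.
have -> : x^-1 ^+ n = x^-1 ^+ n.+2 * x ^+ 2.
  by rewrite -addn2 exprD -mulrA -exprMn mulVf ?gt_eqF// expr1n mulr1.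
rewrite (_ : n.+2`!%:R * x ^+ 2 * _ = expR x^-1 * n.+2`!%:R * x ^+ 2); last by ring.
by rewrite ler_wpM2r ?sqr_ge0.
Qed.

Lemma flat_is_derive n (x : R) :
  is_derive x 1 (flat n) (flat n.+2 x - n%:R * flat n.+1 x).
Proof.
have [x0|x0|->] := ltgtP x 0.
- rewrite !flat_le0 ?(ltW x0)// mulr0 subr0.
  have H : \forall y \near x, (cst 0 : R -> R) y = flat n y.
    by near=> y; rewrite flat_le0//; apply/ltW; near: y; exact: lt_nbhsl.
  exact: (near_eq_is_derive H (is_derive_cst _ _ _)).
- have H : \forall y \near x, (fun y => y^-1 ^+ n * expR (- y^-1)) y = flat n y.
    by near=> y; rewrite /flat ifT//; near: y; exact: lt_nbhsr.
  apply: (near_eq_is_derive H).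
  have xn0 : x != 0 by rewrite gt_eqF.
  have dV : is_derive x 1 (fun y : R => y^-1) (- (x ^- 2) * 1).
    by apply: is_derive_inv => //; exact: is_derive_id.
  apply: (is_derive_eq (is_derive_mul (is_derive_exp n dV)
    (is_derive_comp_real (is_derive_expR _) _ (is_derive_opp dV)))).
    by apply: differentiableN; apply: differentiable_Rinv.
  rewrite /flat x0 -exprVn; case: (n) => [|k] /=; rewrite ?exprS ?expr0.
    by ring.
  by rewrite -[in RHS]natr1; ring.
- rewrite !flat_le0// mulr0 subr0.
  pose Z := [the {linear R -> R} of \0].
  have [df Df] : differentiable (flat n) 0 /\ 'd (flat n) 0 = Z :> (R -> R).
    apply: is_diff_eps; first exact: cst_continuous.
    move=> e e0; near=> y; rewrite (flat_le0 n (lexx 0)) /= !subr0 ger0_norm ?flat_ge0//.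
    apply: le_trans (flat_le n y) _.
    rewrite -[in leLHS]real_normK ?num_real// expr2 mulrA ler_wpM2r//.
    have f0 : 0 < n.+2`!%:R :> R by rewrite ltr0n fact_gt0.
    rewrite mulrC -ler_pdivlMr//; near: y.
    by apply: (@nbhs0_le _ R^o); rewrite divr_gt0.
  by apply: (is_derive_eq (is_derive_diff _ df)); rewrite Df.
Unshelve. all: by end_near. Qed.

Lemma class_C_flat r n : class_C r setT (flat n).
Proof.
have oT := @openT R.
elim: r n => [|r IH] n.
  move=> x _; have [dx _] := flat_is_derive n x.
  exact/differentiable_continuous/derivable1_diffP.
apply: (@class_C_is_derive _ _ _ (fun x => flat n.+2 x - n%:R * flat n.+1 x)) => //.
  by move=> x _; exact: flat_is_derive.
by apply: class_CB => //; apply: class_CZ.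
Qed.

Definition ramp (x : R) : R := flat 0 x / (flat 0 x + flat 0 (1 - x)).

Lemma ramp_le0 x : x <= 0 -> ramp x = 0.
Proof. by move=> x0; rewrite /ramp flat_le0// mul0r. Qed.

Lemma ramp_den_gt0 x : 0 < flat 0 x + flat 0 (1 - x).
Proof.
have [x0|x0] := ltP 0 x; first by rewrite ltr_wpDr ?flat_ge0// flat_gt0.
by rewrite ltr_wpDl ?flat_ge0// flat_gt0//; lra.
Qed.

Lemma ramp_ge1 x : 1 <= x -> ramp x = 1.
Proof.
move=> x1; rewrite /ramp [flat 0 (1 - x)]flat_le0; last by lra.
by rewrite addr0 divff// gt_eqF// flat_gt0; lra.
Qed.

Lemma ramp_gt0 x : 0 < x -> 0 < ramp x.
Proof. by move=> x0; rewrite divr_gt0 ?ramp_den_gt0// flat_gt0. Qed.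

Lemma class_C_ramp r : class_C r setT ramp.
Proof.
have oT := @openT R.
have C1 : class_C r setT (fun x : R => flat 0 (1 - x)).
  apply: (@class_C_comp_real _ _ _ setT) => //; last exact: class_C_flat.
  apply: class_CB => //; first exact: class_C_cst.
  exact: class_C_id.
apply: class_CM => //; first exact: class_C_flat.
apply: class_CV => // [z _|]; first by rewrite gt_eqF// ramp_den_gt0.
by apply: class_CD => //; exact: class_C_flat.
Qed.

End RealVariable.

(** * Functions of one variable *)

Section OneVariable.
Variable R : realType.
Implicit Types (f g u w : R -> R).

Lemma is_derive_continuous f (x a : R) : is_derive x 1 f a -> {for x, continuous f}.
Proof. by case=> dx _; exact/differentiable_continuous/derivable1_diffP. Qed.

Lemma MVT_le f df (a b : R) : a <= b ->
  (forall x, a <= x <= b -> is_derive x 1 f (df x)) ->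
  exists2 c, a <= c <= b & f b - f a = df c * (b - a).
Proof.
move=> ab dfx.
have H1 x : x \in `]a, b[%R -> is_derive x 1 f (df x).
  by rewrite in_itv/= => /andP[ax xb]; apply: dfx; rewrite !ltW.
have H2 : {within `[a, b], continuous f}.
  apply: derivable_within_continuous => x; rewrite in_itv/= => xab.
  by case: (dfx x xab).
by have [c] := MVT_segment ab H1 H2; rewrite in_itv/= => cab E; exists c.
Qed.

Lemma is_derive_cst_segment f (a b : R) : a <= b ->
  (forall x, a <= x <= b -> is_derive x 1 f 0) -> f b = f a.
Proof.
move=> ab df; have [c _ E] := @MVT_le f (fun=> 0) a b ab df.
by apply/eqP; rewrite -subr_eq0 E mul0r.
Qed.

Lemma is_derive_nondecreasing f df (a b : R) : a <= b ->
  (forall x, a <= x <= b -> is_derive x 1 f (df x) /\ 0 <= df x) -> f a <= f b.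
Proof.
move=> ab H; have [|c /H[_ c0] E] := @MVT_le f df a b ab; first by move=> x /H[].
by rewrite -subr_ge0 E mulr_ge0// subr_ge0.
Qed.

(** Both w - u and w + u are nondecreasing. *)
Lemma is_derive_majorant u du w dw (T : R) : 0 <= T ->
  (forall s, 0 <= s <= T -> is_derive s 1 u (du s)) ->
  (forall s, 0 <= s <= T -> is_derive s 1 w (dw s)) ->
  (forall s, 0 <= s <= T -> `|du s| <= dw s) ->
  `|u 0| <= w 0 -> `|u T| <= w T.
Proof.
move=> T0 hu hw hle; rewrite !ler_norml => /andP[u0 u1].
have D1 : w 0 - u 0 <= w T - u T.
  apply: (@is_derive_nondecreasing (fun s => w s - u s) (fun s => dw s - du s)) => // s sT; split.
    by apply: is_derive_sub; [exact: hw|exact: hu].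
  by have := hle s sT; rewrite ler_norml subr_ge0 => /andP[_].
have D2 : w 0 + u 0 <= w T + u T.
  apply: (@is_derive_nondecreasing (fun s => w s + u s) (fun s => dw s + du s)) => // s sT; split.
    by apply: is_derive_add; [exact: hw|exact: hu].
  by have := hle s sT; rewrite ler_norml => /andP[]; lra.
by apply/andP; split; lra.
Qed.

Lemma is_derive_reverse f (x a : R) : is_derive (- x) 1 f a ->
  is_derive x 1 (fun y => f (- y)) (- a).
Proof.
move=> df; have dN : is_derive x 1 (fun y : R => - y) (- 1).
  by apply: is_derive_opp; exact: is_derive_id.
apply: (is_derive_eq (@is_derive_comp_real R R f (fun y => - y) x 1 _ _ df _ dN)).
  by apply/derivable1_diffP; case: dN.
by rewrite mulrN1.
Qed.

Let mu := @lebesgue_measure R.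

(** The integral from - m is differentiable on both sides of 0; subtracting
    its value at 0 makes the primitives for different m agree. *)
Lemma local_primitive g (m : R) : 0 < m -> continuous g ->
  exists F : R -> R, F 0 = 0 /\ forall x : R, - m < x < m -> is_derive x 1 F (g x).
Proof.
move=> m0 cg.
pose F x := (\int[mu]_(t in `[(- m), x]) g t)%R.
have dF (x : R) : - m < x < m -> is_derive x 1 F (g x).
  move=> /andP[mx xm].
  have ig : mu.-integrable `[(- m), m] (EFin \o g).
    apply: continuous_compact_integrable; first exact: segment_compact.
    exact: continuous_subspaceT.
  have [d1 d2] := continuous_FTC1_closed xm ig mx (cg x).
  by constructor; [exact: d1|rewrite -derive1E; exact: d2].
exists (fun x => F x - F 0); split; first by rewrite subrr.
move=> x /dF dFx; apply: (is_derive_eq (is_derive_sub dFx (is_derive_cst _ _ _))).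
by rewrite subr0.
Qed.

Lemma primitive_exists g : continuous g ->
  exists G : R -> R, G 0 = 0 /\ forall x : R, is_derive x 1 G (g x).
Proof.
move=> cg.
have /choice[F HF] (m : R) : exists F : R -> R, 0 < m ->
    F 0 = 0 /\ forall x : R, - m < x < m -> is_derive x 1 F (g x).
  have [m0|_] := ltP 0 m; last by exists g.
  by have [F HF] := local_primitive m0 cg; exists F.
have F0 m : 0 < m -> F m 0 = 0 by move=> /HF[].
have dF m (x : R) : 0 < m -> - m < x < m -> is_derive x 1 (F m) (g x).
  by move=> /HF[_ +]; apply.
have same m m' x : 0 < m -> 0 < m' -> - m < x < m -> - m' < x < m' -> F m x = F m' x.
  move=> m0 m0' xm xm'; apply/eqP; rewrite -subr_eq0; apply/eqP.
  have dD (y : R) : - m < y < m -> - m' < y < m' ->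
      is_derive y 1 (fun y => F m y - F m' y) 0.
    move=> ym ym'; apply: (is_derive_eq (is_derive_sub (dF m y m0 ym) (dF m' y m0' ym'))).
    by rewrite subrr.
  have z0 : F m 0 - F m' 0 = 0 by rewrite !F0// subrr.
  have [x0|x0] := leP 0 x.
    rewrite -[RHS]z0; apply: (@is_derive_cst_segment (fun y => F m y - F m' y)) => // y Hy.
    by apply: dD; lra.
  rewrite -[RHS]z0; apply/esym/(@is_derive_cst_segment (fun y => F m y - F m' y)); first exact: ltW.
  by move=> y Hy; apply: dD; lra.
exists (fun x => F (`|x| + 1) x); split; first by rewrite F0// ltr_wpDl.
move=> x; have m0 : 0 < `|x| + 2 by rewrite ltr_wpDl.
have xm : - (`|x| + 2) < x < `|x| + 2.
  by have := lexx `|x|; rewrite ler_norml => /andP[]; lra.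
apply: near_eq_is_derive (dF _ x m0 xm).
near=> y.
have xy : `|x - y| < 1 by near: y; exact: nbhsx_ballx.
have y0 : 0 < `|y| + 1 by rewrite ltr_wpDl.
have := lexx `|x|; have := lexx `|y|; move: xy.
rewrite !ler_norml ltr_norml => /andP[? ?] /andP[? ?] /andP[? ?].
by apply: same => //; lra.
Unshelve. all: by end_near. Qed.

Definition primitive g : R -> R :=
  xget (fun=> 0) [set G | G 0 = 0 /\ forall x : R, is_derive x 1 G (g x)].

Lemma primitiveP g : continuous g ->
  primitive g 0 = 0 /\ forall x : R, is_derive x 1 (primitive g) (g x).
Proof.
move=> /primitive_exists[G HG]; rewrite /primitive.
by case: xgetP => [F _ //|/(_ G)]; case: HG => h1 h2 /(_ (conj h1 h2)).
Qed.

(** The weight exp(K |t|) makes integration a contraction with factor 1/K,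
    on any time interval. *)
Lemma primitive_exp_bound g (A K T t : R) : 0 < K -> continuous g -> `|t| <= T ->
  (forall s, `|s| <= T -> `|g s| <= A * expR (K * `|s|)) ->
  `|primitive g t| <= A / K * expR (K * `|t|).
Proof.
move=> K0 cg tT bg; have [P0 dP] := primitiveP cg.
have A0 : 0 <= A.
  have /bg : `|0 : R| <= T by rewrite normr0 (le_trans _ tT).
  by rewrite normr0 mulr0 expR0 mulr1; apply: le_trans.
have dw (s : R) : is_derive s 1 (fun s => A / K * expR (K * s)) (A * expR (K * s)).
  have dK : is_derive s 1 (fun s : R => K * s) (K * 1).
    by apply: is_derive_scale; exact: is_derive_id.
  apply: (is_derive_eq (is_derive_scale (A / K) (is_derive_comp_real (is_derive_expR _) _ dK))).
    by apply/derivable1_diffP; case: dK.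
  by field; rewrite gt_eqF.
have [t0|t0] := leP 0 t.
  rewrite ger0_norm// in tT *.
  apply: (@is_derive_majorant _ _ (fun s => A / K * expR (K * s)) _ t t0
    (fun s _ => dP s) (fun s _ => dw s)).
    move=> s /andP[s0 st]; have := bg s; rewrite ger0_norm//; apply.
    exact: le_trans tT.
  by rewrite P0 normr0 mulr_ge0 ?expR_ge0// divr_ge0// ltW.
rewrite ltr0_norm// in tT *.
have H := @is_derive_majorant (fun s => primitive g (- s)) (fun s => - g (- s))
  (fun s => A / K * expR (K * s)) (fun s => A * expR (K * s)) (- t) _ _ (fun s _ => dw s).
rewrite -[X in primitive g X]opprK; apply: H.
- by rewrite oppr_ge0 ltW.
- by move=> s _; apply: is_derive_reverse; exact: dP.
- move=> s /andP[s0 st]; rewrite normrN; have := bg (- s); rewrite normrN ger0_norm//.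
  by apply; exact: le_trans tT.
by rewrite oppr0 P0 normr0 mulr_ge0 ?expR_ge0// divr_ge0// ltW.
Qed.

Lemma primitive_sub g1 g2 t : continuous g1 -> continuous g2 ->
  primitive g1 t - primitive g2 t = primitive (fun s => g1 s - g2 s) t.
Proof.
move=> c1 c2; have c12 : continuous (fun s => g1 s - g2 s).
  by move=> x; apply: cvgB; [exact: c1|exact: c2].
have [P1 d1] := primitiveP c1; have [P2 d2] := primitiveP c2.
have [P3 d3] := primitiveP c12.
pose h s := primitive g1 s - primitive g2 s - primitive (fun s => g1 s - g2 s) s.
have dh (s : R) : is_derive s 1 h 0.
  by apply: (is_derive_eq (is_derive_sub (is_derive_sub (d1 s) (d2 s)) (d3 s))); rewrite subrr.
by apply/eqP; rewrite -subr_eq0 -/(h t) (is_derive_0_is_cst t 0 dh) /h P1 P2 P3 !subrr.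
Qed.

End OneVariable.

(** * Row vectors and the Gronwall inequality *)

Section RowVectors.
Variables (R : realType) (n : nat).
Implicit Types (x : 'rV[R]_n).

Lemma rV_norm_coord x i : `|x 0 i| <= `|x|.
Proof.
rewrite [leRHS]/Num.Def.normr/= mx_normrE.
exact: (le_bigmax _ (fun ij : 'I_1 * 'I_n => `|x ij.1 ij.2|) (0, i)).
Qed.

Lemma rV_norm_le x (a : R) : 0 <= a -> (forall i, `|x 0 i| <= a) -> `|x| <= a.
Proof.
move=> a0 xa; rewrite [leLHS]/Num.Def.normr/= mx_normrE.
by apply: bigmax_le => // -[i j] _ /=; rewrite ord1.
Qed.

Lemma rV_norm_lt x (a : R) : 0 < a -> (forall i, `|x 0 i| < a) -> `|x| < a.
Proof.
move=> a0 xa; rewrite [ltLHS]/Num.Def.normr/= mx_normrE.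
by apply: bigmax_lt => // -[i j] _ /=; rewrite ord1.
Qed.

Lemma rV_norm_sqr x : `|x| ^+ 2 <= \sum_i x 0 i ^+ 2.
Proof.
have s0 : 0 <= \sum_i x 0 i ^+ 2 by apply: sumr_ge0 => i _; exact: sqr_ge0.
rewrite -[leRHS]sqr_sqrtr// lerXn2r ?nnegrE// ?sqrtr_ge0//.
apply: rV_norm_le => [|i]; first exact: sqrtr_ge0.
rewrite -sqrtr_sqr ler_wsqrtr// (bigD1 i)//= lerDl.
by apply: sumr_ge0 => j _; exact: sqr_ge0.
Qed.

Lemma rV_continuous_coord i : continuous (fun x : 'rV[R]_n => x 0 i).
Proof. by move=> x; exact: coord_continuous. Qed.

Lemma is_derive_coord (x v : 'rV[R]_n) i :
  is_derive x v (fun y : 'rV[R]_n => y 0 i) (v 0 i).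
Proof.
have d := @derivable_id R 'rV[R]_n x v.
apply: DeriveDef; first exact: (derivable_mxP id x v).1.
by have := @derive_id R 'rV[R]_n x v; rewrite derive_mx// => /rowP/(_ i); rewrite mxE.
Qed.

Lemma is_derive_rV_continuous (e de : R -> 'rV[R]_n) (t : R) :
  (forall i, is_derive t 1 (fun s => e s 0 i) (de t 0 i)) -> {for t, continuous e}.
Proof.
move=> He; have De : derivable e t 1.
  by apply/derivable_mxP => i j; rewrite ord1; case: (He j).
by apply: differentiable_continuous; exact/derivable1_diffP.
Qed.

End RowVectors.

Section Gronwall.
Variables (R : realType) (n : nat).

(** The sup norm is not differentiable, so the estimate is carried out on
    the square of the Euclidean norm plus eps^2, whose logarithmic derivative is
    at most n (2 K + 1). The constant does not depend on the curve, which makes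
    the estimates below uniform in the initial condition. *)
Lemma gronwall (K T : R) : 0 <= K -> exists2 C, 0 < C &
  forall (e de : R -> 'rV[R]_n) (eps : R), 0 <= eps ->
    (forall t : R, 0 <= t <= T -> forall i,
       is_derive t 1 (fun s => e s 0 i) (de t 0 i)) ->
    (forall t : R, 0 <= t <= T -> `|de t| <= K * `|e t| + eps) ->
    forall t, 0 <= t <= T -> `|e t| <= C * (`|e 0| + eps).
Proof.
move=> K0; pose c := n%:R * (2 * K + 1); pose A := n.+1%:R * expR (c * T).
have c0 : 0 <= c by rewrite mulr_ge0// addr_ge0// mulr_ge0.
have A0 : 0 < A by rewrite mulr_gt0 ?expR_gt0.
exists (Num.sqrt A); first by rewrite sqrtr_gt0.
move=> e de eps eps0 He Hle t tT.
have t0 : 0 <= t by case/andP: tT.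
pose S s := \sum_i e s 0 i ^+ 2 + eps ^+ 2.
pose dS s := \sum_i (2 * e s 0 i ^+ 1 * de s 0 i) + 0.
have S_ge s : `|e s| ^+ 2 + eps ^+ 2 <= S s by rewrite lerD2r rV_norm_sqr.
have dSE (s : R) : 0 <= s <= t -> is_derive s 1 S (dS s).
  move=> /andP[s0 st]; have sT : 0 <= s <= T by case/andP: tT => _; lra.
  apply: is_derive_add.
  apply: is_derive_bigsum => i _.
  exact: (@is_derive_exp _ _ (fun s => e s 0 i) 2 s 1 _ (He s sT i)).
have dSle s : 0 <= s <= t -> dS s <= c * S s.
  move=> /andP[s0 st]; have sT : 0 <= s <= T by case/andP: tT => _; lra.
  rewrite /dS addr0 /c -mulrA mulr_natl.
  have -> : ((2 * K + 1) * S s) *+ n = \sum_(i < n) (2 * K + 1) * S s.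
    by rewrite sumr_const card_ord.
  apply: ler_sum => i _; rewrite expr1.
  apply: le_trans (_ : 2 * `|e s| * (K * `|e s| + eps) <= _).
    apply: le_trans (ler_norm _) _; rewrite !normrM ger0_norm//.
    apply: ler_pM => //; first by rewrite ler_wpM2l// rV_norm_coord.
    by apply: le_trans (Hle s sT); exact: rV_norm_coord.
  apply: le_trans (_ : (2 * K + 1) * (`|e s| ^+ 2 + eps ^+ 2) <= _).
    have : 0 <= K * eps ^+ 2 by rewrite mulr_ge0// sqr_ge0.
    have := sqr_ge0 (`|e s| - eps); nra.
  by rewrite ler_wpM2l// addr_ge0// mulr_ge0.
have dexp (s : R) : is_derive s 1 (fun s => expR (- c * s)) (expR (- c * s) * (- c)).
  have dK : is_derive s 1 (fun s : R => - c * s) (- c * 1).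
    by apply: is_derive_scale; exact: is_derive_id.
  apply: (is_derive_eq (is_derive_comp_real (is_derive_expR _) _ dK)).
    by apply/derivable1_diffP; case: dK.
  by rewrite mulr1.
pose F s := - (expR (- c * s) * S s).
pose dF s := - (expR (- c * s) * (- c) * S s + expR (- c * s) * dS s).
have dFE (s : R) : 0 <= s <= t -> is_derive s 1 F (dF s) /\ 0 <= dF s.
  move=> st; split.
    by apply: is_derive_opp; apply: is_derive_mul => //; exact: dSE.
  rewrite /dF -mulrA -mulrDr -mulrN mulr_ge0 ?expR_ge0//.
  by have := dSle s st; lra.
have mono : F 0 <= F t := is_derive_nondecreasing t0 dFE.
have S0 : S 0 <= n.+1%:R * (`|e 0| + eps) ^+ 2.
  have h1 : \sum_i e 0 0 i ^+ 2 <= n%:R * `|e 0| ^+ 2.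
    rewrite mulr_natl -[n in _ *+ n]card_ord -sumr_const; apply: ler_sum => i _.
    by rewrite -real_normK ?num_real// lerXn2r ?nnegrE// rV_norm_coord.
  have h2 : n%:R * `|e 0| ^+ 2 <= n%:R * (`|e 0| + eps) ^+ 2.
    by rewrite ler_wpM2l// lerXn2r ?nnegrE// ?addr_ge0// lerDl.
  rewrite /S -natr1 mulrDl mul1r; apply: lerD; first exact: le_trans h2.
  by rewrite lerXn2r ?nnegrE// ?addr_ge0// lerDr.
rewrite /F mulr0 expR0 mul1r lerN2 mulNr expRN ler_pdivrMl ?expR_gt0// in mono.
have St : `|e t| ^+ 2 <= A * (`|e 0| + eps) ^+ 2.
  apply: le_trans (_ : S t <= _).
    by apply: le_trans (S_ge t); rewrite lerDl sqr_ge0.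
  apply: (le_trans mono); rewrite /A.
  apply: le_trans (_ : expR (c * t) * (n.+1%:R * (`|e 0| + eps) ^+ 2) <= _).
    by rewrite ler_wpM2l// expR_ge0.
  rewrite mulrCA mulrA ler_wpM2r ?sqr_ge0// ler_wpM2l// ler_expR ler_wpM2l//.
  by case/andP: tT.
have e0 : 0 <= `|e 0| + eps by rewrite addr_ge0.
rewrite -ler_sqr ?nnegrE// ?mulr_ge0 ?sqrtr_ge0//.
by rewrite exprMn sqr_sqrtr// ltW.
Qed.

End Gronwall.

(** * Ordinary differential equations *)

Section GeometricLimits.
Variable R : realType.
Implicit Types (u : nat -> R) (C : R).

Lemma ler_mul_expR (a x : R) : 0 <= a -> 0 <= x -> a <= a * expR x.
Proof.
move=> a0 x0; have := ler_wpM2l a0 (le_trans _ (expR_ge1Dx x)).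
by move=> /(_ 1); rewrite mulr1; apply; rewrite lerDl.
Qed.

Lemma geometric_null C (a : R) : (forall k, `|a| <= C / 2 ^+ k) -> a = 0.
Proof.
move=> H; apply/eqP; rewrite -normr_eq0; apply/eqP/le_anti; rewrite normr_ge0 andbT.
have C0 : 0 <= C by have := H 0%N; rewrite expr0 divr1; apply: le_trans.
rewrite leNgt; apply/negP => a0.
have [k Hk] : exists k, C / `|a| < 2 ^+ k.
  exists (Num.bound (C / `|a|)); have := archi_boundP (divr_ge0 C0 (normr_ge0 a)).
  move=> /lt_le_trans; apply; rewrite -natrX ler_nat.
  exact/ltnW/ltn_expl.
have := H k; rewrite ler_pdivlMr ?exprn_gt0// leNgt mulrC => /negP; apply.
by rewrite -ltr_pdivrMr.
Qed.

(** u k - 2 C / 2^k increases and u k + 2 C / 2^k decreases. *)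
Lemma geometric_limn u C : (forall k, `|u k.+1 - u k| <= C / 2 ^+ k) ->
  u @ \oo --> limn u /\ forall k, `|u k - limn u| <= 2 * C / 2 ^+ k.
Proof.
move=> H; have C0 : 0 <= C by have := H 0%N; rewrite expr0 divr1; apply: le_trans.
pose v k := u k - 2 * C / 2 ^+ k; pose w k := u k + 2 * C / 2 ^+ k.
have e2 k : 2 * C / 2 ^+ k = 2 * (2 * C / 2 ^+ k.+1).
  by rewrite exprS; field; rewrite expf_neq0.
have e1 k : C / 2 ^+ k = 2 * C / 2 ^+ k.+1.
  by rewrite exprS; field; rewrite expf_neq0.
have vS k : v k <= v k.+1.
  by have := H k; rewrite ler_norml /v (e1 k) (e2 k); set d := _ / _ => /andP[? ?]; lra.
have wS k : w k.+1 <= w k.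
  by have := H k; rewrite ler_norml /w (e1 k) (e2 k); set d := _ / _ => /andP[? ?]; lra.
have vm : {homo v : m n / (m <= n)%N >-> m <= n} by apply: homo_leq => // y x z; apply: le_trans.
have wm m n : (m <= n)%N -> w n <= w m.
  move=> /subnK <-; elim: (n - m)%N => [|k IH]; first by rewrite add0n.
  by rewrite addSn; exact: le_trans (wS _) IH.
have vw j k : v j <= w k.
  apply: le_trans (vm _ _ (leq_maxl j k)) _; apply: le_trans _ (wm _ _ (leq_maxr j k)).
  rewrite /v /w lerD2l; have : 0 <= 2 * C / 2 ^+ maxn j k.
    by rewrite divr_ge0 ?mulr_ge0// exprn_ge0.
  by lra.
pose l := sup (range v).
have hs : has_sup (range v) by split; [exists (v 0%N), 0%N|exists (w 0%N) => _ [k _ <-]].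
have vl k : v k <= l by apply: sup_upper_bound => //; exists k.
have lw k : l <= w k by apply: sup_le_ub; [exists (v 0%N), 0%N|move=> _ [j _ <-]].
have ul k : `|u k - l| <= 2 * C / 2 ^+ k.
  by have := vl k; have := lw k; rewrite /v /w ler_norml => ? ?; apply/andP; split; lra.
have cvl : u @ \oo --> l.
  apply/cvgrPdist_le => e e0.
  have [N HN] : exists N, 2 * C / e < 2 ^+ N.
    exists (Num.bound (2 * C / e)).
    have := archi_boundP (divr_ge0 (mulr_ge0 (ler0n R 2) C0) (ltW e0)).
    move=> /lt_le_trans; apply; rewrite -natrX ler_nat.
    exact/ltnW/ltn_expl.
  exists N => // k /= Nk; rewrite distrC; apply: le_trans (ul k) _.
  rewrite ler_pdivrMr ?exprn_gt0// -ler_pdivrMl// mulrC.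
  apply: le_trans (ltW HN) _; rewrite ler_weXn2l//.
  by rewrite (ler_nat R 1 2).
by rewrite (cvg_lim _ cvl).
Qed.

End GeometricLimits.

Section Picard.
Variables (R : realType) (n : nat) (f : R -> 'rV[R]_n -> 'rV[R]_n) (x0 : 'rV[R]_n).
Hypothesis cf : forall x : R -> 'rV[R]_n, continuous x ->
  forall i, continuous (fun t => f t (x t) 0 i).
Hypothesis lipf : forall T : R, exists2 K, 0 < K &
  forall t a b, `|t| <= T -> `|f t a - f t b| <= K * `|a - b|.

Fixpoint picard k (t : R) : 'rV[R]_n :=
  if k is k'.+1 then
    \row_i (x0 0 i + primitive (fun s => f s (picard k' s) 0 i) t)
  else x0.

Lemma picard_continuous k : continuous (picard k).
Proof.
elim: k => [|k IH]; first exact: cst_continuous.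
move=> t.
apply: (@is_derive_rV_continuous _ _ _ (fun t => \row_i f t (picard k t) 0 i)) => i.
have [_ dP] := primitiveP (cf IH (i := i)).
rewrite (_ : (fun s => _) = fun s => x0 0 i + primitive (fun s => f s (picard k s) 0 i) s).
  apply: (is_derive_eq (is_derive_add (is_derive_const _ _ _) (dP t))).
  by rewrite add0r mxE.
by apply/funext => s; rewrite mxE.
Qed.

Lemma continuous_bounded (g : R -> R) (T : R) : continuous g ->
  exists2 M, 0 <= M & forall s, `|s| <= T -> `|g s| <= M.
Proof.
move=> cg; have [T0|T0] := ltP T 0.
  by exists 0 => // s sT; have := le_lt_trans sT T0; rewrite ltNge normr_ge0.
have [||c _ Hc] := @EVT_max R (fun s => `|g s|) (- T) T.
- by lra.
- apply: continuous_subspaceT => s.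
  by apply: continuous_comp; [exact: cg|exact: norm_continuous].
exists `|g c| => // s; rewrite ler_norml => sT; apply: Hc.
by rewrite in_itv.
Qed.

(** In the norm weighted by exp(- 2 K |t|), each iteration halves the
    distance. *)
Lemma picard_step (T : R) : exists2 A, 0 <= A & forall k t, `|t| <= T ->
  `|picard k.+1 t - picard k t| <= A / 2 ^+ k.
Proof.
have [K K0 HK] := lipf T.
have /choice[B HB] (i : 'I_n) : exists M, 0 <= M /\
    forall s, `|s| <= T -> `|f s x0 0 i| <= M.
  have [M M0 HM] := @continuous_bounded _ T (cf (@cst_continuous _ _ x0) (i := i)).
  by exists M.
pose A := (\sum_i B i) / (2 * K).
have sB : 0 <= \sum_i B i by apply: sumr_ge0 => i _; case: (HB i).
have A0 : 0 <= A by rewrite divr_ge0// mulr_ge0// ltW.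
have K20 : 0 < 2 * K by rewrite mulr_gt0.
have main k t : `|t| <= T ->
    `|picard k.+1 t - picard k t| <= A / 2 ^+ k * expR (2 * K * `|t|).
  elim: k t => [|k IH] t tT.
    apply: rV_norm_le => [|i].
      by rewrite mulr_ge0 ?expR_ge0// divr_ge0// exprn_ge0.
    rewrite !mxE /= addrAC subrr add0r expr0 divr1 /A.
    apply: primitive_exp_bound tT _ => //.
      exact: (cf (@cst_continuous _ _ x0)).
    move=> s sT; apply: le_trans (_ : \sum_i B i <= _).
      apply: le_trans (proj2 (HB i) s sT) _; rewrite (bigD1 i)//= lerDl.
      by apply: sumr_ge0 => j _; case: (HB j).
    by apply: ler_mul_expR => //; rewrite mulr_ge0// ltW.
  apply: rV_norm_le => [|i].
    by rewrite mulr_ge0 ?expR_ge0// divr_ge0// exprn_ge0.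
  rewrite [picard k.+2]lock [picard k.+1]lock 2!mxE -!lock [picard k.+2]/= [picard k.+1 t]/=.
  rewrite !mxE opprD addrACA subrr add0r.
  rewrite primitive_sub; last 2 first.
    exact: (cf (@picard_continuous k.+1)).
    exact: (cf (@picard_continuous k)).
  rewrite (_ : A / 2 ^+ k.+1 = (K * (A / 2 ^+ k)) / (2 * K)); last first.
    by rewrite exprS; field; rewrite gt_eqF//= expf_neq0.
  apply: primitive_exp_bound tT _ => //.
    move=> s; apply: cvgB.
      exact: (cf (@picard_continuous k.+1)).
    exact: (cf (@picard_continuous k)).
  move=> s sT; apply: le_trans (_ : `|f s (picard k.+1 s) - f s (picard k s)| <= _).
    by have := rV_norm_coord (f s (picard k.+1 s) - f s (picard k s)) i; rewrite !mxE.
  apply: le_trans (HK s _ _ sT) _; rewrite -mulrA ler_wpM2l ?(ltW K0)//.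
  exact: IH.
exists (A * expR (2 * K * T)); first by rewrite mulr_ge0// expR_ge0.
move=> k t tT; apply: le_trans (main k t tT) _.
rewrite mulrAC ler_wpM2r ?invr_ge0 ?exprn_ge0// ler_wpM2l// ler_expR ler_wpM2l//.
exact: ltW.
Qed.

Definition picard_limit (t : R) : 'rV[R]_n := \row_i limn (fun k => picard k t 0 i).

Lemma picard_limit_dist (T : R) : exists2 A, 0 <= A & forall k t, `|t| <= T ->
  `|picard k t - picard_limit t| <= A / 2 ^+ k.
Proof.
have [A A0 HA] := picard_step T; exists (2 * A); first by rewrite mulr_ge0.
move=> k t tT; apply: rV_norm_le => [|i]; first by rewrite divr_ge0 ?mulr_ge0 ?exprn_ge0.
have [|_ /(_ k)] := @geometric_limn _ (fun k => picard k t 0 i) A.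
  move=> j; have := rV_norm_coord (picard j.+1 t - picard j t) i.
  rewrite [X in X <= _](_ : _ = `|picard j.+1 t 0 i - picard j t 0 i|).
    by move=> /le_trans; apply; exact: HA.
  by rewrite [in LHS]mxE [X in _ + X]mxE.
by rewrite [in X in _ -> X]mxE [X in _ -> `|_ + X| <= _]mxE [X in _ -> `|_ - X| <= _]mxE.
Qed.

Lemma picard_limit_continuous : continuous picard_limit.
Proof.
move=> t; apply/cvgrPdist_lt => e e0.
have [A A0 HA] := picard_limit_dist (`|t| + 1).
have [k Hk] : exists k, A / 2 ^+ k < e / 3.
  exists (Num.bound (A / (e / 3))); rewrite ltr_pdivrMr ?exprn_gt0// mulrC -ltr_pdivrMr ?divr_gt0//.
  have := archi_boundP (divr_ge0 A0 (ltW (divr_gt0 e0 (ltr0Sn R 2)))).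
  by move=> /lt_le_trans; apply; rewrite -natrX ler_nat; exact/ltnW/ltn_expl.
have := @picard_continuous k t; move/cvgrPdist_lt => /(_ (e / 3)).
rewrite divr_gt0// => /(_ isT) ck.
near=> s.
have st : `|s| <= `|t| + 1.
  have : `|s - t| < 1 by near: s; exact: (@near_dist_lt R R).
  by have := ler_distD t s 0; rewrite !subr0; lra.
have tt : `|t| <= `|t| + 1 by lra.
have h1 := HA k t tt; have h2 := HA k s st.
have h3 : `|picard k t - picard k s| < e / 3 by near: s.
have -> : picard_limit t - picard_limit s =
  - (picard k t - picard_limit t) + (picard k t - picard k s) + (picard k s - picard_limit s).
  by apply/rowP => j; rewrite !mxE; ring.
apply: le_lt_trans (ler_normD _ _) _.
apply: le_lt_trans (lerD (ler_normD _ _) (lexx _)) _.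
by rewrite normrN; lra.
Unshelve. all: by end_near. Qed.

Lemma picard_limit_primitive t i :
  picard_limit t 0 i = x0 0 i + primitive (fun s => f s (picard_limit s) 0 i) t.
Proof.
apply/eqP; rewrite -subr_eq0; apply/eqP.
have tt : `|t| <= `|t| + 1 by lra.
have [A A0 HA] := picard_limit_dist (`|t| + 1).
have [K K0 HK] := lipf (`|t| + 1).
apply: (@geometric_null _ (A + A * expR (K * `|t|))) => k.
have -> : picard_limit t 0 i - (x0 0 i + primitive (fun s => f s (picard_limit s) 0 i) t) =
  (picard_limit t - picard k.+1 t) 0 i +
  primitive (fun s => f s (picard k s) 0 i - f s (picard_limit s) 0 i) t.
  rewrite -primitive_sub; last 2 first.
    exact: (cf (@picard_continuous k)).
    exact: (cf picard_limit_continuous).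
  have E1 : picard k.+1 t 0 i = x0 0 i + primitive (fun s => f s (picard k s) 0 i) t.
    by rewrite /= mxE.
  have E2 (a b : 'rV[R]_n) : (a - b) 0 i = a 0 i - b 0 i by rewrite !mxE.
  by rewrite E2 E1; ring.
apply: le_trans (ler_normD _ _) _; rewrite mulrDl; apply: lerD.
  apply: le_trans (rV_norm_coord _ _) _; rewrite distrC.
  apply: le_trans (HA k.+1 t tt) _; rewrite ler_wpM2l// lef_pV2 ?posrE ?exprn_gt0//.
  by rewrite ler_weXn2l// (ler_nat R 1 2).
rewrite (_ : A * expR (K * `|t|) / 2 ^+ k = (K * (A / 2 ^+ k)) / K * expR (K * `|t|)); last first.
  by field; rewrite gt_eqF//= expf_neq0.
apply: primitive_exp_bound tt _ => //.
  move=> s; apply: cvgB.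
    exact: (cf (@picard_continuous k)).
  exact: (cf picard_limit_continuous).
move=> s sT; apply: le_trans (_ : `|f s (picard k s) - f s (picard_limit s)| <= _).
  by have := rV_norm_coord (f s (picard k s) - f s (picard_limit s)) i; rewrite !mxE.
apply: le_trans (HK s _ _ sT) _.
apply: le_trans (_ : K * (A / 2 ^+ k) <= _); first by rewrite ler_wpM2l ?(ltW K0)// HA.
have : 0 <= K * (A / 2 ^+ k) by rewrite mulr_ge0 ?divr_ge0 ?exprn_ge0// ltW.
by move=> h; apply: ler_mul_expR => //; rewrite mulr_ge0// ltW.
Qed.

(** The Lipschitz constant may depend on the time interval: linear equations
    along an orbit, such as the variational equation, are covered. *)
Theorem picard_lindelof : exists x : R -> 'rV[R]_n, x 0 = x0 /\
  forall (t : R) i, is_derive t 1 (fun s => x s 0 i) (f t (x t) 0 i).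
Proof.
exists picard_limit; split.
  apply/rowP => i; rewrite picard_limit_primitive.
  by have [-> _] := primitiveP (cf picard_limit_continuous (i := i)); rewrite addr0.
move=> t i; have [_ dP] := primitiveP (cf picard_limit_continuous (i := i)).
rewrite (_ : (fun s => _) = fun s => x0 0 i +
  primitive (fun s => f s (picard_limit s) 0 i) s); last first.
  by apply/funext => s; exact: picard_limit_primitive.
by apply: (is_derive_eq (is_derive_add (is_derive_const _ _ _) (dP t))); rewrite add0r.
Qed.

End Picard.

(** * Differentials in coordinates *)

Section DifferentialRowVector.
Variables (R : realType) (n : nat).
Implicit Types (f : 'rV[R]_n -> R) (x v : 'rV[R]_n).

Definition lform (c : 'I_n -> R) (h : 'rV[R]_n) : R := \sum_j h 0 j * c j.

Lemma lform_linear c : linear (lform c).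
Proof.
move=> a u v; rewrite /lform scaler_sumr -big_split /=; apply: eq_bigr => j _.
by rewrite !mxE mulrDl -mulrA.
Qed.
HB.instance Definition _ c := GRing.isLinear.Build R 'rV[R]_n R *:%R (lform c) (lform_linear c).

Lemma lform_le c h : `|lform c h| <= (\sum_j `|c j|) * `|h|.
Proof.
apply: le_trans (ler_norm_sum _ _ _) _; rewrite mulr_suml; apply: ler_sum => j _.
by rewrite normrM mulrC ler_wpM2l// rV_norm_coord.
Qed.

Lemma lform_continuous c : continuous (lform c).
Proof.
move=> z; apply: differentiable_continuous.
have [] := @differentiable_lincomb R 'rV[R]_n R n c (fun j h => h 0 j) z => //.
by move=> j; exact: differentiable_coord.
Qed.

Lemma is_diff_rV (c : 'I_n -> R) f x :
  (forall e, 0 < e -> \forall y \near x,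
     `|f y - f x - lform c (y - x)| <= e * `|y - x|) ->
  differentiable f x /\ forall v, 'D_v f x = lform c v.
Proof.
move=> H; have [df Df] := is_diff_eps (@lform_continuous c) H.
by split => // v; rewrite deriveE// Df.
Qed.

Lemma diff_rV f x v : differentiable f x ->
  'd f x v = lform (fun j => 'D_(delta_mx 0 j) f x) v.
Proof.
move=> df; rewrite [in LHS](row_sum_delta v) linear_sum; apply: eq_bigr => j _.
by rewrite linearZ /= deriveE.
Qed.

Lemma is_derive_along f (g : R -> 'rV[R]_n) (dg : 'rV[R]_n) (t : R) :
  differentiable f (g t) ->
  (forall i, is_derive t 1 (fun s => g s 0 i) (dg 0 i)) ->
  is_derive t 1 (fun s => f (g s)) (lform (fun j => 'D_(delta_mx 0 j) f (g t)) dg).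
Proof.
move=> df Hg; have dgt : derivable g t 1.
  by apply/derivable_mxP => i j; rewrite ord1; case: (Hg j).
have dgt' : differentiable g t by exact/derivable1_diffP.
have Dg : 'D_1 g t = dg.
  rewrite derive_mx//; apply/rowP => j; rewrite mxE.
  by have [_ ->] := Hg j.
have D := differentiable_comp dgt' df.
apply: DeriveDef; first exact/derivable1_diffP.
rewrite deriveE//.
by rewrite diff_comp//= -(deriveE _ dgt') Dg diff_rV.
Qed.

Lemma continuous_ball_bounded f (M : R) : continuous f ->
  exists2 B, 0 <= B & forall x, `|x| <= M -> `|f x| <= B.
Proof.
move=> cf; have [M0|M0] := ltP M 0.
  by exists 0 => // x xM; have := le_lt_trans xM M0; rewrite ltNge normr_ge0.
have cA : compact [set x : 'rV[R]_n | `|x| <= M].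
  apply: bounded_closed_compact.
    by exists M; split; [exact: num_real|move=> N MN x /le_trans; apply; exact: ltW].
  apply: (@closed_comp _ _ (fun x : 'rV[R]_n => `|x|) [set y | y <= M]); last exact: closed_le.
  by move=> x _; exact: norm_continuous.
have A0 : [set x : 'rV[R]_n | `|x| <= M] !=set0 by exists 0; rewrite /= normr0.
have cAf : {within [set x : 'rV[R]_n | `|x| <= M], continuous (fun x => `|f x|)}.
  apply: continuous_subspaceT => s.
  by apply: continuous_comp; [exact: cf|exact: norm_continuous].
have [c _ Hc] := EVT_max_rV A0 cA cAf.
exists `|f c| => // x xM; apply: Hc.
by rewrite inE.
Qed.

Lemma ball_convex (a b : 'rV[R]_n) (M s : R) : `|a| <= M -> `|b| <= M ->
  0 <= s <= 1 -> `|a + s *: (b - a)| <= M.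
Proof.
move=> aM bM /andP[s0 s1].
have -> : a + s *: (b - a) = (1 - s) *: a + s *: b.
  by apply/rowP => j; rewrite !mxE; ring.
apply: le_trans (ler_normD _ _) _; rewrite !normrZ !ger0_norm ?subr_ge0//.
have := ler_wpM2l s0 bM; have h : 0 <= 1 - s by rewrite subr_ge0.
by have := ler_wpM2l h aM; lra.
Qed.

Lemma segment_is_derive f a b (s : R) : (forall x, differentiable f x) ->
  is_derive s 1 (fun s => f (a + s *: (b - a)))
    (lform (fun j => 'D_(delta_mx 0 j) f (a + s *: (b - a))) (b - a)).
Proof.
move=> df; apply: (@is_derive_along f (fun s => a + s *: (b - a))) => // i.
rewrite (_ : (fun s => _) = fun s => a 0 i + (b - a) 0 i * s); last first.
  by apply/funext => r; rewrite [LHS]mxE [X in _ + X = _]mxE [r * _]mulrC.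
apply: (is_derive_eq (is_derive_add (is_derive_const _ _ _)
  (is_derive_scale _ (is_derive_id _ _)))).
by rewrite add0r mulr1.
Qed.

Lemma class_C1_lipschitz f (M : R) : class_C 1 setT f ->
  exists2 K, 0 <= K & forall a b, `|a| <= M -> `|b| <= M ->
    `|f b - f a| <= K * `|b - a|.
Proof.
move=> Cf; have df x : differentiable f x by exact: class_C_differentiable Cf _.
have /choice[B HB] (j : 'I_n) : exists B, 0 <= B /\
    forall x, `|x| <= M -> `|'D_(delta_mx 0 j) f x| <= B.
  have [|B B0 HB] := @continuous_ball_bounded ('D_(delta_mx 0 j) f) M; last by exists B.
  by move=> x; exact: class_C_continuous (class_C_derive _ Cf) _.
exists (\sum_j B j); first by apply: sumr_ge0 => j _; case: (HB j).
move=> a b aM bM.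
have [c c01 E] := @MVT_le _ _ _ 0 1 ler01 (fun s _ => segment_is_derive a b s df).
rewrite scale1r subrKC scale0r addr0 subr0 mulr1 in E.
rewrite E; apply: le_trans (lform_le _ _) _; rewrite ler_wpM2r//.
by apply: ler_sum => j _; apply: (HB j).2; exact: ball_convex.
Qed.

Lemma class_C2_taylor f (M : R) : class_C 2 setT f ->
  exists2 K, 0 <= K & forall a b, `|a| <= M -> `|b| <= M ->
    `|f b - f a - lform (fun j => 'D_(delta_mx 0 j) f a) (b - a)| <= K * `|b - a| ^+ 2.
Proof.
move=> Cf; have df x : differentiable f x by exact: class_C_differentiable Cf _.
have /choice[B HB] (j : 'I_n) : exists B, 0 <= B /\
    forall a b, `|a| <= M -> `|b| <= M ->
    `|'D_(delta_mx 0 j) f b - 'D_(delta_mx 0 j) f a| <= B * `|b - a|.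
  have [B B0 HB] := class_C1_lipschitz M (class_C_derive (delta_mx 0 j) Cf).
  by exists B.
exists (\sum_j B j); first by apply: sumr_ge0 => j _; case: (HB j).
move=> a b aM bM.
have [c c01 E] := @MVT_le _ _ _ 0 1 ler01 (fun s _ => segment_is_derive a b s df).
rewrite scale1r subrKC scale0r addr0 subr0 mulr1 in E.
rewrite E -sumrB.
rewrite (eq_bigr (fun j => (b - a) 0 j * ('D_(delta_mx 0 j) f (a + c *: (b - a)) - 'D_(delta_mx 0 j) f a))); last first.
  by move=> j _; rewrite mulrBr.
apply: le_trans (lform_le _ _) _.
rewrite expr2 mulrA ler_wpM2r// mulr_suml; apply: ler_sum => j _.
apply: le_trans ((HB j).2 _ _ aM (ball_convex aM bM c01)) _.
rewrite addrAC subrr add0r normrZ ler_wpM2l//; first by case: (HB j).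
by case/andP: c01 => c0 c1; rewrite ger0_norm// ler_piMl.
Qed.

End DifferentialRowVector.

(** * Smooth dependence on initial conditions *)

Section Flows.
Variable R : realType.

Lemma class_C_coord n r (D : set 'rV[R]_n) (i : 'I_n) : open D ->
  class_C r D (fun x : 'rV[R]_n => x 0 i).
Proof.
move=> oD; apply: (@class_C_ext _ _ _ _ (lform (fun j => (j == i)%:R))) => //.
  move=> z _; rewrite /lform (bigD1 i)//= eqxx mulr1 big1 ?addr0// => j /negbTE->.
  by rewrite mulr0.
by apply: class_C_linear => //; exact: lform_continuous.
Qed.

Definition smooth_field n (Y : 'rV[R]_n -> 'rV[R]_n) :=
  forall i r, class_C r setT (fun x : 'rV[R]_n => Y x 0 i).

Definition global_flow n (Y : 'rV[R]_n -> 'rV[R]_n) (g : R -> 'rV[R]_n -> 'rV[R]_n) :=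
  (forall x, g 0 x = x) /\
  forall x (t : R) i, is_derive t 1 (fun s => g s x 0 i) (Y (g t x) 0 i).

Definition locally_bounded n (g : R -> 'rV[R]_n -> 'rV[R]_n) :=
  forall x, exists d M, 0 < d /\
    forall x' t, `|x' - x| < d -> 0 <= t <= 1 -> `|g t x'| <= M.

Section Dependence.
Variables (n : nat) (Y : 'rV[R]_n -> 'rV[R]_n) (g : R -> 'rV[R]_n -> 'rV[R]_n).
Hypotheses (sY : smooth_field Y) (gY : global_flow Y g) (bg : locally_bounded g).

Let g0 x : g 0 x = x. Proof. by case: gY. Qed.
Let dg x (t : R) i : is_derive t 1 (fun s => g s x 0 i) (Y (g t x) 0 i).
Proof. by case: gY => _; apply. Qed.

Let g_continuous x : continuous (fun t => g t x).
Proof. by move=> t; apply: (@is_derive_rV_continuous _ _ _ (fun t => Y (g t x)) _ (dg x t)). Qed.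

Lemma field_lipschitz M : exists2 K, 0 <= K &
  forall a b, `|a| <= M -> `|b| <= M -> `|Y b - Y a| <= K * `|b - a|.
Proof.
have /choice[K HK] (i : 'I_n) : exists K, 0 <= K /\
    forall a b, `|a| <= M -> `|b| <= M -> `|Y b 0 i - Y a 0 i| <= K * `|b - a|.
  by have [K K0 HK] := class_C1_lipschitz M (sY i 1); exists K.
have K0 : 0 <= \sum_i K i by apply: sumr_ge0 => i _; case: (HK i).
exists (\sum_i K i) => // a b aM bM; apply: rV_norm_le => [|i].
  by rewrite mulr_ge0.
rewrite !mxE; apply: le_trans ((HK i).2 a b aM bM) _.
rewrite ler_wpM2r// (bigD1 i)//= lerDl.
by apply: sumr_ge0 => j _; case: (HK j).
Qed.

Lemma flow_lipschitz x : exists d C, [/\ 0 < d, 0 < C & forall x' t,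
  `|x' - x| < d -> 0 <= t <= 1 -> `|g t x' - g t x| <= C * `|x' - x|].
Proof.
have [d [M [d0 HM]]] := bg x; have [K K0 HK] := field_lipschitz M.
have [C C0 HC] := gronwall n 1 K0.
exists d, C; split=> // x' t x'x t01.
have xd : `|x - x| < d by rewrite subrr normr0.
have := HC (fun t => g t x' - g t x) (fun t => Y (g t x') - Y (g t x)) 0 (lexx 0).
rewrite !g0 addr0; apply=> // [s s01 i|s s01].
  rewrite (_ : (fun s => _) = fun s => g s x' 0 i - g s x 0 i); last first.
    by apply/funext => r; rewrite !mxE.
  by apply: (is_derive_eq (is_derive_sub (dg x' s i) (dg x s i))); rewrite !mxE.
by rewrite addr0; apply: HK; exact: HM.
Qed.

(** Vectors are rows, so the Jacobian matrix acts on the right. *)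
Definition jac (x : 'rV[R]_n) : 'M[R]_n :=
  \matrix_(j, i) 'D_(delta_mx 0 j) (fun x : 'rV[R]_n => Y x 0 i) x.

Lemma jac_coordE (v : 'rV[R]_n) x i :
  (v *m jac x) 0 i = lform (fun j => 'D_(delta_mx 0 j) (fun x : 'rV[R]_n => Y x 0 i) x) v.
Proof. by rewrite mxE; apply: eq_bigr => j _; rewrite mxE. Qed.

Lemma jac_bounded M : exists2 B, 0 <= B & forall x (v : 'rV[R]_n), `|x| <= M ->
  `|v *m jac x| <= B * `|v|.
Proof.
have /choice[B HB] (ij : 'I_n * 'I_n) : exists B, 0 <= B /\
    forall x, `|x| <= M -> `|'D_(delta_mx (0 : 'I_1) ij.2) (fun x : 'rV[R]_n => Y x 0 ij.1) x| <= B.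
  have [|B B0 HB] := @continuous_ball_bounded R n ('D_(delta_mx (0 : 'I_1) ij.2) (fun x : 'rV[R]_n => Y x 0 ij.1)) M.
    by move=> x; exact: (@class_C_continuous _ _ 0 setT _ _ (class_C_derive _ (sY ij.1 1))).
  by exists B.
have B0 : 0 <= \sum_ij B ij by apply: sumr_ge0 => ij _; case: (HB ij).
exists (\sum_ij B ij) => // x v xM; apply: rV_norm_le => [|i]; first by rewrite mulr_ge0.
rewrite jac_coordE; apply: le_trans (lform_le _ _) _; rewrite ler_wpM2r//.
apply: le_trans (_ : \sum_j B (i, j) <= _).
  by apply: ler_sum => j _; exact: ((HB (i, j)).2 x xM).
rewrite [leRHS](_ : _ = \sum_i \sum_j B (i, j)).
  rewrite [leRHS](bigD1 i)//= lerDl; apply: sumr_ge0 => k _; apply: sumr_ge0 => j _.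
  by case: (HB (k, j)).
by rewrite pair_bigA /=; apply: eq_bigr => -[].
Qed.

(** The variational equation along the orbit of x. *)
Lemma variation_exists x (h : 'rV[R]_n) : exists v : R -> 'rV[R]_n, v 0 = h /\
  forall (t : R) i, is_derive t 1 (fun s => v s 0 i) ((v t *m jac (g t x)) 0 i).
Proof.
apply: (@picard_lindelof R n (fun t v => v *m jac (g t x)) h).
  move=> v cv i.
  rewrite (_ : (fun t => _) = (fun t => \sum_j v t 0 j * ('D_(delta_mx 0 j) (fun x : 'rV[R]_n => Y x 0 i) (g t x)))); last first.
    by apply/funext => s; rewrite jac_coordE.
  suff C0 : class_C 0 (@setT R) (fun t => \sum_j v t 0 j * ('D_(delta_mx 0 j) (fun x : 'rV[R]_n => Y x 0 i) (g t x))).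
    by move=> t; exact: C0.
  apply: class_C_sum => [|j _]; first exact: openT.
  apply: (@class_CM R R 0 setT (fun t => v t 0 j)
    (fun t => 'D_(delta_mx 0 j) (fun x : 'rV[R]_n => Y x 0 i) (g t x))) => [|s _|s _].
  - exact: openT.
  - apply: (@continuous_comp _ _ _ v (fun x : 'rV[R]_n => x 0 j)); first exact: cv.
    exact: rV_continuous_coord.
  apply: (@continuous_comp _ _ _ (fun t => g t x) ('D_(delta_mx 0 j) (fun x : 'rV[R]_n => Y x 0 i))); first exact: g_continuous.
  exact: (@class_C_continuous _ _ 0 setT _ _ (class_C_derive _ (sY i 1))).
move=> T; have /choice[M HM] (i : 'I_n) : exists M, 0 <= M /\ forall s, `|s| <= T -> `|g s x 0 i| <= M.
  have [|M M0 HM] := @continuous_bounded R (fun s => g s x 0 i) T; last by exists M.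
  by move=> s; exact: is_derive_continuous (dg x s i).
have M0 : 0 <= \sum_i M i by apply: sumr_ge0 => i _; case: (HM i).
have [B B0 HB] := jac_bounded (\sum_i M i).
exists (B + 1); first by rewrite ltr_wpDl.
move=> t a b tT; rewrite -mulmxBl; apply: le_trans (_ : B * `|a - b| <= _).
  apply: HB; apply: rV_norm_le => // i; apply: le_trans ((HM i).2 t tT) _.
  by rewrite (bigD1 i)//= lerDl; apply: sumr_ge0 => j _; case: (HM j).
by rewrite ler_wpM2r// lerDl.
Qed.

Definition variation x (j : 'I_n) : R -> 'rV[R]_n :=
  sval (cid (variation_exists x (delta_mx 0 j))).

(** Superposition of the solutions that start at the basis vectors, so that
    linearity in h is built in. *)
Definition tangent (t : R) x (h : 'rV[R]_n) : 'rV[R]_n :=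
  \sum_j h 0 j *: variation x j t.

Lemma tangent0 x h : tangent 0 x h = h.
Proof.
rewrite [RHS]row_sum_delta; apply: eq_bigr => j _; congr (_ *: _).
by rewrite /variation; case: cid => v /= [].
Qed.

Lemma tangent_is_derive x h (t : R) i :
  is_derive t 1 (fun s => tangent s x h 0 i) ((tangent t x h *m jac (g t x)) 0 i).
Proof.
rewrite (_ : (fun s => _) = fun s => \sum_j h 0 j * variation x j s 0 i); last first.
  by apply/funext => s; rewrite summxE; apply: eq_bigr => j _; rewrite mxE.
have -> : (tangent t x h *m jac (g t x)) 0 i =
    \sum_j h 0 j * (variation x j t *m jac (g t x)) 0 i.
  rewrite mulmx_suml summxE; apply: eq_bigr => j _.
  by rewrite -scalemxAl mxE.
apply: is_derive_bigsum => j _; apply: is_derive_scale.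
by rewrite /variation; case: cid => v /= [].
Qed.

Lemma tangent_bounded x : exists d C, [/\ 0 < d, 0 < C & forall x' h t,
  `|x' - x| < d -> 0 <= t <= 1 -> `|tangent t x' h| <= C * `|h|].
Proof.
have [d [M [d0 HM]]] := bg x; have [B B0 HB] := jac_bounded M.
have [C C0 HC] := gronwall n 1 B0.
exists d, C; split=> // x' h t x'x t01.
have := HC (fun t => tangent t x' h) (fun t => tangent t x' h *m jac (g t x')) 0 (lexx 0).
rewrite tangent0 addr0; apply=> // [s s01 i|s s01]; first exact: tangent_is_derive.
by rewrite addr0; apply: HB; exact: HM.
Qed.

(** By Taylor's formula for Y, the difference g t x' - g t x satisfies the
    variational equation up to an error that is quadratic in |x' - x|. *)
Lemma flow_taylor x : exists d C, [/\ 0 < d, 0 < C & forall x' t,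
  `|x' - x| < d -> 0 <= t <= 1 ->
  `|g t x' - g t x - tangent t x (x' - x)| <= C * `|x' - x| ^+ 2].
Proof.
have [d [M [d0 HM]]] := bg x; have [B B0 HB] := jac_bounded M.
have [d' [L [d'0 L0 HL]]] := flow_lipschitz x.
have /choice[K HK] (i : 'I_n) : exists K, 0 <= K /\
    forall a b, `|a| <= M -> `|b| <= M ->
    `|Y b 0 i - Y a 0 i - ((b - a) *m jac a) 0 i| <= K * `|b - a| ^+ 2.
  have [K K0 HK] := class_C2_taylor M (sY i 2); exists K; split=> // a b aM bM.
  by rewrite jac_coordE; exact: HK.
have K0 : 0 <= \sum_i K i by apply: sumr_ge0 => i _; case: (HK i).
have [C C0 HC] := gronwall n 1 B0.
exists (Num.min d d'), (C * ((\sum_i K i) * L ^+ 2) + 1); split.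
- by rewrite lt_min d0.
- by rewrite ltr_wpDl// mulr_ge0 ?(ltW C0)// mulr_ge0// sqr_ge0.
move=> x' t; rewrite lt_min => /andP[x'd x'd'] t01.
have xd : `|x - x| < d by rewrite subrr normr0.
pose eps := (\sum_i K i) * L ^+ 2 * `|x' - x| ^+ 2.
have eps0 : 0 <= eps by rewrite /eps mulr_ge0 ?sqr_ge0// mulr_ge0 ?sqr_ge0.
apply: le_trans (_ : C * eps <= _); last first.
  by rewrite /eps mulrDl mul1r -!mulrA lerDl sqr_ge0.
have := HC (fun t => g t x' - g t x - tangent t x (x' - x))
  (fun t => Y (g t x') - Y (g t x) - tangent t x (x' - x) *m jac (g t x)) eps eps0.
rewrite !g0 tangent0 subrr normr0 add0r; apply=> // [s s01 i|s s01].
  rewrite (_ : (fun s => _) = fun s => g s x' 0 i - g s x 0 i - tangent s x (x' - x) 0 i); last first.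
    by apply/funext => r; rewrite 2!mxE [(- tangent _ _ _) 0 i]mxE [(- g _ _) 0 i]mxE.
  apply: (is_derive_eq (is_derive_sub (is_derive_sub (dg x' s i) (dg x s i)) (tangent_is_derive x (x' - x) s i))).
  by rewrite 2![in RHS]mxE [(- Y _) 0 i]mxE [in RHS]mxE.
set w := g s x' - g s x; set tg := tangent s x (x' - x).
have -> : Y (g s x') - Y (g s x) - tg *m jac (g s x) =
    (w - tg) *m jac (g s x) + (Y (g s x') - Y (g s x) - w *m jac (g s x)).
  rewrite mulmxBl; move: (w *m _) (tg *m _) => a b.
  by apply/rowP => j; rewrite !mxE; ring.
apply: le_trans (ler_normD _ _) _; apply: lerD.
  by apply: HB; exact: HM.
apply: rV_norm_le => // i.
have -> : (Y (g s x') - Y (g s x) - w *m jac (g s x)) 0 i =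
  Y (g s x') 0 i - Y (g s x) 0 i - (w *m jac (g s x)) 0 i.
  by rewrite 2!mxE [(- Y _) 0 i]mxE [(- (w *m _)) 0 i]mxE.
apply: le_trans ((HK i).2 _ _ (HM _ _ xd s01) (HM _ _ x'd s01)) _.
rewrite -/w /eps -mulrA; apply: ler_pM; rewrite ?sqr_ge0//.
- by case: (HK i).
- by rewrite (bigD1 i)//= lerDl; apply: sumr_ge0 => j _; case: (HK j).
rewrite -exprMn lerXn2r ?nnegrE ?mulr_ge0 ?(ltW L0)//.
exact: HL.
Qed.

Lemma flow_differentiable t i x : 0 <= t <= 1 ->
  differentiable (fun x => g t x 0 i) x /\
  forall h, 'D_h (fun x => g t x 0 i) x = tangent t x h 0 i.
Proof.
move=> t01; pose c j := variation x j t 0 i.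
have tE h : tangent t x h 0 i = lform c h.
  by rewrite summxE; apply: eq_bigr => j _; rewrite mxE.
have [d [C [d0 C0 HC]]] := flow_taylor x.
have [|df Df] := @is_diff_rV R n c (fun x => g t x 0 i) x; last first.
  by split=> // h; rewrite Df tE.
move=> e e0; rewrite /=.
apply: filterS (filterI (near_dist_lt x d0) (near_dist_lt x (divr_gt0 e0 C0))) => y [yd ye].
rewrite -tE.
have -> : g t y 0 i - g t x 0 i - tangent t x (y - x) 0 i =
  (g t y - g t x - tangent t x (y - x)) 0 i.
  by rewrite 2!mxE [(- g _ _) 0 i]mxE [(- tangent _ _ _) 0 i]mxE.
apply: le_trans (rV_norm_coord _ _) _; apply: le_trans (HC _ _ yd t01) _.
rewrite expr2 mulrA ler_wpM2r//.
by rewrite mulrC -ler_pdivlMr// ltW.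
Qed.

End Dependence.

Lemma row_lsubmx n (w : 'rV[R]_(n + n)) : \row_j w 0 (lshift n j) = lsubmx w.
Proof. by apply/rowP => j; rewrite !mxE. Qed.

Lemma class_C_lsubmx n r (f : 'rV[R]_n -> R) : class_C r setT f ->
  class_C r setT (fun w : 'rV[R]_(n + n) => f (lsubmx w)).
Proof.
move=> Cf; apply: (@class_C_ext R 'rV[R]_(n + n) r setT
  (fun w => f (\row_j w 0 (lshift n j)))).
- exact: openT.
- by move=> w _; rewrite row_lsubmx.
apply: (@class_C_comp_rV R 'rV[R]_(n + n) n r setT setT f
  (fun j w => w 0 (lshift n j))) => // [|j].
  exact: openT.
by apply: class_C_coord; exact: openT.
Qed.

(** The directional derivative of the flow is the second component of the
    flow of the tangent field (x, h) |-> (Y x, h * jac x), so that smoothness to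
    order r of all flows yields smoothness to order r.+1. *)
Theorem flow_smooth r : forall n (Y : 'rV[R]_n -> 'rV[R]_n) g,
  smooth_field Y -> global_flow Y g -> locally_bounded g ->
  forall t i, 0 <= t <= 1 -> class_C r setT (fun x => g t x 0 i).
Proof.
elim: r => [|r IH] n Y g sY gY bg t i t01.
  move=> x _; apply: differentiable_continuous.
  by have [] := flow_differentiable sY gY bg i x t01.
split=> [x _|h]; first by have [] := flow_differentiable sY gY bg i x t01.
pose V := tangent sY gY.
pose Y2 (w : 'rV[R]_(n + n)) := row_mx (Y (lsubmx w)) (rsubmx w *m jac Y (lsubmx w)).
pose g2 s (w : 'rV[R]_(n + n)) := row_mx (g s (lsubmx w)) (V s (lsubmx w) (rsubmx w)).
have oT := @openT 'rV[R]_(n + n).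
have sY2 : smooth_field Y2.
  move=> k q; rewrite -(fintype.splitK k); case: (fintype.split k) => j /=.
    apply: (@class_C_ext R 'rV[R]_(n + n) _ _ (fun w => Y (lsubmx w) 0 j)) => //.
      by move=> w _; rewrite row_mxEl.
    exact: (class_C_lsubmx (sY j q)).
  apply: (@class_C_ext _ _ _ _ (fun w : 'rV[R]_(n + n) => \sum_l w 0 (rshift n l) *
      'D_(delta_mx 0 l) (fun x : 'rV[R]_n => Y x 0 j) (lsubmx w))) => //.
    by move=> w _; rewrite row_mxEr jac_coordE; apply: eq_bigr => l _; rewrite mxE.
  apply: class_C_sum => // l _; apply: class_CM => //; first exact: class_C_coord.
  exact: (class_C_lsubmx (class_C_derive _ (sY j q.+1))).
have gY2 : global_flow Y2 g2.
  case: (gY) => g0 dg; split=> [w|w s k].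
    by rewrite /g2 g0 /V tangent0 hsubmxK.
  rewrite -(fintype.splitK k); case: (fintype.split k) => j /=.
    rewrite /g2 /Y2 !row_mxEl row_mxKl.
    rewrite (_ : (fun _ => _) = fun s => g s (lsubmx w) 0 j); first exact: dg.
    by apply/funext => s'; rewrite row_mxEl.
  rewrite /Y2 !row_mxEr row_mxKl row_mxKr.
  rewrite (_ : (fun _ => _) = fun s => V s (lsubmx w) (rsubmx w) 0 j).
    exact: tangent_is_derive.
  by apply/funext => s'; rewrite /g2 row_mxEr.
have bg2 : locally_bounded g2.
  move=> w; have [d [M [d0 HM]]] := bg (lsubmx w).
  have [d' [C [d'0 C0 HC]]] := tangent_bounded sY gY bg (lsubmx w).
  exists (Num.min 1 (Num.min d d')), (Num.max M (C * (`|w| + 1))).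
  split; first by rewrite !lt_min ltr01 d0.
  move=> w' s; rewrite !lt_min => /andP[w1 /andP[wd wd']] s01.
  have nl (u : 'rV[R]_(n + n)) : `|lsubmx u| <= `|u|.
    by apply: rV_norm_le => // j; rewrite mxE; exact: rV_norm_coord.
  have nr (u : 'rV[R]_(n + n)) : `|rsubmx u| <= `|u|.
    by apply: rV_norm_le => // j; rewrite mxE; exact: rV_norm_coord.
  have ld : `|lsubmx w' - lsubmx w| <= `|w' - w| by rewrite -linearB; exact: nl.
  have M0 : 0 <= M by apply: le_trans (HM (lsubmx w) s _ s01); rewrite // subrr normr0.
  apply: rV_norm_le => [|k]; first by rewrite le_max M0.
  rewrite /g2 -(fintype.splitK k) le_max; case: (fintype.split k) => j /=.
    rewrite row_mxEl; apply/orP; left; apply: le_trans (rV_norm_coord _ _) _.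
    by apply: HM => //; exact: le_lt_trans wd.
  rewrite row_mxEr; apply/orP; right; apply: le_trans (rV_norm_coord _ _) _.
  apply: le_trans (HC _ _ _ (le_lt_trans ld wd') s01) _; rewrite ler_wpM2l ?(ltW C0)//.
  apply: le_trans (nr _) _; have := ler_normD (w' - w) w; rewrite subrK; lra.
have C2 := IH _ _ _ sY2 gY2 bg2 t (rshift n i) t01.
have oTn := @openT 'rV[R]_n.
apply: (@class_C_ext R 'rV[R]_n r _ (fun x => g2 t (\row_k row_mx x h 0 k) 0 (rshift n i))) => //.
  move=> x _; have [_ ->] := flow_differentiable sY gY bg i x t01.
  rewrite (_ : \row_k _ = row_mx x h); first by rewrite /g2 row_mxEr row_mxKl row_mxKr.
  by apply/rowP => k; rewrite mxE.
apply: (@class_C_comp_rV R 'rV[R]_n _ r setT setT (fun w => g2 t w 0 (rshift n i))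
  (fun k x => row_mx x h 0 k)) => // k.
rewrite -(fintype.splitK k); case: (fintype.split k) => j /=.
  apply: (@class_C_ext _ _ _ _ (fun x : 'rV[R]_n => x 0 j)) => //.
    by move=> x _; rewrite row_mxEl.
  exact: class_C_coord.
apply: (@class_C_ext _ _ _ _ (fun=> h 0 j)) => //.
  by move=> x _; rewrite row_mxEr.
exact: class_C_cst.
Qed.

End Flows.

(** * Flows of bounded fields *)

Section Uniqueness.
Variables (R : realType) (n : nat) (Y : 'rV[R]_n -> 'rV[R]_n) (K : R).
Hypotheses (K0 : 0 <= K) (HK : forall a b, `|Y a - Y b| <= K * `|a - b|).

(** Time is rescaled by T so that both directions of time are covered. *)
Lemma ode_unique (u v : R -> 'rV[R]_n) (T : R) : u 0 = v 0 ->
  (forall l : R, 0 <= l <= 1 -> forall i, is_derive (l * T) 1 (fun s => u s 0 i) (Y (u (l * T)) 0 i)) ->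
  (forall l : R, 0 <= l <= 1 -> forall i, is_derive (l * T) 1 (fun s => v s 0 i) (Y (v (l * T)) 0 i)) ->
  forall l, 0 <= l <= 1 -> u (l * T) = v (l * T).
Proof.
move=> uv0 du dv l l01.
have KT : 0 <= K * `|T| by rewrite mulr_ge0.
have [C C0 HC] := gronwall n 1 KT.
have sc (w : R -> 'rV[R]_n) (a : R) i (b : R) : is_derive (a * T) 1 (fun s => w s 0 i) b ->
    is_derive a 1 (fun s => w (s * T) 0 i) (b * T).
  move=> dw; have dT : is_derive a 1 (fun s : R => s * T) T.
    apply: (is_derive_eq (is_derive_mul (is_derive_id _ _) (is_derive_const a _ T))).
    by rewrite mul1r mulr0 addr0.
  apply: (@is_derive_comp_real R R (fun s => w s 0 i) (fun s => s * T) a 1 T b dw _ dT).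
  by apply/derivable1_diffP; case: dT.
have := HC (fun s => u (s * T) - v (s * T)) (fun s => T *: (Y (u (s * T)) - Y (v (s * T)))) 0 (lexx 0).
rewrite mul0r uv0 subrr normr0 addr0 mulr0 => H.
apply/eqP; rewrite -subr_eq0 -normr_le0; apply: H l01.
  move=> s s01 i.
  rewrite (_ : (fun s => _) = fun s => u (s * T) 0 i - v (s * T) 0 i); last first.
    by apply/funext => r; rewrite !mxE.
  apply: (is_derive_eq (is_derive_sub (sc _ _ _ _ (du s s01 i)) (sc _ _ _ _ (dv s s01 i)))).
  by rewrite !mxE; ring.
move=> s s01; rewrite normrZ addr0 [K * _]mulrC -mulrA ler_wpM2l//; exact: HK.
Qed.

End Uniqueness.

Section BoundedField.
Variables (R : realType) (n : nat) (Y : 'rV[R]_n -> 'rV[R]_n) (M K : R).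
Hypotheses (sY : smooth_field Y) (bY : forall x, `|Y x| <= M)
  (K0 : 0 <= K) (HK : forall a b, `|Y a - Y b| <= K * `|a - b|).

Lemma flow_exists : exists g, global_flow Y g.
Proof.
have H x : exists g : R -> 'rV[R]_n, g 0 = x /\
    forall (t : R) i, is_derive t 1 (fun s => g s 0 i) (Y (g t) 0 i).
  apply: (@picard_lindelof R n (fun _ => Y) x).
    move=> u cu i t; apply: (@continuous_comp _ _ _ u (fun x => Y x 0 i)); first exact: cu.
    exact: (sY i 0).
  move=> T; exists (K + 1); first by rewrite ltr_wpDl.
  move=> _ a b _; apply: le_trans (HK a b) _.
  by rewrite ler_wpM2r// lerDl.
have [g Hg] := choice H; exists (fun t x => g x t); split.
  by move=> x; case: (Hg x).
by move=> x; case: (Hg x).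
Qed.

Definition flow : R -> 'rV[R]_n -> 'rV[R]_n := sval (cid flow_exists).

Lemma flow_global : global_flow Y flow.
Proof. by rewrite /flow; case: cid. Qed.

Lemma flow0 x : flow 0 x = x.
Proof. by case: flow_global. Qed.

Lemma flow_is_derive x (t : R) i : is_derive t 1 (fun s => flow s x 0 i) (Y (flow t x) 0 i).
Proof. by case: flow_global => _; apply. Qed.

Lemma field_bound_ge0 : 0 <= M.
Proof. exact: le_trans (normr_ge0 _) (bY 0). Qed.

Lemma flow_drift (t : R) x : `|flow t x - x| <= M * `|t|.
Proof.
have M0 := field_bound_ge0.
apply: rV_norm_le => [|i]; first by rewrite mulr_ge0.
have dM (s : R) : is_derive s 1 (fun s => M * s) M.
  by apply: (is_derive_eq (is_derive_scale _ (is_derive_id _ _))); rewrite mulr1.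
have dF (s : R) : is_derive s 1 (fun s => flow s x 0 i - x 0 i) (Y (flow s x) 0 i).
  apply: (is_derive_eq (is_derive_sub (flow_is_derive x s i) (is_derive_const _ _ _))).
  by rewrite subr0.
have bYi s : `|Y (flow s x) 0 i| <= M by apply: le_trans (rV_norm_coord _ _) (bY _).
have z0 : `|flow 0 x 0 i - x 0 i| <= M * 0 by rewrite flow0 subrr normr0 mulr0.
have -> : (flow t x - x) 0 i = flow t x 0 i - x 0 i by rewrite !mxE.
have [t0|t0] := leP 0 t.
  rewrite [`|t|]ger0_norm//.
  exact: (is_derive_majorant t0 (fun s _ => dF s) (fun s _ => dM s)).
rewrite [`|t|]ltr0_norm// -[X in flow X]opprK.
apply: (@is_derive_majorant _ (fun s => flow (- s) x 0 i - x 0 i) (fun s => - Y (flow (- s) x) 0 i)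
  (fun s => M * s) (fun=> M) (- t)) => //.
- by rewrite oppr_ge0 ltW.
- by move=> s _; exact: (is_derive_reverse (dF (- s))).
- by move=> s _; rewrite normrN.
by rewrite oppr0.
Qed.

Lemma flow_add (s t : R) x : flow t (flow s x) = flow (t + s) x.
Proof.
have := @ode_unique R n Y K K0 HK (fun r => flow r (flow s x)) (fun r => flow (r + s) x) t.
rewrite flow0 add0r => /(_ erefl) H.
have := H _ _ 1; rewrite mul1r; apply; rewrite ?ler01 ?lexx// => l l01 i.
  exact: flow_is_derive.
have dT (a : R) : is_derive a 1 (fun r : R => r + s) 1.
  apply: (is_derive_eq (is_derive_add (is_derive_id _ _) (is_derive_const a _ s))).
  by rewrite addr0.
have := @is_derive_comp_real R R (fun r => flow r x 0 i) (fun r => r + s) (l * t) 1 1 _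
  (flow_is_derive x _ i) _ (dT _).
rewrite mulr1; apply.
by apply/derivable1_diffP; case: (dT (l * t)).
Qed.

(** The field (x, c) |-> (c Y x, 0) turns the duration of the motion into an
    initial condition, to which smooth dependence applies. *)
Let Yc (w : 'rV[R]_(n + 1)) : 'rV[R]_(n + 1) := row_mx (w 0 (rshift n 0) *: Y (lsubmx w)) 0.
Let gc (t : R) (w : 'rV[R]_(n + 1)) : 'rV[R]_(n + 1) :=
  row_mx (flow (t * w 0 (rshift n 0)) (lsubmx w)) (rsubmx w).

Let sYc : smooth_field Yc.
Proof.
have oT := @openT 'rV[R]_(n + 1).
move=> k r; rewrite -(fintype.splitK k); case: (fintype.split k) => j /=.
  apply: (@class_C_ext R _ _ _ (fun w : 'rV[R]_(n + 1) => w 0 (rshift n 0) * Y (\row_l w 0 (lshift 1 l)) 0 j)) => //.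
    move=> w _; rewrite /Yc row_mxEl mxE; congr (_ * Y _ _ _).
    by apply/rowP => l; rewrite !mxE.
  apply: class_CM => //; first exact: class_C_coord.
  apply: (@class_C_comp_rV R 'rV[R]_(n + 1) n r setT setT (fun x => Y x 0 j)
    (fun l w => w 0 (lshift 1 l))) => // l.
  exact: class_C_coord.
apply: (@class_C_ext R _ _ _ (fun=> 0)) => //; last exact: class_C_cst.
by move=> w _; rewrite /Yc row_mxEr mxE.
Qed.

Let gYc : global_flow Yc gc.
Proof.
split=> [w|w t k]; first by rewrite /gc mul0r flow0 hsubmxK.
rewrite -(fintype.splitK k); case: (fintype.split k) => j /=.
  rewrite /Yc row_mxEl mxE /gc row_mxKl row_mxEr [rsubmx w 0 0]mxE.
  rewrite (_ : (fun s => _) = fun s => flow (s * w 0 (rshift n 0)) (lsubmx w) 0 j); last first.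
    by apply/funext => s; rewrite row_mxEl.
  have dT (a : R) : is_derive a 1 (fun r : R => r * w 0 (rshift n 0)) (w 0 (rshift n 0)).
    apply: (is_derive_eq (is_derive_mul (is_derive_id _ _) (is_derive_const a _ _))).
    by rewrite mul1r mulr0 addr0.
  have := @is_derive_comp_real R R (fun r => flow r (lsubmx w) 0 j)
    (fun r => r * w 0 (rshift n 0)) t 1 _ _ (flow_is_derive (lsubmx w) _ j) _ (dT t).
  rewrite mulrC; apply.
  by apply/derivable1_diffP; case: (dT t).
rewrite /Yc row_mxEr mxE (_ : (fun s => _) = fun=> rsubmx w 0 j).
  exact: is_derive_const.
by apply/funext => s; rewrite /gc row_mxEr.
Qed.

Let bgc : locally_bounded gc.
Proof.
move=> w; exists 1, ((1 + M) * (`|w| + 1)); split=> // w' t w'w /andP[t0 t1].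
have M0 := field_bound_ge0.
have w'1 : `|w'| <= `|w| + 1.
  by have := ler_normD (w' - w) w; rewrite subrK; lra.
have MW : `|w'| <= (1 + M) * (`|w| + 1).
  apply: le_trans w'1 _; rewrite ler_peMl ?addr_ge0// lerDl//.
apply: rV_norm_le => [|k]; first exact: le_trans MW.
rewrite -(fintype.splitK k) /gc; case: (fintype.split k) => j /=; last first.
  by rewrite row_mxEr mxE; apply: le_trans (rV_norm_coord _ _) MW.
rewrite row_mxEl; set c := w' 0 (rshift n 0).
have lw : `|lsubmx w'| <= `|w'|.
  by apply: rV_norm_le => // l; rewrite mxE; exact: rV_norm_coord.
have ct : `|t * c| <= `|w| + 1.
  rewrite normrM ger0_norm//; apply: le_trans (ler_piMl _ t1) _ => //.
  exact: le_trans (rV_norm_coord _ _) w'1.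
apply: le_trans (rV_norm_coord _ _) _.
have := ler_normD (flow (t * c) (lsubmx w') - lsubmx w') (lsubmx w'); rewrite subrK.
move=> /le_trans; apply; rewrite mulrDl mul1r addrC; apply: lerD; first exact: le_trans w'1.
by apply: le_trans (flow_drift _ _) _; rewrite ler_wpM2l.
Qed.

Theorem class_C_flow r (T : 'rV[R]_n -> R) i : class_C r setT T ->
  class_C r setT (fun x => flow (T x) x 0 i).
Proof.
move=> CT.
have oT := @openT 'rV[R]_n.
have C1 := flow_smooth r sYc gYc bgc (lshift 1 i) (t := 1).
have {}C1 := C1 _; rewrite ler01 lexx in C1; have {}C1 := C1 isT.
apply: (@class_C_ext R 'rV[R]_n r _ (fun x => gc 1 (\row_k row_mx x (T x)%:M 0 k) 0 (lshift 1 i))) => //.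
  move=> x _; rewrite (_ : \row_k _ = row_mx x (T x)%:M); last by apply/rowP => k; rewrite mxE.
  by rewrite /gc row_mxEl row_mxEr mxE eqxx mulr1n mul1r row_mxKl.
apply: (@class_C_comp_rV R 'rV[R]_n _ r setT setT (fun w => gc 1 w 0 (lshift 1 i))
  (fun k x => row_mx x (T x)%:M 0 k)) => // k.
rewrite -(fintype.splitK k); case: (fintype.split k) => j /=.
  apply: (@class_C_ext _ _ _ _ (fun x : 'rV[R]_n => x 0 j)) => //.
    by move=> x _; rewrite row_mxEl.
  exact: class_C_coord.
apply: (@class_C_ext _ _ _ _ T) => //.
by move=> x _; rewrite row_mxEr mxE ord1 eqxx mulr1n.
Qed.

Lemma flow_uniform (x : 'rV[R]_n) (T : 'rV[R]_n -> R) (e : R) :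
  (forall x', `|T x' - T x| <= `|x' - x|) -> 0 < e ->
  exists2 d, 0 < d & forall x', `|x' - x| < d ->
    forall l, 0 <= l <= 1 -> `|flow (l * T x') x' - flow (l * T x) x| < e.
Proof.
move=> cT e0.
have [d [C [d0 C0 HC]]] := flow_lipschitz sYc gYc bgc (row_mx x (T x)%:M).
pose e' := Num.min d (e / C).
have e'0 : 0 < e' by rewrite lt_min d0 divr_gt0.
exists e' => // x' xe' l l01.
have Txx' : `|T x' - T x| < e' by exact: le_lt_trans (cT x') xe'.
have wd : `|row_mx x' (T x')%:M - row_mx x (T x)%:M| < e'.
  apply: rV_norm_lt => // k; rewrite -(fintype.splitK k); case: (fintype.split k) => j /=.
    rewrite [X in `|X|](_ : _ = (x' - x) 0 j); last by rewrite [LHS]mxE row_mxEl [X in _ + X]mxE row_mxEl !mxE.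
    by apply: le_lt_trans (rV_norm_coord _ _) _.
  rewrite [X in `|X|](_ : _ = T x' - T x)//.
  by rewrite [LHS]mxE row_mxEr [X in _ + X]mxE row_mxEr !mxE ord1 eqxx !mulr1n.
have wdd : `|row_mx x' (T x')%:M - row_mx x (T x)%:M| < d.
  by apply: lt_le_trans wd _; rewrite ge_min lexx.
have := HC _ l wdd l01.
rewrite /gc !row_mxEr !mxE eqxx !mulr1n !row_mxKl !row_mxKr => H.
have block (a b : 'rV[R]_n) (a' b' : 'rV[R]_1) : `|a - b| <= `|row_mx a a' - row_mx b b'|.
  rewrite opp_row_mx add_row_mx; apply: rV_norm_le => // j.
  by rewrite -[leLHS]/`|(a - b) 0 j| -(row_mxEl (a - b) (a' - b')); exact: rV_norm_coord.
apply: le_lt_trans (block _ _ _ _) _; apply: le_lt_trans H _.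
have : `|row_mx x' (T x')%:M - row_mx x (T x)%:M| < e / C.
  by apply: lt_le_trans wd _; rewrite ge_min lexx orbT.
by rewrite ltr_pdivlMr// mulrC.
Qed.

End BoundedField.

(** * First integrals carried by a tube of orbits *)

Lemma open_norm_ball (R : realType) (E : normedModType R) (y : E) (d : R) :
  open [set x : E | `|x - y| < d].
Proof.
apply: (@open_comp _ _ (fun x : E => `|x - y|) [set r | r < d]); last exact: open_lt.
move=> x _; apply: (@continuous_comp _ _ _ (fun x : E => x - y) (fun x : E => `|x|)).
  by apply: cvgB; [exact: cvg_id|exact: cvg_cst].
exact: norm_continuous.
Qed.

Section Tube.
Variables (R : realType) (n : nat) (tau : 'I_n) (Y : 'rV[R]_n -> 'rV[R]_n)
  (Om : set 'rV[R]_n) (Q : nat -> set 'rV[R]_n)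
  (Yk : nat -> 'rV[R]_n -> 'rV[R]_n) (phi : nat -> R -> 'rV[R]_n -> 'rV[R]_n).

(** The margin in exh_fat is what lets the orbits close to an orbit in Q k
    stay in Q k.+1. *)
Record exhaustion : Prop := Exhaustion {
  exh_sub : forall k x, Q k x -> Om x;
  exh_closed : forall k x, ~ Q k x ->
    exists2 e, 0 < e & forall x', `|x' - x| < e -> ~ Q k x';
  exh_fat : forall k, exists2 d, 0 < d &
    forall x x', Q k x -> `|x' - x| < d -> Q k.+1 x';
  exh_cover : forall x, Om x -> exists k, Q k x
}.

(** The fields Yk are complete modifications of Y, exact on Q k, for which
    the coordinate tau is still the time. *)
Record cutoffs : Prop := Cutoffs {
  cut_eq : forall k x, Q k x -> Yk k x = Y x;
  cut_tau : forall k x, Yk k x 0 tau = 1;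
  cut_lip : forall k, exists2 K, 0 <= K & forall a b, `|Yk k a - Yk k b| <= K * `|a - b|;
  cut_flow : forall k, global_flow (Yk k) (phi k);
  cut_drift : forall k, exists2 M, 0 <= M & forall s x, `|phi k s x - x| <= M * `|s|;
  cut_add : forall k s t x, phi k t (phi k s x) = phi k (t + s) x;
  cut_smooth : forall k r T i, class_C r setT T ->
    class_C r setT (fun x => phi k (T x) x 0 i);
  cut_unif : forall k x (T : 'rV[R]_n -> R) e,
    (forall x', `|T x' - T x| <= `|x' - x|) -> 0 < e ->
    exists2 d, 0 < d & forall x', `|x' - x| < d ->
      forall l, 0 <= l <= 1 -> `|phi k (l * T x') x' - phi k (l * T x) x| < e
}.

Hypotheses (EX : exhaustion) (CU : cutoffs).
Implicit Types (x y : 'rV[R]_n).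

Definition dur (t : R) (y : 'rV[R]_n) : R := t - y 0 tau.

(** Parametrising by the fraction l of the way to the slice tau = t keeps the
    same interval [0, 1] for all starting points and both directions of time. *)
Definition transport k t l y := phi k (l * dur t y) y.

(** y is joined to the slice tau = t by an orbit of Yk inside Q k, where it is
    an orbit of Y. *)
Definition conn k t y := forall l, 0 <= l <= 1 -> Q k (transport k t l y).

Lemma phi0 k y : phi k 0 y = y. Proof. by case: (cut_flow CU k). Qed.

Lemma phi_is_derive k y (t : R) i :
  is_derive t 1 (fun s => phi k s y 0 i) (Yk k (phi k t y) 0 i).
Proof. by case: (cut_flow CU k) => _; apply. Qed.

Lemma phi_tau k s y : phi k s y 0 tau = y 0 tau + s.
Proof.
pose h s := phi k s y 0 tau - s.
have dh (r : R) : is_derive r 1 h 0.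
  apply: (is_derive_eq (is_derive_sub (phi_is_derive k y r tau) (is_derive_id _ _))).
  by rewrite (cut_tau CU) subrr.
by have := is_derive_0_is_cst s 0 dh; rewrite /h phi0; lra.
Qed.

Lemma transport0 k t y : transport k t 0 y = y.
Proof. by rewrite /transport mul0r phi0. Qed.

Lemma transport1 k t y : transport k t 1 y = phi k (dur t y) y.
Proof. by rewrite /transport mul1r. Qed.

Lemma transport_tau k t l y : transport k t l y 0 tau = (1 - l) * y 0 tau + l * t.
Proof. by rewrite /transport phi_tau /dur; ring. Qed.

Lemma transport_slice k t l y : y 0 tau = t -> transport k t l y = y.
Proof. by move=> yt; rewrite /transport /dur yt subrr mulr0 phi0. Qed.

Lemma dur_lip t y y' : `|dur t y' - dur t y| <= `|y' - y|.
Proof.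
have -> : dur t y' - dur t y = (y - y') 0 tau by rewrite !mxE /dur; ring.
by rewrite [leRHS]distrC; exact: rV_norm_coord.
Qed.

Lemma class_C_dur r t : class_C r setT (dur t).
Proof.
have oT := @openT 'rV[R]_n.
by apply: class_CB => //; [exact: class_C_cst|exact: class_C_coord].
Qed.

Lemma Q_mono k k' x : (k <= k')%N -> Q k x -> Q k' x.
Proof.
move=> /subnK <-; elim: (k' - k)%N => [|j IH] Qx; first by rewrite add0n.
have [d d0 Hd] := exh_fat EX (j + k); rewrite addSn; apply: (Hd x) (IH Qx) _.
by rewrite subrr normr0.
Qed.

(** The first orbit stays where both cutoff fields equal Y, so it solves the
    second equation as well. *)
Lemma transport_unique k k' t y :
  (forall l, 0 <= l <= 1 -> Q k (transport k t l y) /\ Q k' (transport k t l y)) ->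
  forall l, 0 <= l <= 1 -> transport k' t l y = transport k t l y.
Proof.
move=> H l l01; have [K K0 HK] := cut_lip CU k'.
apply: (@ode_unique R n (Yk k') K K0 HK (fun s => phi k' s y) (fun s => phi k s y)) l01.
- by rewrite !phi0.
- by move=> a _ i; exact: phi_is_derive.
move=> a a01 i; have [Qk Qk'] := H a a01.
by rewrite (cut_eq CU Qk') -(cut_eq CU Qk); exact: phi_is_derive.
Qed.

Lemma conn_mono k k' t y : (k <= k')%N -> conn k t y ->
  conn k' t y /\ forall l, 0 <= l <= 1 -> transport k' t l y = transport k t l y.
Proof.
move=> kk' ck.
have E l : 0 <= l <= 1 -> transport k' t l y = transport k t l y.
  by apply: transport_unique => a a01; split; [|apply: Q_mono kk' _]; exact: ck.
by split => // l l01; rewrite E//; apply: Q_mono kk' _; exact: ck.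
Qed.

Lemma conn_agree k k' t y l : conn k t y -> conn k' t y -> 0 <= l <= 1 ->
  transport k' t l y = transport k t l y.
Proof.
move=> ck ck' l01; have [_ <-//] := conn_mono (leq_maxl k k') ck.
by have [_ <-] := conn_mono (leq_maxr k k') ck'.
Qed.

Lemma conn_near k t y : conn k t y ->
  exists2 d, 0 < d & forall y', `|y' - y| < d -> conn k.+1 t y'.
Proof.
move=> ck; have [e e0 He] := exh_fat EX k.
have [d d0 Hd] := cut_unif CU k.+1 (dur_lip t y) e0.
exists d => // y' y'y l l01; apply: (He (transport k.+1 t l y)).
  by have [_ ->//] := conn_mono (leqnSn k) ck; exact: ck.
exact: Hd.
Qed.

Lemma nconn_near k t y : ~ conn k t y ->
  exists2 d, 0 < d & forall y', `|y' - y| < d -> ~ conn k t y'.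
Proof.
move=> /existsNP[l /not_implyP[l01 nQ]].
have [e e0 He] := exh_closed EX nQ.
have [d d0 Hd] := cut_unif CU k (dur_lip t y) e0.
exists d => // y' y'y cy'; apply: (He (transport k t l y')); first exact: Hd.
exact: cy'.
Qed.

Section TubeFunction.
Variables (t0 : R) (g : 'rV[R]_n -> R).

(** The value is independent of the chosen k, see [conn_agree]. *)
Definition tube (y : 'rV[R]_n) : R :=
  if pselect (exists k, conn k t0 y) is left h
  then g (transport (sval (cid h)) t0 1 y) else 0.

Lemma tubeE k y : conn k t0 y -> tube y = g (transport k t0 1 y).
Proof.
move=> ck; rewrite /tube; case: pselect => [h|[]]; last by exists k.
case: cid => k' /= ck'; congr (g _).
by apply: conn_agree => //; rewrite ler01 lexx.
Qed.

Lemma tube_neq0 y : tube y != 0 ->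
  exists k, conn k t0 y /\ g (transport k t0 1 y) != 0.
Proof.
rewrite /tube; case: pselect => [h|_]; last by rewrite eqxx.
by case: cid => k /= ck gk; exists k.
Qed.

Lemma tube_slice y : Om y -> y 0 tau = t0 -> tube y = g y.
Proof.
move=> /(exh_cover EX)[k Qy] yt.
have ck : conn k t0 y by move=> l _; rewrite transport_slice.
by rewrite (tubeE ck) transport_slice.
Qed.

Hypothesis gC : forall r, class_C r setT g.

(** The tube of all orbits through the support of g is closed in Om. *)
Hypothesis proper : forall y, Om y -> exists m d, 0 < d /\
  forall y' k, `|y' - y| < d -> conn k t0 y' -> g (transport k t0 1 y') != 0 ->
    conn m t0 y'.

Let h k y := g (transport k t0 1 y).

Let hC k r : class_C r setT (h k).
Proof.
have oT := @openT 'rV[R]_n.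
apply: (@class_C_ext R _ _ _ (fun y => g (\row_i phi k (dur t0 y) y 0 i))) => //.
  move=> y _; rewrite /h transport1; congr (g _).
  by apply/rowP => i; rewrite mxE.
apply: (@class_C_comp_rV R 'rV[R]_n n r setT setT g (fun i y => phi k (dur t0 y) y 0 i)) => // i.
by apply: (cut_smooth CU); exact: class_C_dur.
Qed.

(** If y is not joined to the slice inside Q m, neither are the points near y,
    and by properness the support of g is not reached from them at all. *)
Lemma tube_cases y : Om y -> exists2 d, 0 < d &
  (exists k, Q k y /\ forall y', `|y' - y| < d -> tube y' = h k.+1 y') \/
  (forall y', `|y' - y| < d -> tube y' = 0).
Proof.
move=> /proper[m [d [d0 Hd]]].
have [cm|ncm] := pselect (conn m t0 y).
  have [e e0 He] := conn_near cm; exists e => //; left; exists m; split.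
    by rewrite -(transport0 m t0 y); apply: cm; rewrite lexx ler01.
  by move=> y' /He cy'; exact: tubeE.
have [e e0 He] := nconn_near ncm; exists (Num.min d e); first by rewrite lt_min d0.
right=> y'; rewrite lt_min => /andP[yd ye]; apply/eqP/negP => /negP/tube_neq0[k [ck gk]].
exact: He ye (Hd y' k yd ck gk).
Qed.

Lemma class_C_tube r : class_C r Om tube.
Proof.
apply: class_C_local => y /tube_cases[d d0 H].
exists [set y' | `|y' - y| < d]; split.
- by rewrite /= subrr normr0.
- exact: open_norm_ball.
have oB := @open_norm_ball R _ y d.
case: H => [[k [_ H]]|H].
  apply: (@class_C_ext _ _ _ _ (h k.+1)) => //; first by move=> z /H.
  exact: class_C_sub (hC k.+1 r).
apply: (@class_C_ext _ _ _ _ (fun=> 0)) => //; first by move=> z /H.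
exact: class_C_cst.
Qed.

Lemma tube_invariant y : Om y -> 'd tube y (Y y) = 0.
Proof.
move=> Oy; have dt : differentiable tube y.
  exact: (class_C_differentiable (class_C_tube 1) Oy).
rewrite -deriveE//; have [d d0 [[k [Qy H]]|H]] := tube_cases Oy; last first.
  rewrite (@near_eq_derive _ _ _ _ (cst 0)) ?derive_cst//.
  by apply: filterS (near_dist_lt y d0) => y' /H.
rewrite (@near_eq_derive _ _ _ _ (h k.+1)); last first.
  by apply: filterS (near_dist_lt y d0) => y' /H.
have dh : differentiable (h k.+1) y by exact: (class_C_differentiable (hC k.+1 1) _).
have EY : Y y = Yk k.+1 y by rewrite (cut_eq CU)//; exact: Q_mono (leqnSn k) Qy.
have := @is_derive_along R n (h k.+1) (fun s => phi k.+1 s y) (Yk k.+1 y) 0.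
rewrite phi0 => /(_ dh) D.
have {}D := D _; rewrite deriveE// diff_rV// EY.
have [|_ <-] := D; first by move=> i; have := phi_is_derive k.+1 y 0 i; rewrite phi0.
rewrite (_ : (fun s => _) = cst (h k.+1 y)) ?derive_cst//.
apply/funext => s; rewrite /h !transport1 (cut_add CU); congr (g (phi _ _ _)).
by rewrite /dur phi_tau; ring.
Qed.

End TubeFunction.

End Tube.

(** * Confinement of orbits *)

Section Proper.
Variables (R : realType) (n : nat) (tau : 'I_n) (Y : 'rV[R]_n -> 'rV[R]_n)
  (Om : set 'rV[R]_n) (Q : nat -> set 'rV[R]_n)
  (Yk : nat -> 'rV[R]_n -> 'rV[R]_n) (phi : nat -> R -> 'rV[R]_n -> 'rV[R]_n).
Hypotheses (EX : exhaustion Om Q) (CU : cutoffs tau Y Q Yk phi).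
Implicit Types (x y : 'rV[R]_n) (s t : R).

Let conn := conn tau Q phi.

(** Orbits are labelled by the value s of tau. *)
Definition slice_at k y s := phi k (s - y 0 tau) y.

Definition btw (a b s : R) := (a <= s <= b) || (b <= s <= a).

Lemma slice_at_tau k y s : slice_at k y s 0 tau = s.
Proof. by rewrite /slice_at (phi_tau CU) subrKC. Qed.

Lemma slice_at_slice_at k y s r : slice_at k (slice_at k y s) r = slice_at k y r.
Proof. by rewrite {1}/slice_at slice_at_tau /slice_at (cut_add CU) addrA subrK. Qed.

Lemma slice_at_self k y : slice_at k y (y 0 tau) = y.
Proof. by rewrite /slice_at subrr (phi0 CU). Qed.

Lemma transport_slice_at k t l y :
  transport tau phi k t l y = slice_at k y ((1 - l) * y 0 tau + l * t).
Proof. by rewrite /transport /slice_at /dur; congr (phi _ _ _); ring. Qed.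

Lemma transport1_slice_at k t y : transport tau phi k t 1 y = slice_at k y t.
Proof. by rewrite transport_slice_at; congr slice_at; ring. Qed.

Lemma btw_ratio a b s : btw a b s -> exists2 l, 0 <= l <= 1 & s = (1 - l) * a + l * b.
Proof.
move=> H; have [ab|ab] := eqVneq a b.
  exists 0; first by rewrite lexx ler01.
  by move: H; rewrite ab /btw => /orP[] /le_anti ->; ring.
exists ((s - a) / (b - a)); last by field; rewrite subr_eq0 eq_sym.
have [b0|b0] := ltP 0 (b - a).
  by rewrite divr_ge0 ?(ltW b0)//= ?ler_pdivrMr// ?mul1r; case/orP: H => /andP[]; lra.
have {}b0 : 0 < a - b by rewrite subr_gt0 lt_neqAle eq_sym ab -subr_le0.
have -> : (s - a) / (b - a) = (a - s) / (a - b) by rewrite -opprB -[b - a]opprB invrN mulrNN.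
by rewrite divr_ge0 ?(ltW b0)//= ?ler_pdivrMr// ?mul1r; case/orP: H => /andP[]; lra.
Qed.

Lemma btw_convex a b l : 0 <= l <= 1 -> btw a b ((1 - l) * a + l * b).
Proof.
move=> /andP[l0 l1]; apply/orP; have [ab|ab] := leP a b; [left|right]; apply/andP; split; nra.
Qed.

Lemma connP k t y : conn k t y <-> forall s, btw (y 0 tau) t s -> Q k (slice_at k y s).
Proof.
split=> [c s /btw_ratio[l l01 ->]|c l l01].
  by rewrite -transport_slice_at; exact: c.
by rewrite transport_slice_at; apply: c; exact: btw_convex.
Qed.

Lemma conn_sub k t s y : conn k t y -> btw (y 0 tau) t s -> conn k s y.
Proof.
move=> /connP c H; apply/connP => r Hr; apply: c.
by move: H Hr; rewrite /btw => /orP[] /andP[? ?] /orP[] /andP[? ?]; apply/orP; lra.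
Qed.

Lemma conn_rev k t y : conn k t y -> conn k (y 0 tau) (slice_at k y t).
Proof.
move=> /connP c; apply/connP => s; rewrite slice_at_tau slice_at_slice_at => H; apply: c.
by move: H; rewrite /btw orbC.
Qed.

Lemma conn_slice_at_agree k k' t y s : conn k t y -> conn k' t y -> btw (y 0 tau) t s ->
  slice_at k y s = slice_at k' y s.
Proof.
move=> c c' /btw_ratio[l l01 ->]; rewrite -!transport_slice_at.
exact: (conn_agree EX CU c' c).
Qed.

Lemma conn_le k k' t y : (k <= k')%N -> conn k t y -> conn k' t y.
Proof. by move=> kk' c; have [] := conn_mono EX CU kk' c. Qed.

Lemma conn_cat k k' t s y : conn k s y -> conn k' t (slice_at k y s) ->
  btw (y 0 tau) t s -> conn (maxn k k') t y.
Proof.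
move=> c c' H; set K := maxn k k'.
have cK := conn_le (leq_maxl k k') c; have cK' := conn_le (leq_maxr k k') c'.
have E : slice_at K y s = slice_at k y s.
  by apply: (conn_slice_at_agree cK c); rewrite /btw !lexx !andbT le_total.
apply/connP => r Hr.
have [Hr1|Hr2] : btw (y 0 tau) s r \/ btw s t r.
  have [rs|rs] := leP r s; move: H Hr; rewrite /btw => /orP[] /andP[? ?] /orP[] /andP[? ?];
    (by left; apply/orP; lra) || (by right; apply/orP; lra).
  by move/connP: cK; apply.
move/connP: cK'; rewrite (slice_at_tau k y s) => /(_ r Hr2).
by rewrite -E slice_at_slice_at.
Qed.

Variable I : 'rV[R]_n -> R.
Hypothesis I_open : forall x, 0 < I x ->
  exists2 d, 0 < d & forall x', `|x' - x| < d -> I x / 2 < I x'.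
Hypothesis I_cst : forall k t y, conn k t y -> I (slice_at k y t) = I y.
(** The endpoints of an orbit segment confine the whole segment as long as
    tau keeps its sign and stays away from 0. *)
Hypothesis a_priori : forall b, exists m, forall k t y,
  conn k t y -> Q b y -> Q b (slice_at k y t) -> b.+1%:R^-1 <= I y ->
  b.+1%:R^-1 <= `|y 0 tau| -> b.+1%:R^-1 <= `|t| -> 0 < y 0 tau * t -> conn m t y.

Lemma small_inv (a : R) : 0 < a -> exists b : nat, forall b', (b <= b')%N -> b'.+1%:R^-1 <= a.
Proof.
move=> a0; have i0 : 0 < a^-1 by rewrite invr_gt0.
exists (Num.bound a^-1) => b' bb'; rewrite invf_ple ?posrE//.
have := archi_boundP (ltW i0).
by move=> /ltW/le_trans; apply; rewrite ler_nat; exact: leqW.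
Qed.

Lemma Om_ball y : Om y -> exists b d, 0 < d /\ forall y', `|y' - y| < d ->
  forall b', (b <= b')%N -> Q b' y'.
Proof.
move=> /(exh_cover EX)[b Qb]; have [d d0 Hd] := exh_fat EX b.
exists b.+1, d; split=> // y' y'y b' bb'; apply: (Q_mono EX bb').
exact: Hd Qb y'y.
Qed.

Lemma conn_extend k t y : conn k t y -> exists2 e, 0 < e & forall t', `|t' - t| < e ->
  conn k.+1 t' y.
Proof.
move=> c; have [d d0 Hd] := exh_fat EX k; have [M M0 HM] := cut_drift CU k.+1.
have M1 : 0 < M + 1 by rewrite ltr_wpDl.
have [cS ES] := conn_mono EX CU (leqnSn k) c.
exists (d / (M + 1)); first exact: divr_gt0.
move=> t' t't l l01; apply: (Hd (transport tau phi k.+1 t l y)).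
  by rewrite ES//; exact: c.
have -> : transport tau phi k.+1 t' l y = phi k.+1 (l * (t' - t)) (transport tau phi k.+1 t l y).
  by rewrite /transport (cut_add CU) /dur; congr (phi _ _ _); ring.
apply: le_lt_trans (HM _ _) _; apply: le_lt_trans (_ : (M + 1) * `|t' - t| < d).
  apply: ler_pM => //; first by rewrite lerDl.
  by case/andP: l01 => l0 l1; rewrite normrM ger0_norm// ler_piMl.
by rewrite mulrC -ltr_pdivlMr.
Qed.

Variables (x0 : 'rV[R]_n).
Let t0 := x0 0 tau.
Hypotheses (Ox0 : Om x0) (Ix0 : 0 < I x0) (t00 : t0 != 0).

(** The condition [proper] for functions supported in the ball of radius r
    around x0. *)
Definition proper_near (r : R) := forall y, Om y -> exists m d, 0 < d /\
  forall y' k, `|y' - y| < d -> conn k t0 y' -> `|slice_at k y' t0 - x0| < r ->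
    conn m t0 y'.

Lemma same_side r a : 0 < a -> (exists b, forall b' x, (b <= b')%N -> `|x - x0| < r ->
    Q b' x /\ b'.+1%:R^-1 <= I x) ->
  forall y, Om y -> exists m d, 0 < d /\
  forall y' k, `|y' - y| < d -> conn k t0 y' -> `|slice_at k y' t0 - x0| < r ->
    a <= `|y' 0 tau| -> 0 < y' 0 tau * t0 -> conn m t0 y'.
Proof.
move=> a0 [b Hb] y /Om_ball[b1 [d [d0 Hd]]].
have [b2 Hb2] := small_inv a0.
have t0n : 0 < `|t0| by rewrite normr_gt0.
have [b3 Hb3] := small_inv t0n.
pose b' := (b + b1 + b2 + b3)%N; have [m Hm] := a_priori b'.
exists m, d; split=> // y' k y'y c px ay' yt.
have [Qp Ip] := Hb b' _ (leq_trans (leq_addr _ _) (leq_trans (leq_addr _ _) (leq_addr _ _))) px.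
apply: (Hm k) => //.
- by apply: Hd => //; rewrite /b' -!addnA addnCA leq_addr.
- by rewrite -(I_cst c).
- by apply: le_trans (Hb2 _ _) ay'; rewrite /b' addnAC leq_addl.
by apply: Hb3; rewrite /b' leq_addl.
Qed.

Lemma x0_ball : exists2 r, 0 < r & exists b, forall b' x, (b <= b')%N -> `|x - x0| < r ->
    Q b' x /\ b'.+1%:R^-1 <= I x.
Proof.
have [b [d [d0 Hd]]] := Om_ball Ox0; have [e e0 He] := I_open Ix0.
have I2 : 0 < I x0 / 2 by rewrite divr_gt0.
have [b1 Hb1] := small_inv I2.
exists (Num.min d e); first by rewrite lt_min d0.
exists (b + b1)%N => b' x bb'; rewrite lt_min => /andP[xd xe]; split.
  by apply: Hd => //; exact: leq_trans (leq_addr _ _) bb'.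
apply: le_trans (Hb1 _ (leq_trans (leq_addl _ _) bb')) _.
exact/ltW/He.
Qed.

Lemma tau_near (y y' : 'rV[R]_n) : `|y' 0 tau - y 0 tau| <= `|y' - y|.
Proof.
have -> : y' 0 tau - y 0 tau = (y' - y) 0 tau by rewrite !mxE.
exact: rV_norm_coord.
Qed.

(** All orbits from a neighbourhood of y to the ball have tau of the sign of
    t0, where the a priori bound applies; if tau vanishes at y, or has the other
    sign there, no such orbit exists. *)
Lemma proper_nocross r1 : 0 < r1 ->
  (forall x k, `|x - x0| < r1 -> ~ conn k 0 x) ->
  exists2 r, 0 < r & proper_near r.
Proof.
move=> r10 nB; have [r r0 Hr] := x0_ball.
pose r' := Num.min r r1.
have r'0 : 0 < r' by rewrite lt_min r0.
have r'r x : `|x - x0| < r' -> `|x - x0| < r by rewrite lt_min => /andP[].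
have r'1 x : `|x - x0| < r' -> `|x - x0| < r1 by rewrite lt_min => /andP[].
exists r' => // y Oy.
have cross k y' : conn k t0 y' -> `|slice_at k y' t0 - x0| < r' -> 0 < y' 0 tau * t0.
  move=> c px; rewrite ltNge; apply/negP => yt; apply: (nB (slice_at k y' t0) k (r'1 _ px)).
  apply: conn_sub (conn_rev c) _; rewrite slice_at_tau /btw.
  have [t0p|t0p|t0z] := ltgtP t0 0; last by move: t00; rewrite t0z eqxx.
    by apply/orP; left; apply/andP; split; nra.
  by apply/orP; right; apply/andP; split; nra.
have [yt|] := ltP 0 (y 0 tau * t0).
  have ay : 0 < `|y 0 tau| / 2.
    by rewrite divr_gt0// normr_gt0; apply: contraTneq yt => ->; rewrite mul0r ltxx.
  have [m [d [d0 Hd]]] := same_side ay Hr Oy.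
  exists m, (Num.min d (`|y 0 tau| / 2)); split; first by rewrite lt_min d0.
  move=> y' k; rewrite lt_min => /andP[yd ya] c px; apply: (Hd y' k) => //.
  - exact: r'r.
  - have := le_lt_trans (tau_near y y') ya.
    have := ler_distD (y' 0 tau) (y 0 tau) 0; rewrite !subr0 distrC; lra.
  - exact: cross c px.
have [yz _|ynz yt] := eqVneq (y 0 tau) 0.
  have [k1 Qy] := exh_cover EX Oy.
  have c0 : conn k1 0 y by move=> l _; rewrite (transport_slice CU).
  have [d d0 Hd] := conn_near EX CU c0.
  have d' : 0 < Num.min d `|t0| by rewrite lt_min d0 normr_gt0.
  exists 0%N, (Num.min d `|t0|); split=> // y' k; rewrite lt_min => /andP[y'd y't] c px.
  exfalso; have yt' := cross k y' c px.
  apply: (nB (slice_at k y' t0) (maxn k k1.+1) (r'1 _ px)).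
  apply: (@conn_cat k k1.+1 0 (y' 0 tau)).
  - exact: conn_rev.
  - by rewrite slice_at_slice_at slice_at_self; exact: Hd.
  have := le_lt_trans (tau_near y y') y't; rewrite yz subr0.
  rewrite slice_at_tau /btw; have [t0p|t0p|t0z] := ltgtP t0 0; last by move: t00; rewrite t0z eqxx.
    rewrite (ltr0_norm t0p) ltr_norml => /andP[? ?]; apply/orP; left; apply/andP; split; nra.
  rewrite (gtr0_norm t0p) ltr_norml => /andP[? ?]; apply/orP; right; apply/andP; split; nra.
have yn : 0 < `|y 0 tau| by rewrite normr_gt0.
exists 0%N, `|y 0 tau|; split=> // y' k y'y c px.
exfalso; have := cross k y' c px; have := le_lt_trans (tau_near y y') y'y.
rewrite ltr_norml; have [yp|yp|yz] := ltgtP (y 0 tau) 0; last by rewrite yz eqxx in ynz.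
  by rewrite (ltr0_norm yp) => /andP[? ?] ?; nra.
by rewrite (gtr0_norm yp) => /andP[? ?] ?; nra.
Qed.

(** The orbit of x0 goes a little beyond the slice tau = 0, to tau = q, and so
    do the orbits of the points around x0, inside one set of the exhaustion. An
    orbit from y' to the ball is cut at tau = q when it has to cross tau = 0:
    the piece near x0 is under control and the a priori bound applies to the
    other. *)
Lemma proper_cross k1 : conn k1 0 x0 -> exists2 r, 0 < r & proper_near r.
Proof.
move=> c1; have [e e0 He] := conn_extend c1.
have [r1 r10 [b Hb]] := x0_ball.
have t0n : 0 < `|t0| by rewrite normr_gt0.
have e2 : 0 < e / 2 by rewrite divr_gt0.
(* a slice beyond tau = 0, still reached by the orbit of x0 *)
have [q [qe qt]] : exists q, `|q| = e / 2 /\ q * t0 < 0.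
  have [t0p|t0p|t0z] := ltgtP t0 0; last by move: t00; rewrite t0z eqxx.
    by exists (e / 2); rewrite gtr0_norm//; split=> //; nra.
  by exists (- (e / 2)); rewrite normrN gtr0_norm//; split=> //; nra.
have c2 : conn k1.+1 q x0 by apply: He; rewrite subr0 qe; lra.
have [r2 r20 Hr2] := conn_near EX CU c2.
exists (Num.min r1 r2); first by rewrite lt_min r10.
move=> y Oy.
have a0 : 0 < Num.min (e / 2) `|t0| by rewrite lt_min e2.
have [m [d [d0 Hd]]] := same_side a0 (ex_intro _ b Hb) Oy.
have [b1 [d1 [d10 Hd1]]] := Om_ball Oy.
have [b2 Hb2] := small_inv e2.
pose b' := (b + b1 + b2 + k1.+2)%N; have [m' Hm'] := a_priori b'.
exists (m + maxn m' k1.+2)%N, (Num.min d d1); split; first by rewrite lt_min d0.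
move=> y' k; rewrite !lt_min => /andP[yd yd1] c /andP[px1 px2].
have ce := Hr2 _ px2; have cr := conn_rev c.
have up j : conn j t0 y' -> (j <= m + maxn m' k1.+2)%N -> conn (m + maxn m' k1.+2) t0 y'.
  by move=> cj jm; exact: conn_le cj.
(* y' lies on the controlled piece, or on the side of t0, or beyond q *)
have [yb|ynb] := boolP (btw t0 q (y' 0 tau)).
  have c3 : conn k1.+2 (y' 0 tau) (slice_at k y' t0) by apply: conn_sub ce _; rewrite slice_at_tau.
  apply: (up k1.+2); last by rewrite (leq_trans (leq_maxr m' _))// leq_addl.
  have := conn_rev c3; rewrite slice_at_tau.
  rewrite (conn_slice_at_agree c3 cr) ?slice_at_slice_at ?slice_at_self//.
  by rewrite slice_at_tau /btw !lexx !andbT le_total.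
have [yt|yt] := ltP 0 (y' 0 tau * t0).
  apply: (up m); last exact: leq_addr.
  apply: (Hd y' k) => //; rewrite ge_min; apply/orP; right.
  have [t0p|t0p|t0z] := ltgtP t0 0; last by move: t00; rewrite t0z eqxx.
    have y0 : y' 0 tau < 0 by rewrite -(nmulr_lgt0 _ t0p).
    have q0 : 0 < q by rewrite -(nmulr_llt0 _ t0p).
    rewrite !ltr0_norm// lerN2 leNgt; apply/negP => yq; move/negP: ynb; apply.
    by apply/orP; left; apply/andP; split; lra.
  have y0 : 0 < y' 0 tau by rewrite -(pmulr_lgt0 _ t0p).
  have q0 : q < 0 by rewrite -(pmulr_llt0 _ t0p).
  rewrite !gtr0_norm// leNgt; apply/negP => yq; move/negP: ynb; apply.
  by apply/orP; right; apply/andP; split; lra.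
have [bq yq yqe] : [/\ btw (y' 0 tau) t0 q, 0 < y' 0 tau * q & e / 2 <= `|y' 0 tau|].
  rewrite -qe; have [t0p|t0p|t0z] := ltgtP t0 0; last by move: t00; rewrite t0z eqxx.
    have q0 : 0 < q by rewrite -(nmulr_llt0 _ t0p).
    have y0 : 0 <= y' 0 tau by rewrite -(nmulr_lle0 _ t0p).
    have yq : q < y' 0 tau.
      rewrite ltNge; apply/negP => yq; move/negP: ynb; apply.
      by apply/orP; left; apply/andP; split; lra.
    rewrite !gtr0_norm//; last exact: lt_trans yq.
    split; [by apply/orP; right; apply/andP; split; lra| |exact: ltW].
    by rewrite mulr_gt0//; exact: lt_trans yq.
  have q0 : q < 0 by rewrite -(pmulr_llt0 _ t0p).
  have y0 : y' 0 tau <= 0 by rewrite -(pmulr_lle0 _ t0p).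
  have yq : y' 0 tau < q.
    rewrite ltNge; apply/negP => yq; move/negP: ynb; apply.
    by apply/orP; right; apply/andP; split; lra.
  rewrite !ltr0_norm//; last exact: lt_trans q0.
  split; [by apply/orP; left; apply/andP; split; lra| |by rewrite lerN2 ltW].
  by rewrite nmulr_rgt0//; exact: lt_trans q0.
have cq := conn_sub c bq.
have p1 : slice_at k y' q = slice_at k1.+2 (slice_at k y' t0) q.
  have cq' : conn k q (slice_at k y' t0).
    by apply: conn_sub cr _; rewrite slice_at_tau; move: bq; rewrite /btw orbC.
  rewrite -(slice_at_slice_at k y' t0 q); apply: (conn_slice_at_agree cq' ce).
  by rewrite slice_at_tau /btw !lexx !andbT le_total.
have cmq : conn m' q y'.
  have [Qe Ie] := Hb b' _ (leq_trans (leq_addr _ _) (leq_trans (leq_addr _ _) (leq_addr _ _))) px1.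
  apply: (Hm' k) => //.
  - by apply: Hd1 => //; rewrite /b' -!addnA addnCA leq_addr.
  - rewrite p1; apply: (Q_mono EX (leq_addl _ _ : (k1.+2 <= b')%N)).
    by move/connP: ce; apply; rewrite slice_at_tau /btw !lexx !andbT le_total.
  - by rewrite -(I_cst c).
  - by apply: le_trans (Hb2 _ _) yqe; rewrite /b' addnAC leq_addl.
  - by rewrite qe; apply: Hb2; rewrite /b' addnAC leq_addl.
apply: (up (maxn m' k1.+2)); last exact: leq_addl.
apply: (conn_cat cmq _ bq).
rewrite (conn_slice_at_agree cmq cq) ?p1; last by rewrite /btw !lexx !andbT le_total.
by have := conn_rev ce; rewrite slice_at_tau.
Qed.

End Proper.

(** * The reduced field *)

(** The partial derivatives are bounded, being continuous with bounded
    support. *)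
Lemma bounded_support_lipschitz (R : realType) n (f : 'rV[R]_n -> R) (M : R) :
  (forall r, class_C r setT f) -> (forall x, M < `|x| -> f x = 0) ->
  exists2 K, 0 <= K & (forall x, `|f x| <= K) /\ forall a b, `|f b - f a| <= K * `|b - a|.
Proof.
move=> Cf f0; have df x : differentiable f x by exact: class_C_differentiable (Cf 1) _.
have bd (h : 'rV[R]_n -> R) : continuous h -> (forall x, M < `|x| -> h x = 0) ->
    exists2 B, 0 <= B & forall x, `|h x| <= B.
  move=> ch h0; have [B B0 HB] := continuous_ball_bounded M ch.
  exists B => // x; have [xM|xM] := leP `|x| M; first exact: HB.
  by rewrite h0// normr0.
have [B0 B00 HB0] := bd f (fun x => class_C_continuous (Cf 0%N) I) f0.
have /choice[B HB] (j : 'I_n) : exists B, 0 <= B /\ forall x, `|'D_(delta_mx 0 j) f x| <= B.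
  have [||B b0 HB] := bd ('D_(delta_mx 0 j) f); last by exists B.
    by move=> x; exact: (@class_C_continuous _ _ 0 setT _ _ (class_C_derive _ (Cf 1))).
  move=> x Mx; rewrite (@near_eq_derive _ _ _ _ (cst 0)) ?derive_cst//.
  have e0 : 0 < `|x| - M by rewrite subr_gt0.
  apply: filterS (near_dist_lt x e0) => y yx; apply: f0.
  by have := ler_normD y (x - y); rewrite addrC subrK distrC; lra.
have sB : 0 <= \sum_j B j by apply: sumr_ge0 => j _; case: (HB j).
exists (B0 + \sum_j B j); first exact: addr_ge0.
split=> [x|a b]; first by apply: le_trans (HB0 x) _; rewrite lerDl.
have [c c01 E] := @MVT_le _ _ _ 0 1 ler01 (fun s _ => segment_is_derive a b s df).
rewrite scale1r subrKC scale0r addr0 subr0 mulr1 in E.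
rewrite E; apply: le_trans (lform_le _ _) _; rewrite ler_wpM2r//.
apply: le_trans (_ : \sum_j B j <= _); last by rewrite lerDr.
by apply: ler_sum => j _; exact: (HB j).2.
Qed.

Section ReducedField.
Variables (R : realType) (lam kap : R).
Hypotheses (lam0 : lam != 0) (kap0 : kap != 0).
Local Notation V := 'rV[R]_5.
Implicit Types (x : V).

(** A position (w, z) with w in the plane, and velocities v and y of w and z,
    give the coordinates xi = |w|^2, eta = w.v, zeta = |v|^2, z and y. *)
Definition cxi : 'I_5 := inord 0.
Definition ceta : 'I_5 := inord 1.
Definition czeta : 'I_5 := inord 2.
Definition cz : 'I_5 := inord 3.
Definition cy : 'I_5 := inord 4.

Definition rho x := Num.sqrt (x 0 cxi + x 0 cz ^+ 2).
Definition sig x := rho x ^+ 3 / (kap * x 0 cz).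

(** The motion v' = lam w / rho^3, z' = y, y' = kap z / rho^3 in the rotation
    invariants, with y as the time: everything is divided by kap z / rho^3. *)
Definition fcomp (i : 'I_5) x : R :=
  match val i with
  | 0%N => 2 * x 0 ceta * sig x
  | 1%N => x 0 czeta * sig x + lam * x 0 cxi / (kap * x 0 cz)
  | 2%N => 2 * lam * x 0 ceta / (kap * x 0 cz)
  | 3%N => x 0 cy * sig x
  | _ => 1
  end.

Lemma fcomp_xi x : fcomp cxi x = 2 * x 0 ceta * sig x.
Proof. by rewrite /fcomp [val _](@inordK 4). Qed.
Lemma fcomp_eta x : fcomp ceta x = x 0 czeta * sig x + lam * x 0 cxi / (kap * x 0 cz).
Proof. by rewrite /fcomp [val _](@inordK 4). Qed.
Lemma fcomp_zeta x : fcomp czeta x = 2 * lam * x 0 ceta / (kap * x 0 cz).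
Proof. by rewrite /fcomp [val _](@inordK 4). Qed.
Lemma fcomp_z x : fcomp cz x = x 0 cy * sig x.
Proof. by rewrite /fcomp [val _](@inordK 4). Qed.
Lemma fcomp_y x : fcomp cy x = 1.
Proof. by rewrite /fcomp [val _](@inordK 4). Qed.

Definition field x : V := \row_i fcomp i x.

Definition Om : set V := [set x | 0 < x 0 cz /\ 0 < x 0 cxi].

Lemma open_coord_gt (i : 'I_5) (a : R) : open [set x : V | a < x 0 i].
Proof.
apply: (@open_comp _ _ (fun x : V => x 0 i) [set r | a < r]); last exact: open_gt.
by move=> x _; exact: rV_continuous_coord.
Qed.

Lemma open_coord_lt (i : 'I_5) (a : R) : open [set x : V | x 0 i < a].
Proof.
apply: (@open_comp _ _ (fun x : V => x 0 i) [set r | r < a]); last exact: open_lt.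
by move=> x _; exact: rV_continuous_coord.
Qed.

Lemma open_Om : open Om.
Proof. by apply: openI; exact: open_coord_gt. Qed.

Lemma rho2_gt0 x : Om x -> 0 < x 0 cxi + x 0 cz ^+ 2.
Proof. by move=> [z0 x0]; rewrite addr_gt0// exprn_gt0. Qed.

Lemma rho_gt0 x : Om x -> 0 < rho x.
Proof. by move=> /rho2_gt0; rewrite /rho sqrtr_gt0. Qed.

Lemma class_C_rho r : class_C r Om rho.
Proof.
apply: (@class_C_comp_real R V r Om [set x | 0 < x] Num.sqrt).
- exact: open_Om.
- apply: class_CD; first exact: open_Om.
    by apply: class_C_coord; exact: open_Om.
  by apply: class_CX; [exact: open_Om|apply: class_C_coord; exact: open_Om].
- by move=> z /rho2_gt0.
exact: class_C_sqrt.
Qed.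

Lemma kz_neq0 x : Om x -> kap * x 0 cz != 0.
Proof. by move=> [z0 _]; rewrite mulf_neq0// gt_eqF. Qed.

Lemma class_C_kz r : class_C r Om (fun x => (kap * x 0 cz)^-1).
Proof.
have oO := open_Om.
by apply: class_CV => //; [exact: kz_neq0|apply: class_CZ => //; exact: class_C_coord].
Qed.

Lemma class_C_sig r : class_C r Om sig.
Proof.
have oO := open_Om.
by apply: class_CM => //; [apply: class_CX => //; exact: class_C_rho|exact: class_C_kz].
Qed.

Lemma class_C_fcomp r i : class_C r Om (fcomp i).
Proof.
have oO := open_Om; have Cc j : class_C r Om (fun x : V => x 0 j) by exact: class_C_coord.
have Cs := class_C_sig r; have Ck := class_C_kz r.
case: i => -[|[|[|[|k]]]] ik; rewrite /fcomp /=.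
- by apply: class_CM => //; exact: class_CZ.
- apply: class_CD => //; first exact: class_CM.
  by apply: class_CM => //; exact: class_CZ.
- by apply: class_CM => //; exact: class_CZ.
- exact: class_CM.
- exact: class_C_cst.
Qed.

Definition Qx (k : nat) : set V :=
  [set x | [/\ k.+1%:R^-1 <= x 0 cz, k.+1%:R^-1 <= x 0 cxi & forall i, `|x 0 i| <= k.+1%:R]].

(** The factor normalises the distance from 1/(k+2) to 1/(k+1). *)
Definition cutpos (k : nat) (a : R) := ramp ((a - k.+2%:R^-1) * (k.+1%:R * k.+2%:R)).
Definition cutbig (k : nat) (a : R) := ramp (k.+2%:R ^+ 2 - a ^+ 2).
Definition chi k x := cutpos k (x 0 cz) * cutpos k (x 0 cxi) * \prod_(i < 5) cutbig k (x 0 i).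

Lemma inv_step k : (k.+1%:R^-1 - k.+2%:R^-1) * (k.+1%:R * k.+2%:R) = 1 :> R.
Proof.
have h1 : k.+1%:R != 0 :> R by rewrite pnatr_eq0.
have h2 : k.+2%:R != 0 :> R by rewrite pnatr_eq0.
have e : k.+2%:R = k.+1%:R + 1 :> R by rewrite -natr1.
rewrite e in h2 *; move: (k.+1%:R) h1 h2 => a h1 h2.
by field; rewrite h1 h2.
Qed.

Lemma chi1 k x : Qx k x -> chi k x = 1.
Proof.
move=> [z x0 xi].
have c a : k.+1%:R^-1 <= a -> cutpos k a = 1.
  move=> ka; apply: ramp_ge1; rewrite -[leLHS](inv_step k) ler_wpM2r ?mulr_ge0//.
  by rewrite lerD2r.
rewrite /chi !c// !mul1r big1// => i _; apply: ramp_ge1.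
have := xi i; have e : k.+2%:R = k.+1%:R + 1 :> R by rewrite -natr1.
rewrite e -(real_normK (num_real (x 0 i))); have := normr_ge0 (x 0 i).
have : 0 <= k.+1%:R :> R by []. nra.
Qed.

Lemma chi_small k x : (x 0 cz < k.+2%:R^-1) \/ (x 0 cxi < k.+2%:R^-1) -> chi k x = 0.
Proof.
have c a : a < k.+2%:R^-1 -> cutpos k a = 0.
  move=> ka; apply: ramp_le0; by rewrite mulr_le0_ge0// subr_le0 ltW.
by rewrite /chi; case=> /c ->; rewrite ?mul0r// mulr0 mul0r.
Qed.

Lemma chi_big k x : k.+2%:R < `|x| -> chi k x = 0.
Proof.
move=> kx; have [i xi] : exists i, k.+2%:R < `|x 0 i|.
  apply/not_existsP => H; have : `|x| <= k.+2%:R.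
    by apply: rV_norm_le => // i; rewrite leNgt; apply/negP; exact: H.
  by rewrite leNgt kx.
rewrite /chi (bigD1 i)//= [cutbig k (x 0 i)]ramp_le0 ?mul0r ?mulr0//.
rewrite subr_le0 -(real_normK (num_real (x 0 i))) lerXn2r ?nnegrE//.
exact: ltW.
Qed.

Lemma class_C_chi k r : class_C r setT (chi k).
Proof.
have oT := @openT V; have Cc j : class_C r setT (fun x : V => x 0 j) by exact: class_C_coord.
have Cp j : class_C r setT (fun x : V => cutpos k (x 0 j)).
  apply: (@class_C_comp_real R V r setT setT (@ramp R)) => //; last exact: class_C_ramp.
  apply: class_CM => //; last exact: class_C_cst.
  by apply: class_CB => //; exact: class_C_cst.
apply: class_CM => //; first exact: class_CM.
apply: class_C_prod => // i.
apply: (@class_C_comp_real R V r setT setT (@ramp R)) => //; last exact: class_C_ramp.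
by apply: class_CB => //; [exact: class_C_cst|exact: class_CX].
Qed.

(** The component of y is left alone, so that y remains the time. *)
Definition fieldk k x : V := \row_i (if i == cy then 1 else chi k x * fcomp i x).

(** The components of the field are singular outside of Om, where the cutoff
    vanishes identically. *)
Lemma class_C_cutcomp k r i : class_C r setT (fun x => chi k x * fcomp i x).
Proof.
apply: class_C_local => x _.
have zero : forall D, open D -> D `<=` [set x | chi k x = 0] ->
    class_C r D (fun x => chi k x * fcomp i x).
  move=> D oD sD; apply: (@class_C_ext R V r D (fun=> 0)) => //; last exact: class_C_cst.
  by move=> z /sD /= ->; rewrite mul0r.
have [xO|xO] := pselect (Om x).
  exists Om; split=> //; first exact: open_Om.
  apply: class_CM; [exact: open_Om| |exact: class_C_fcomp].
  exact: class_C_sub (class_C_chi k r).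
have k0 : 0 < k.+2%:R^-1 :> R by rewrite invr_gt0.
have [z0|z0] := ltP (x 0 cz) (k.+2%:R^-1).
  exists [set x : V | x 0 cz < k.+2%:R^-1]; split=> //; first exact: open_coord_lt.
  by apply: zero; [exact: open_coord_lt|move=> z h; apply: chi_small; left].
exists [set x : V | x 0 cxi < k.+2%:R^-1].
have h : x 0 cxi < k.+2%:R^-1.
  rewrite ltNge; apply/negP => x0; apply: xO.
  by split; [exact: lt_le_trans z0|exact: lt_le_trans x0].
split=> //; first exact: open_coord_lt.
by apply: zero; [exact: open_coord_lt|move=> z h'; apply: chi_small; right].
Qed.

Lemma smooth_fieldk k : smooth_field (fieldk k).
Proof.
move=> i r; have [iy|iy] := eqVneq i cy.
  apply: (@class_C_ext R V r _ (fun=> 1)); [exact: openT| |exact: class_C_cst].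
  by move=> x _; rewrite mxE iy eqxx.
apply: (@class_C_ext R V r _ (fun x => chi k x * fcomp i x)); [exact: openT| |exact: class_C_cutcomp].
by move=> x _; rewrite mxE (negbTE iy).
Qed.

Lemma fieldk_bounds k : exists2 K, 0 <= K & (forall x, `|fieldk k x| <= K) /\
  forall a b, `|fieldk k a - fieldk k b| <= K * `|a - b|.
Proof.
have /choice[K HK] (i : 'I_5) : exists K, 0 <= K /\
    ((forall x, `|chi k x * fcomp i x| <= K) /\
    forall a b, `|chi k b * fcomp i b - chi k a * fcomp i a| <= K * `|b - a|).
  have [|x kx|K K0 H] := @bounded_support_lipschitz R 5 (fun x => chi k x * fcomp i x) k.+2%:R.
  - by move=> r; exact: class_C_cutcomp.
  - by rewrite chi_big// mul0r.
  by exists K.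
have K0 : 0 <= \sum_i K i by apply: sumr_ge0 => i _; case: (HK i).
have Ki i : K i <= \sum_i K i.
  by rewrite (bigD1 i)//= lerDl; apply: sumr_ge0 => j _; case: (HK j).
exists (1 + \sum_i K i); first by rewrite addr_ge0.
split=> [x|a b]; apply: rV_norm_le => [|i].
- by rewrite addr_ge0.
- rewrite mxE; case: ifP => _; first by rewrite normr1 lerDl.
  by apply: le_trans ((HK i).2.1 x) (le_trans (Ki i) _); rewrite lerDr.
- by rewrite mulr_ge0// addr_ge0.
rewrite !mxE; case: ifP => _; first by rewrite subrr normr0 mulr_ge0// addr_ge0.
apply: le_trans ((HK i).2.2 b a) _; rewrite ler_wpM2r//.
by apply: le_trans (Ki i) _; rewrite lerDr.
Qed.

Lemma exhaustion_Qx : exhaustion Om Qx.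
Proof.
have k0 k : 0 < k.+1%:R^-1 :> R by rewrite invr_gt0.
have cd (x x' : V) i : `|x' 0 i - x 0 i| <= `|x' - x|.
  have -> : x' 0 i - x 0 i = (x' - x) 0 i by rewrite !mxE.
  exact: rV_norm_coord.
have lt_dist (a b u v : R) : `|u - v| < a - b -> a <= v -> b < u.
  by rewrite ltr_norml => /andP[? ?]; lra.
split.
- by move=> k x [z x0 _]; split; exact: lt_le_trans (k0 k) _.
- move=> k x nQ.
  have [z|z] := ltP (x 0 cz) k.+1%:R^-1.
    exists (k.+1%:R^-1 - x 0 cz); rewrite ?subr_gt0// => x' x'x [z' _ _].
    have := le_lt_trans (cd x x' cz) x'x; rewrite distrC => /lt_dist/(_ z').
    by rewrite ltxx.
  have [x0|x0] := ltP (x 0 cxi) k.+1%:R^-1.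
    exists (k.+1%:R^-1 - x 0 cxi); rewrite ?subr_gt0// => x' x'x [_ x'0 _].
    have := le_lt_trans (cd x x' cxi) x'x; rewrite distrC => /lt_dist/(_ x'0).
    by rewrite ltxx.
  have [i xi] : exists i, k.+1%:R < `|x 0 i|.
    apply/not_existsP => H; apply: nQ; split=> // i.
    by rewrite leNgt; apply/negP; exact: H.
  exists (`|x 0 i| - k.+1%:R); rewrite ?subr_gt0// => x' x'x [_ _ /(_ i) x'i].
  have := le_lt_trans (cd x x' i) x'x; have := ler_distD (x' 0 i) (x 0 i) 0.
  by rewrite !subr0 [`|x 0 i - _|]distrC; lra.
- move=> k; have d0 : 0 < k.+1%:R^-1 - k.+2%:R^-1 :> R.
    by rewrite subr_gt0 ltf_pV2 ?posrE// ltr_nat.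
  exists (Num.min (k.+1%:R^-1 - k.+2%:R^-1) 1); first by rewrite lt_min d0 ltr01.
  move=> x x' [z x0 xi]; rewrite lt_min => /andP[xd x1]; split.
  + exact/ltW/(lt_dist _ _ _ _ (le_lt_trans (cd x x' cz) xd)).
  + exact/ltW/(lt_dist _ _ _ _ (le_lt_trans (cd x x' cxi) xd)).
  + move=> i; have := le_lt_trans (cd x x' i) x1; have := xi i.
    have h3 := ler_distD (x 0 i) (x' 0 i) 0; rewrite !subr0 in h3; have e : k.+2%:R = k.+1%:R + 1 :> R by rewrite -natr1.
    by rewrite e; lra.
move=> x [z0 x0].
have [b1 H1] := small_inv z0; have [b2 H2] := small_inv x0.
exists (b1 + b2 + Num.bound `|x|)%N; split.
- by apply: H1; rewrite -addnA leq_addr.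
- by apply: H2; rewrite addnAC leq_addl.
move=> i; apply: le_trans (rV_norm_coord x i) _.
have := archi_boundP (normr_ge0 x) => /ltW/le_trans; apply.
by rewrite ler_nat; apply: leqW; exact: leq_addl.
Qed.

Lemma cutoffs_exist : exists phi, cutoffs cy field Qx fieldk phi.
Proof.
have /choice[phi Hphi] k : exists g, [/\ global_flow (fieldk k) g,
    (forall s t x, g t (g s x) = g (t + s) x),
    (forall r T i, class_C r setT T -> class_C r setT (fun x => g (T x) x 0 i)),
    (forall x (T : V -> R) e,
      (forall x', `|T x' - T x| <= `|x' - x|) -> 0 < e ->
      exists2 d, 0 < d & forall x', `|x' - x| < d ->
      forall l, 0 <= l <= 1 -> `|g (l * T x') x' - g (l * T x) x| < e)
    & exists2 M, 0 <= M & forall s x, `|g s x - x| <= M * `|s|].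
  have [K K0 [Kb Kl]] := fieldk_bounds k.
  exists (flow (smooth_fieldk k) K0 Kl); split.
  - exact: flow_global.
  - by move=> s t x; exact: flow_add.
  - by move=> r T i CT; exact: (class_C_flow _ Kb).
  - by move=> x T e HT e0; exact: (flow_uniform _ Kb).
  - by exists K => // s x; exact: (flow_drift _ Kb).
exists phi; split.
- move=> k x Qk; apply/rowP => i; rewrite !mxE (chi1 Qk) mul1r.
  by case: eqP => // ->; rewrite fcomp_y.
- by move=> k x; rewrite mxE eqxx.
- by move=> k; have [K K0 [_ Kl]] := fieldk_bounds k; exists K.
- by move=> k; case: (Hphi k).
- by move=> k; case: (Hphi k).
- by move=> k; case: (Hphi k).
- by move=> k; case: (Hphi k).
- by move=> k; case: (Hphi k).
Qed.

End ReducedField.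

(** * A priori bounds from energy and angular momentum *)

Section APriori.
Variables (R : realType) (lam kap : R).
Hypotheses (lam0 : lam != 0) (kap0 : kap != 0).
Local Notation V := 'rV[R]_5.
Implicit Types (x : V).

(** By Lagrange's identity, |w|^2 |v|^2 - (w.v)^2 is the square of the angular
    momentum. *)
Definition amom2 x := x 0 cxi * x 0 czeta - x 0 ceta ^+ 2.
(** The Hamiltonian divided by lam kap. *)
Definition energy x := x 0 czeta / (2 * lam) + x 0 cy ^+ 2 / (2 * kap) + (rho x)^-1.

Section Curve.
Implicit Types (l s : R).
Variables (D : R) (x : R -> V).
Hypothesis Ox : forall l, 0 <= l <= 1 -> Om (x l).
Hypothesis dx : forall l, 0 <= l <= 1 -> forall i,
  is_derive l 1 (fun l => x l 0 i) (D * fcomp lam kap i (x l)).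

Let dxi l (l01 : 0 <= l <= 1) : is_derive l 1 (fun l => x l 0 cxi) (D * (2 * x l 0 ceta * sig kap (x l))).
Proof. by rewrite -(fcomp_xi lam); exact: dx. Qed.
Let deta l (l01 : 0 <= l <= 1) : is_derive l 1 (fun l => x l 0 ceta)
  (D * (x l 0 czeta * sig kap (x l) + lam * x l 0 cxi / (kap * x l 0 cz))).
Proof. by rewrite -fcomp_eta; exact: dx. Qed.
Let dzeta l (l01 : 0 <= l <= 1) : is_derive l 1 (fun l => x l 0 czeta)
  (D * (2 * lam * x l 0 ceta / (kap * x l 0 cz))).
Proof. by rewrite -fcomp_zeta; exact: dx. Qed.
Let dz l (l01 : 0 <= l <= 1) : is_derive l 1 (fun l => x l 0 cz) (D * (x l 0 cy * sig kap (x l))).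
Proof. by rewrite -(fcomp_z lam); exact: dx. Qed.
Let dy l (l01 : 0 <= l <= 1) : is_derive l 1 (fun l => x l 0 cy) D.
Proof. by apply: (is_derive_eq (dx l01 cy)); rewrite fcomp_y mulr1. Qed.

Lemma curve_amom2 l : 0 <= l <= 1 -> amom2 (x l) = amom2 (x 0).
Proof.
move=> /andP[l0 l1]; apply: (@is_derive_cst_segment _ (fun l => amom2 (x l))) => // s /andP[s0 sl].
have s01 : 0 <= s <= 1 by rewrite s0 (le_trans sl).
apply: (is_derive_eq (is_derive_sub (is_derive_mul (dxi s01) (dzeta s01)) (is_derive_exp 2 (deta s01)))).
by rewrite /= expr1; ring.
Qed.

Lemma curve_energy l : 0 <= l <= 1 -> energy (x l) = energy (x 0).
Proof.
move=> /andP[l0 l1]; apply: (@is_derive_cst_segment _ (fun l => energy (x l))) => // s /andP[s0 sl].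
have s01 : 0 <= s <= 1 by rewrite s0 (le_trans sl).
have r0 := rho_gt0 (Ox s01); have r2 := rho2_gt0 (Ox s01).
have z0 : x s 0 cz != 0 by rewrite gt_eqF//; case: (Ox s01).
have dr2 := is_derive_add (dxi s01) (is_derive_exp 2 (dz s01)).
have dr2' : differentiable (fun l => x l 0 cxi + x l 0 cz ^+ 2) s.
  by apply/derivable1_diffP; case: dr2.
have drho := @is_derive_comp_real R R Num.sqrt (fun l => x l 0 cxi + x l 0 cz ^+ 2)
  s 1 _ _ (is_derive1_sqrt r2) dr2' dr2.
have rn : Num.sqrt (x s 0 cxi + x s 0 cz ^+ 2) != 0 by rewrite gt_eqF// sqrtr_gt0.
have dri := @is_derive_inv R R (fun l => Num.sqrt (x l 0 cxi + x l 0 cz ^+ 2)) s 1 _ rn drho.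
apply: (is_derive_eq (is_derive_add (is_derive_add
  (is_derive_mul (dzeta s01) (is_derive_const s 1 (2 * lam)^-1))
  (is_derive_mul (is_derive_exp 2 (dy s01)) (is_derive_const s 1 (2 * kap)^-1))) dri)).
rewrite /sig -/(rho (x s)) /=.
have r0' : rho (x s) != 0 by rewrite gt_eqF.
by field; rewrite r0' z0 lam0 kap0.
Qed.

Variable bt : R.
Hypotheses (bt1 : 1 <= bt) (y_lin : forall l, 0 <= l <= 1 -> x l 0 cy = x 0 0 cy + l * D).
Hypotheses (z0b : bt^-1 <= x 0 0 cz) (z1b : bt^-1 <= x 1 0 cz)
  (x0b : forall i, `|x 0 0 i| <= bt) (x1b : forall i, `|x 1 0 i| <= bt)
  (Ib : bt^-1 <= amom2 (x 0))
  (y0b : bt^-1 <= `|x 0 0 cy|) (y1b : bt^-1 <= `|x 1 0 cy|) (yy : 0 < x 0 0 cy * x 1 0 cy).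

Let bt0 : 0 < bt. Proof. exact: lt_le_trans ltr01 bt1. Qed.

Let y_sign l : 0 <= l <= 1 -> 0 < x 0 0 cy * x l 0 cy /\ bt^-1 <= `|x l 0 cy| <= bt.
Proof.
move=> l01; have /andP[l0 l1] := l01.
have i0 : 0 < bt^-1 by rewrite invr_gt0.
have := y_lin l01; have := y_lin (l := 1); rewrite ler01 lexx => /(_ isT).
move: i0 yy y0b y1b (x0b cy) (x1b cy).
move: bt^-1 (x 0 0 cy) (x l 0 cy) (x 1 0 cy) => ib a c b i0 ab a0 b0 a1 b1 Eb Ec.
have m0 : 0 <= 1 - l by rewrite subr_ge0.
have {Eb Ec} Ec : c = (1 - l) * a + l * b by rewrite Ec Eb; ring.
have between (u v w : R) : u <= w -> v <= w -> (1 - l) * u + l * v <= w.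
  by move=> uw vw; have := ler_wpM2l m0 uw; have := ler_wpM2l l0 vw; lra.
have [ap|ap|az] := ltgtP a 0; last by move: ab; rewrite az mul0r ltxx.
  have bp : b < 0 by rewrite -(nmulr_rgt0 _ ap).
  rewrite (ltr0_norm ap) (ltr0_norm bp) in a0 b0 a1 b1.
  have cb : c <= - ib by rewrite Ec; apply: between; lra.
  have cn : c < 0 by apply: le_lt_trans cb _; rewrite oppr_lt0.
  rewrite (ltr0_norm cn) nmulr_rgt0//; split=> //; apply/andP; split; first by lra.
  by have := between (- a) (- b) bt a1 b1; rewrite Ec; lra.
have bp : 0 < b by rewrite -(pmulr_rgt0 _ ap).
rewrite (gtr0_norm ap) (gtr0_norm bp) in a0 b0 a1 b1.
have cb : ib <= c.
  have na : - a <= - ib by lra.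
  have nb : - b <= - ib by lra.
  by have := between _ _ _ na nb; rewrite Ec; lra.
have cn : 0 < c by exact: lt_le_trans cb.
rewrite (gtr0_norm cn) pmulr_rgt0//; split=> //; apply/andP; split=> //.
by rewrite Ec; exact: between.
Qed.

Let sig_kap l : 0 <= l <= 1 -> 0 < sig kap (x l) * kap.
Proof.
move=> l01; have r0 := rho_gt0 (Ox l01); have [z0 _] := Ox l01.
have -> : sig kap (x l) * kap = rho (x l) ^+ 3 / x l 0 cz.
  by rewrite /sig; field; rewrite kap0 gt_eqF.
by rewrite divr_gt0// exprn_gt0.
Qed.

(** y keeps its sign along the segment, hence z is monotone. *)
Let direction : exists e : R, e ^+ 2 = 1 /\ forall l, 0 <= l <= 1 ->
  e * (D * (x l 0 cy * sig kap (x l))) = `|D| * `|x l 0 cy| * `|sig kap (x l)|.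
Proof.
pose a := D * x 0 0 cy * kap.
exists (if 0 <= a then 1 else -1); split; first by case: ifP => _; rewrite ?expr1n// sqrrN expr1n.
move=> l l01; have [s0 _] := y_sign l01; have s1 := sig_kap l01.
rewrite -!normrM -mulrA -[RHS]/(`|_|).
have E : D * (x l 0 cy * sig kap (x l)) * ((x 0 0 cy) ^+ 2 * kap ^+ 2) =
    a * ((x 0 0 cy * x l 0 cy) * (sig kap (x l) * kap)) by rewrite /a; ring.
have p1 : 0 < x 0 0 cy ^+ 2 * kap ^+ 2.
  rewrite mulr_gt0// exprn_even_gt0//= ?kap0//.
  by apply/eqP => z; move: s0; rewrite z mul0r ltxx.
have p2 := mulr_gt0 s0 s1.
case: ifPn => a0.
  rewrite mul1r ger0_norm// -(pmulr_lge0 _ p1) E mulr_ge0// ltW//.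
rewrite mulN1r ltr0_norm// -(pmulr_llt0 _ p1) E pmulr_llt0// ltNge //.
Qed.

Let zb l : 0 <= l <= 1 -> bt^-1 <= x l 0 cz <= bt.
Proof.
move=> l01; have /andP[l0 l1] := l01; have [e [e2 He]] := direction.
(* e is the sign of the derivative of z *)
have mono a b : 0 <= a -> a <= b -> b <= 1 -> e * x a 0 cz <= e * x b 0 cz.
  move=> a0 ab b1.
  apply: (@is_derive_nondecreasing _ (fun l => e * x l 0 cz)
    (fun l => e * (D * (x l 0 cy * sig kap (x l)))) a b ab) => s /andP[sa sb].
  have s01 : 0 <= s <= 1 by rewrite (le_trans a0)//= (le_trans sb).
  split; first by apply: is_derive_scale; exact: dz.
  by rewrite He// !mulr_ge0.
have h0 := mono 0 l (lexx _) l0 l1; have h1 := mono l 1 l0 l1 (lexx _).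
have b0 := x0b cz; have b1 := x1b cz.
rewrite !ler_norml in b0 b1; case/andP: b0 => _ b0; case/andP: b1 => _ b1.
have c0 := z0b; have c1 := z1b; move: bt^-1 c0 c1 => ib c0 c1.
have : (e == 1) || (e == -1) by rewrite -eqf_sqr expr1n e2.
case/orP => /eqP ee; rewrite ee in h0 h1; apply/andP; split; lra.
Qed.

Definition bound_h := bt / (2 * `|lam|) + bt ^+ 2 / (2 * `|kap|) + bt.
(** Energy bounds zeta, since y and 1/rho are bounded. *)
Definition bound_zeta := 2 * `|lam| * (bound_h + bt ^+ 2 / (2 * `|kap|) + bt).
(** The derivative of sqrt xi is at most sqrt zeta * |D sig| and that of the
    monotone function z is |y D sig|, so that sqrt xi varies by at most
    bt * sqrt zeta times the variation of z. *)
Definition bound_root := bt + bt * Num.sqrt bound_zeta * bt.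
Definition bound_all := bt + bound_zeta + bound_root ^+ 2 + (bound_root ^+ 2 * bound_zeta + 1) + bt * bound_zeta.

Lemma bound_all_gt0 : 0 < bound_all.
Proof.
have b0 := bt0.
have h0 : 0 <= bound_h.
  by rewrite !addr_ge0 ?divr_ge0 ?mulr_ge0 ?exprn_ge0 ?(ltW b0).
have z0 : 0 <= bound_zeta.
  by rewrite mulr_ge0 ?mulr_ge0// !addr_ge0// ?divr_ge0 ?mulr_ge0 ?exprn_ge0 ?(ltW b0).
have r0 : 0 <= bound_root ^+ 2 * bound_zeta by rewrite mulr_ge0// sqr_ge0.
have t0 : 0 <= bt * bound_zeta by rewrite mulr_ge0// ltW.
have := sqr_ge0 bound_root; rewrite /bound_all; lra.
Qed.

Let l0n : 0 < `|lam|. Proof. by rewrite normr_gt0. Qed.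
Let k0n : 0 < `|kap|. Proof. by rewrite normr_gt0. Qed.

Let in00 : 0 <= (0 : R) <= 1.
Proof. by rewrite lexx ler01. Qed.

Let norm2 (a : R) : `|2 * a| = 2 * `|a|.
Proof. by rewrite normrM ger0_norm. Qed.

Let y2b l : 0 <= l <= 1 -> `|x l 0 cy ^+ 2 / (2 * kap)| <= bt ^+ 2 / (2 * `|kap|).
Proof.
move=> /y_sign[_ /andP[_ yb]].
rewrite normrM normfV norm2 normrX ler_wpM2r ?invr_ge0 ?mulr_ge0//.
by rewrite lerXn2r ?nnegrE// ltW.
Qed.

Let rhob l : 0 <= l <= 1 -> `|(rho (x l))^-1| <= bt.
Proof.
move=> l01; have r0 := rho_gt0 (Ox l01); have [z0 xi0] := Ox l01.
have /andP[zb1 _] := zb l01.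
rewrite gtr0_norm ?invr_gt0// invf_ple ?posrE//; apply: le_trans zb1 _.
rewrite -[leLHS]ger0_norm ?(ltW z0)// -sqrtr_sqr ler_wsqrtr// lerDr ltW//.
Qed.

Let zeta_gt0 l : 0 <= l <= 1 -> 0 < x l 0 czeta.
Proof.
move=> l01; have [z0 xi0] := Ox l01; rewrite -(pmulr_rgt0 _ xi0).
have : 0 < amom2 (x l).
  by rewrite curve_amom2//; apply: lt_le_trans Ib; rewrite invr_gt0.
by rewrite /amom2 subr_gt0; apply: le_lt_trans; exact: sqr_ge0.
Qed.

Let zetab l : 0 <= l <= 1 -> x l 0 czeta <= bound_zeta.
Proof.
move=> l01; have z00 := in00.
have E0 : `|energy (x 0)| <= bound_h.
  apply: le_trans (ler_normD _ _) _; apply: lerD; last exact: rhob.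
  apply: le_trans (ler_normD _ _) _; apply: lerD; last exact: y2b.
  rewrite normrM normfV norm2 ler_wpM2r ?invr_ge0 ?mulr_ge0//.
have E1 : x l 0 czeta = 2 * lam * (energy (x 0) - x l 0 cy ^+ 2 / (2 * kap) - (rho (x l))^-1).
  rewrite -(curve_energy l01) /energy; field; rewrite kap0 lam0.
  by rewrite gt_eqF// rho_gt0//; exact: Ox.
rewrite E1; apply: le_trans (ler_norm _) _; rewrite normrM norm2.
rewrite ler_wpM2l ?mulr_ge0//.
apply: le_trans (ler_normB _ _) _; apply: lerD; last exact: rhob.
by apply: le_trans (ler_normB _ _) _; apply: lerD => //; exact: y2b.
Qed.

Let bz0 : 0 < bound_zeta.
Proof.
have z00 := in00.
exact: lt_le_trans (zeta_gt0 z00) (zetab z00).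
Qed.

Let rootb l : 0 <= l <= 1 -> Num.sqrt (x l 0 cxi) <= bound_root.
Proof.
move=> l01; have /andP[l0 l1] := l01; have [e [e2 He]] := direction.
pose C := bt * Num.sqrt bound_zeta.
have C0 : 0 <= C by rewrite mulr_ge0 ?sqrtr_ge0// ltW.
have dsq s (s01 : 0 <= s <= 1) : is_derive s 1 (fun l => Num.sqrt (x l 0 cxi) - Num.sqrt (x 0 0 cxi))
    ((2 * Num.sqrt (x s 0 cxi))^-1 * (D * (2 * x s 0 ceta * sig kap (x s)))).
  have [_ xi0] := Ox s01; have dxs := dxi s01.
  have df : differentiable (fun l => x l 0 cxi) s by apply/derivable1_diffP; case: dxs.
  apply: (is_derive_eq (is_derive_sub (@is_derive_comp_real R R Num.sqrt (fun l => x l 0 cxi) s 1 _ _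
    (is_derive1_sqrt xi0) df dxs) (is_derive_const _ _ _))).
  by rewrite subr0.
have dw s (s01 : 0 <= s <= 1) : is_derive s 1 (fun l => C * (e * (x l 0 cz - x 0 0 cz)))
    (C * (e * (D * (x s 0 cy * sig kap (x s))))).
  apply: is_derive_scale; apply: is_derive_scale.
  by apply: (is_derive_eq (is_derive_sub (dz s01) (is_derive_const _ _ _))); rewrite subr0.
have in01 s : 0 <= s <= l -> 0 <= s <= 1 by move=> /andP[-> sl]; exact: le_trans l1.
have := @is_derive_majorant R _ _ _ _ l l0 (fun s sl => dsq s (in01 s sl)) (fun s sl => dw s (in01 s sl)).
rewrite !subrr normr0 !mulr0 lexx => H.
have {}H : `|Num.sqrt (x l 0 cxi) - Num.sqrt (x 0 0 cxi)| <= C * (e * (x l 0 cz - x 0 0 cz)).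
  apply: H => // s /in01 s01; rewrite He//.
  have [_ xi0] := Ox s01; have zt0 := zeta_gt0 s01; have [_ /andP[yb _]] := y_sign s01.
  have q0 : 0 < Num.sqrt (x s 0 cxi) by rewrite sqrtr_gt0.
  have -> : (2 * Num.sqrt (x s 0 cxi))^-1 * (D * (2 * x s 0 ceta * sig kap (x s))) =
      D * sig kap (x s) * (x s 0 ceta / Num.sqrt (x s 0 cxi)).
    by field; rewrite gt_eqF.
  rewrite /C [leLHS](_ : _ = `|D| * `|sig kap (x s)| *
    (`|x s 0 ceta| * `|(Num.sqrt (x s 0 cxi))^-1|)); last by rewrite -!normrM.
  have eb : `|x s 0 ceta| * `|(Num.sqrt (x s 0 cxi))^-1| <= Num.sqrt bound_zeta.
    rewrite normfV (gtr0_norm q0) ler_pdivrMr// -sqrtr_sqr -sqrtrM ?(ltW bz0)//.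
    rewrite ler_wsqrtr//; apply: le_trans (_ : x s 0 czeta * x s 0 cxi <= _).
      have : 0 <= amom2 (x s).
        by rewrite curve_amom2//; apply: le_trans Ib; rewrite invr_ge0 ltW.
      by rewrite /amom2 mulrC subr_ge0 mulrC.
    by rewrite ler_wpM2r ?(ltW xi0)// zetab.
  have h1 : 1 <= bt * `|x s 0 cy| by rewrite mulrC -ler_pdivrMr// div1r.
  have -> : bt * Num.sqrt bound_zeta * (`|D| * `|x s 0 cy| * `|sig kap (x s)|) =
    `|D| * `|sig kap (x s)| * (Num.sqrt bound_zeta * (bt * `|x s 0 cy|)) by ring.
  rewrite ler_wpM2l ?mulr_ge0//; apply: le_trans eb _.
  by rewrite ler_peMr ?sqrtr_ge0.
have /andP[z1 z2] := zb l01; have /andP[z3 z4] : bt^-1 <= x 0 0 cz <= bt by apply: zb; exact: in00.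
have i0 : 0 < bt^-1 by rewrite invr_gt0.
have ez' := le_trans (ltW i0) z1; have ez0 := le_trans (ltW i0) z3.
have ez : e * (x l 0 cz - x 0 0 cz) <= bt.
  have : (e == 1) || (e == -1) by rewrite -eqf_sqr expr1n e2.
  by case/orP => /eqP ->; lra.
have s0 : Num.sqrt (x 0 0 cxi) <= bt.
  have := x0b cxi; rewrite ler_norml => /andP[_ h].
  rewrite -[leRHS]ger0_norm ?(ltW bt0)// -sqrtr_sqr ler_wsqrtr//.
  by apply: le_trans h _; rewrite expr2 ler_peMr// ltW.
have := ler_wpM2l C0 ez; rewrite /bound_root -/C.
by move: H; rewrite ler_norml => /andP[_ H]; lra.
Qed.

(** Upper bounds come from energy; xi is bounded below because xi zeta is at
    least the square of the angular momentum. *)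
Lemma curve_bounded l : 0 <= l <= 1 ->
  [/\ bound_all^-1 <= x l 0 cz, bound_all^-1 <= x l 0 cxi &
    [/\ `|x l 0 cxi| <= bound_all, `|x l 0 ceta| <= bound_all, `|x l 0 czeta| <= bound_all,
       `|x l 0 cz| <= bound_all & `|x l 0 cy| <= bound_all]].
Proof.
move=> l01; have [z0 xi0] := Ox l01; have zt0 := zeta_gt0 l01.
have /andP[z1 z2] := zb l01; have [_ /andP[_ yb]] := y_sign l01.
have zt := zetab l01; have rt := rootb l01.
have r2 : 0 <= bound_root ^+ 2 := sqr_ge0 _.
have bz := bz0; have b0 := bt0.
have p1 : 0 <= bound_root ^+ 2 * bound_zeta by rewrite mulr_ge0// ltW.
have p2 : 0 < bt * bound_zeta by rewrite mulr_gt0.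
have A0 : 0 < bound_all by rewrite /bound_all; lra.
have xb : x l 0 cxi <= bound_root ^+ 2.
  rewrite -[leLHS]sqr_sqrtr ?(ltW xi0)// lerXn2r ?nnegrE ?sqrtr_ge0//.
  exact: le_trans (sqrtr_ge0 _) rt.
have Il : amom2 (x l) = amom2 (x 0) := curve_amom2 l01.
have i0 : 0 < bt^-1 by rewrite invr_gt0.
have xz : bt^-1 <= x l 0 cxi * bound_zeta.
  apply: le_trans Ib _; rewrite -Il /amom2.
  apply: le_trans (_ : x l 0 cxi * x l 0 czeta <= _); first by rewrite gerBl sqr_ge0.
  by rewrite ler_wpM2l// ltW.
have e2 : x l 0 ceta ^+ 2 <= bound_root ^+ 2 * bound_zeta.
  apply: le_trans (_ : x l 0 cxi * x l 0 czeta <= _).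
    have : 0 < amom2 (x l) by rewrite Il; exact: lt_le_trans Ib.
    by rewrite /amom2 subr_gt0 => /ltW.
  by apply: ler_pM => //; exact: ltW.
have eb : `|x l 0 ceta| <= bound_root ^+ 2 * bound_zeta + 1.
  rewrite -(real_normK (num_real (x l 0 ceta))) in e2.
  by have := sqr_ge0 (`|x l 0 ceta| - 1); nra.
split.
- apply: le_trans z1; rewrite lef_pV2 ?posrE//; rewrite /bound_all; lra.
- have : (bt * bound_zeta)^-1 <= x l 0 cxi by rewrite invfM ler_pdivrMr.
  by apply: le_trans; rewrite lef_pV2 ?posrE// /bound_all; lra.
split; rewrite ?(gtr0_norm xi0) ?(gtr0_norm zt0) ?(gtr0_norm z0) /bound_all; lra.
Qed.

End Curve.

End APriori.

(** * Local integrals of the reduced field *)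

(** A tube function is explicit on its slice only, and the line lies there. *)
Lemma derive_along_line (R : realType) (E : normedModType R) (f g : E -> R) (x w : E) :
  (\forall t \near (0 : R), f (t *: w + x) = g (t *: w + x)) -> 'D_w f x = 'D_w g x.
Proof.
move=> fg; rewrite /derive; congr (lim _).
have fgx : f x = g x by have := nbhs_singleton fg; rewrite scale0r add0r.
have H : \forall h \near (0 : R)^',
    h^-1 *: ((f \o shift x) (h *: w) - f x) = h^-1 *: ((g \o shift x) (h *: w) - g x).
  by apply: nbhs_dnbhs; apply: filterS fg => h /= ->; rewrite fgx.
rewrite eqEsubset; split; apply: near_eq_cvg => //.
by apply: filterS H => h.
Qed.

Section LocalIntegrals.
Variables (R : realType) (lam kap : R).
Hypotheses (lam0 : lam != 0) (kap0 : kap != 0).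
Local Notation V := 'rV[R]_5.
Implicit Types (x y : V).

Lemma class_C_amom2 r : class_C r setT (@amom2 R).
Proof.
have oT := @openT V; have Cc j : class_C r setT (fun x : V => x 0 j) by exact: class_C_coord.
by apply: class_CB => //; [exact: class_CM|exact: class_CX].
Qed.

Lemma amom2_open x : 0 < amom2 x -> exists2 d, 0 < d &
  forall x', `|x' - x| < d -> amom2 x / 2 < amom2 x'.
Proof.
move=> x0; have [K K0 HK] := class_C1_lipschitz (`|x| + 1) (class_C_amom2 1).
have K1 : 0 < K + 1 by rewrite ltr_wpDl.
exists (Num.min 1 (amom2 x / 2 / (K + 1))).
  by rewrite lt_min ltr01/= divr_gt0// divr_gt0.
move=> x'; rewrite lt_min => /andP[x1 xd].
have n1 : `|x| <= `|x| + 1 by rewrite lerDl.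
have n2 : `|x'| <= `|x| + 1 by have := ler_normD (x' - x) x; rewrite subrK; lra.
have h1 := HK x x' n1 n2.
have h2 : (K + 1) * `|x' - x| < amom2 x / 2 by rewrite mulrC -ltr_pdivlMr.
have h3 : K * `|x' - x| <= (K + 1) * `|x' - x| by rewrite ler_wpM2r// lerDl.
have := le_lt_trans (le_trans h1 h3) h2; rewrite ltr_norml => /andP[? ?]; lra.
Qed.

Variable phi : nat -> R -> V -> V.
Hypothesis CU : cutoffs cy (field lam kap) (@Qx R) (fieldk lam kap) phi.
Let EX := exhaustion_Qx R.
Let conn := conn cy (@Qx R) phi.
Let tr := transport cy phi.

Lemma transport_Om k t y l : conn k t y -> 0 <= l <= 1 -> Om (tr k t l y).
Proof. by move=> c l01; apply: (exh_sub EX); exact: c. Qed.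

Lemma transport_is_derive k t y (l : R) i : conn k t y -> 0 <= l <= 1 ->
  is_derive l 1 (fun l => tr k t l y 0 i) (dur cy t y * fcomp lam kap i (tr k t l y)).
Proof.
move=> c l01.
have dT : is_derive l 1 (fun r : R => r * dur cy t y) (dur cy t y).
  apply: (is_derive_eq (is_derive_mul (is_derive_id _ _) (is_derive_const l _ _))).
  by rewrite mul1r mulr0 addr0.
have dT' : differentiable (fun r : R => r * dur cy t y) l.
  by apply/derivable1_diffP; case: dT.
have := @is_derive_comp_real R R (fun s => phi k s y 0 i) (fun r => r * dur cy t y) l 1
  _ _ (phi_is_derive CU k y (l * dur cy t y) i) dT' dT.
rewrite [phi k _ _](_ : _ = tr k t l y)// (cut_eq CU); last exact: c.
by rewrite mxE mulrC.
Qed.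

Lemma conn_amom2 k t y : conn k t y -> amom2 (slice_at cy phi k y t) = amom2 y.
Proof.
move=> c; rewrite -(transport1_slice_at cy).
have := @curve_amom2 R lam kap (dur cy t y) (fun l => tr k t l y)
  (fun l l01 i => @transport_is_derive k t y l i c l01) 1.
by rewrite /tr (transport0 CU); apply; rewrite ler01 lexx.
Qed.

Lemma a_priori_reduced (b : nat) : exists m, forall k t y,
  conn k t y -> Qx b y -> Qx b (slice_at cy phi k y t) -> b.+1%:R^-1 <= amom2 y ->
  b.+1%:R^-1 <= `|y 0 cy| -> b.+1%:R^-1 <= `|t| -> 0 < y 0 cy * t -> conn m t y.
Proof.
pose N := bound_all lam kap (b.+1%:R : R).
have [m Hm] : exists m : nat, N <= m.+1%:R.
  have [N0|N0] := leP 0 N.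
    exists (Num.bound N); have := archi_boundP N0 => /ltW/le_trans; apply.
    by rewrite ler_nat.
  by exists 0%N; exact: le_trans (ltW N0) _.
exists m => k t y c Qy Qe Iy y0 t0 yt.
have cb : forall l, 0 <= l <= 1 -> Qx m (tr k t l y).
  move=> l l01; have in1 : 0 <= (1 : R) <= 1 by rewrite ler01 lexx.
  have b1 : 1 <= b.+1%:R :> R by rewrite ler1n.
  have [z0 _ x0] := Qy; have [z1 _ x1] := Qe.
  have pe : slice_at cy phi k y t = tr k t 1 y by rewrite -(transport1_slice_at cy).
  have ps : tr k t 0 y = y by rewrite /tr (transport0 CU).
  have et : tr k t 1 y 0 cy = t by rewrite -pe (slice_at_tau CU).
  have := @curve_bounded R lam kap lam0 kap0 (dur cy t y) (fun l => tr k t l y)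
    (fun l => @transport_Om k t y l c) (fun l l01 i => @transport_is_derive k t y l i c l01)
    b.+1%:R b1 _ _ _ _ _ _ _ _ _ l l01.
  rewrite ps et -pe -/N => /(_ _ z0 z1 x0 x1 Iy y0 t0 yt)[].
    by move=> s _; rewrite /tr (transport_tau CU) /dur; ring.
  move=> hz hx [h0 h1 h2 h3 h4].
  have h4' : m.+1%:R^-1 <= N^-1 by rewrite lef_pV2 ?posrE//; exact: bound_all_gt0.
  split; [exact: le_trans hz|exact: le_trans hx|].
  move=> i; apply: le_trans (_ : N <= _) => //.
  have -> : i = inord i by rewrite inord_val.
  by case: i => -[|[|[|[|[|//]]]]] //= _.
move=> l l01.
rewrite [transport _ _ _ _ _ _](@transport_unique R 5 cy _ _ _ _ CU k m t y)//.
  exact: cb.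
by move=> a a01; split; [exact: c|exact: cb].
Qed.

(** Either all orbits near x0 avoid the slice y = 0, or one of them meets it,
    and its starting point replaces x0. *)
Lemma proper_dense x0 e : Om x0 -> 0 < amom2 x0 -> x0 0 cy != 0 -> 0 < e ->
  exists x1 r, [/\ `|x1 - x0| < e, Om x1 & 0 < amom2 x1] /\
    [/\ x1 0 cy != 0, 0 < r & proper_near cy (@Om R) (@Qx R) phi x1 r].
Proof.
move=> Ox0 Ix0 y0 e0.
have [b [d1 [d10 H1]]] := Om_ball EX Ox0; have [d2 d20 H2] := amom2_open Ix0.
have y0n : 0 < `|x0 0 cy| by rewrite normr_gt0.
pose d := Num.min (Num.min e d1) (Num.min d2 `|x0 0 cy|).
have d0 : 0 < d by rewrite !lt_min e0 d10 d20.
have near x : `|x - x0| < d -> [/\ `|x - x0| < e, Om x, 0 < amom2 x & x 0 cy != 0].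
  rewrite !lt_min => /andP[/andP[xe xd1] /andP[xd2 xy]]; split=> //.
  - exact: (exh_sub EX (H1 x xd1 b (leqnn b))).
  - by apply: lt_trans (H2 x xd2); rewrite divr_gt0.
  have cd : `|x 0 cy - x0 0 cy| <= `|x - x0| := tau_near cy x0 x.
  by apply: contraTneq (le_lt_trans cd xy) => ->; rewrite sub0r normrN ltxx.
have [[x1 [k [x1d c]]]|no] := pselect (exists x1 k, `|x1 - x0| < d /\ conn k 0 x1).
  have [xe Ox1 Ix1 y1] := near x1 x1d.
  have [r r0 Hr] := proper_cross EX CU amom2_open conn_amom2 a_priori_reduced Ox1 Ix1 y1 c.
  by exists x1, r.
have [r r0 Hr] := @proper_nocross _ _ _ _ _ _ _ _ EX CU _ amom2_open conn_amom2 a_priori_reduced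
  x0 Ox0 Ix0 y0 d d0 (fun x k xd c => no (ex_intro _ x (ex_intro _ k (conj xd c)))).
by exists x0, r; rewrite subrr normr0.
Qed.

Section Bump.
Variables (x1 : V) (r : R).
Hypothesis r0 : 0 < r.

Definition bump x := ramp (r ^+ 2 - \sum_(i < 5) (x 0 i - x1 0 i) ^+ 2).

Lemma class_C_bump q : class_C q setT bump.
Proof.
have oT := @openT V.
apply: (@class_C_comp_real R V q setT setT (@ramp R)) => //; last exact: class_C_ramp.
apply: class_CB => //; first exact: class_C_cst.
apply: class_C_sum => // i _; apply: class_CX => //; apply: class_CB => //.
  exact: class_C_coord.
exact: class_C_cst.
Qed.

Lemma bump_support x : bump x != 0 -> `|x - x1| < r.
Proof.
move=> bx; have : 0 < r ^+ 2 - \sum_(i < 5) (x 0 i - x1 0 i) ^+ 2.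
  rewrite ltNge; apply/negP => h; move: bx; rewrite /bump ramp_le0 ?eqxx//.
rewrite subr_gt0 => h; have := rV_norm_sqr (x - x1).
rewrite (eq_bigr (fun i => (x 0 i - x1 0 i) ^+ 2)); last by move=> i _; rewrite !mxE.
by move=> /le_lt_trans/(_ h); rewrite ltr_pXn2r ?nnegrE ?(ltW r0)//.
Qed.

Lemma bump_center : 0 < bump x1.
Proof.
rewrite /bump big1 ?subr0; first by apply: ramp_gt0; rewrite exprn_gt0.
by move=> i _; rewrite subrr expr0n.
Qed.

(** On the slice through x1, the differential at x1 is a multiple of that of
    eta. *)
Definition bump_eta x := bump x * (x 0 ceta - x1 0 ceta).

Lemma class_C_bump_eta q : class_C q setT bump_eta.
Proof.
have oT := @openT V; apply: class_CM => //; first exact: class_C_bump.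
by apply: class_CB => //; [exact: class_C_coord|exact: class_C_cst].
Qed.

Lemma bump_eta_derive w : 'D_w bump_eta x1 = bump x1 * w 0 ceta.
Proof.
have db : is_derive x1 w bump ('d bump x1 w).
  by apply: is_derive_diff; exact: class_C_differentiable (class_C_bump 1) _.
have de : is_derive x1 w (fun x : V => x 0 ceta - x1 0 ceta) (w 0 ceta).
  apply: (is_derive_eq (is_derive_sub (is_derive_coord x1 w ceta) (is_derive_const _ _ _))).
  by rewrite subr0.
have [_ ->] := is_derive_mul db de.
by rewrite subrr mulr0 add0r.
Qed.

End Bump.

End LocalIntegrals.

(** The tube of [bump_eta] on the slice y = y(x1). *)
Theorem local_integral (R : realType) (lam kap : R) (x0 : 'rV[R]_5) (e : R) :
  lam != 0 -> kap != 0 -> Om x0 -> 0 < amom2 x0 -> x0 0 cy != 0 -> 0 < e ->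
  exists x1 (f : 'rV[R]_5 -> R) (C : R),
    [/\ `|x1 - x0| < e, Om x1, 0 < amom2 x1, x1 0 cy != 0 & C != 0] /\
    [/\ forall r, class_C r (@Om R) f,
        forall x, Om x -> 'd f x (field lam kap x) = 0 &
        forall w : 'rV[R]_5, w 0 cy = 0 -> 'd f x1 w = C * w 0 ceta].
Proof.
move=> lam0 kap0 Ox0 Ix0 y0 e0; have [phi CU] := cutoffs_exist lam kap0.
have [x1 [r [[x1e Ox1 Ix1] [y1 r0 Hr]]]] := proper_dense lam0 kap0 CU Ox0 Ix0 y0 e0.
pose g := bump_eta x1 r; pose t0 := x1 0 cy.
have EX := exhaustion_Qx R.
have gs x : g x != 0 -> `|x - x1| < r.
  move=> gx; apply: (bump_support r0); apply: contra gx => /eqP h.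
  by rewrite /g /bump_eta h mul0r.
have pr : forall y, Om y -> exists m d, 0 < d /\
    forall y' k, `|y' - y| < d -> conn cy (@Qx R) phi k t0 y' -> g (transport cy phi k t0 1 y') != 0 ->
    conn cy (@Qx R) phi m t0 y'.
  move=> y /Hr[m [d [d0 Hd]]]; exists m, d; split=> // y' k y'y c gk.
  by apply: Hd y'y c _; rewrite -(transport1_slice_at cy); exact: gs.
have gC q : class_C q setT g by exact: class_C_bump_eta.
pose f := tube cy (@Qx R) phi t0 g.
have fC q : class_C q (@Om R) f by exact: (class_C_tube EX CU gC pr).
exists x1, f, (bump x1 r x1); split; first by split=> //; rewrite gt_eqF// bump_center.
split=> // [x Ox|w w0]; first exact: (tube_invariant EX CU gC pr).
have df : differentiable f x1 by exact: (class_C_differentiable (fC 1) Ox1).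
rewrite -deriveE// -(bump_eta_derive x1 r).
apply: derive_along_line.
have c : {for (0 : R), continuous (fun t : R => t *: w + x1)}.
  apply: (@cvgD _ _ _ (nbhs (0 : R))); last exact: cvg_cst.
  by apply: cvgZr_tmp; exact: cvg_id.
have := c; rewrite /prop_for /continuous_at /= scale0r add0r => cc.
have H : \forall t \near (0 : R), Om (t *: w + x1).
  exact: cc _ (open_nbhs_nbhs (conj (@open_Om R) Ox1)).
near=> t; have Ot : Om (t *: w + x1) by near: t.
by rewrite /f (tube_slice EX CU)// !mxE w0 mulr0 add0r.
Unshelve. all: by end_near. Qed.

(** * Series of smooth functions *)

Section SeriesTails.
Variable R : realType.
Implicit Types (a : nat -> R).

Definition partial_sum a (N : nat) := \sum_(0 <= j < N) a j.

Lemma partial_sumS a N : partial_sum a N.+1 = partial_sum a N + a N.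
Proof. by rewrite /partial_sum big_nat_recr. Qed.

Lemma partial_sum_tail a N c : (forall j, (N <= j)%N -> `|a j| <= c / 2 ^+ j) ->
  partial_sum a @ \oo --> limn (partial_sum a) /\
  forall K, (N <= K)%N -> `|partial_sum a K - limn (partial_sum a)| <= 2 * c / 2 ^+ K.
Proof.
move=> H.
have main K : (N <= K)%N -> partial_sum a @ \oo --> limn (partial_sum a) /\
    `|partial_sum a K - limn (partial_sum a)| <= 2 * c / 2 ^+ K.
  move=> NK; pose u k := partial_sum a (k + K)%N.
  have [|cu] := @geometric_limn R u (c / 2 ^+ K).
    move=> k; rewrite /u addSn partial_sumS addrC addKr.
    apply: le_trans (H _ (leq_trans NK (leq_addl _ _))) _.
    by rewrite addnC exprD invfM mulrA.
  have cp : partial_sum a @ \oo --> limn u by rewrite -(cvg_shiftn K).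
  have -> : limn (partial_sum a) = limn u by exact: cvg_lim cp.
  by move=> /(_ 0%N); rewrite /u add0n expr0 divr1 mulrA.
by split=> [|K /main[]//]; have [] := main N (leqnn N).
Qed.

End SeriesTails.

Section Along.
Variables (R : realType) (E : normedModType R).

Lemma is_derive_line (f : E -> R) (x v : E) (t : R) : differentiable f (x + t *: v) ->
  is_derive t 1 (fun s : R => f (x + s *: v)) ('d f (x + t *: v) v).
Proof.
move=> df.
have E1 : (fun s : R => x + s *: v) = cst x + (fun s : R => id s *: v) by [].
have iter_derive : differentiable (fun s : R => id s *: v) t by exact: differentiableZl.
have dg : differentiable (fun s : R => x + s *: v) t.
  by rewrite E1; apply: differentiableD => //; exact: differentiable_cst.
have Dg : 'd (fun s : R => x + s *: v) t (1 : R) = v.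
  rewrite -deriveE// E1 deriveD; [|exact: diff_derivable|exact: diff_derivable].
  by rewrite derive_cst add0r deriveE// diffZl// -deriveE// derive_id scale1r.
have D := differentiable_comp dg df.
apply: DeriveDef; first exact/derivable1_diffP.
by rewrite deriveE// diff_comp//= Dg.
Qed.

End Along.

Section Gluing.
Variables (R : realType) (E : normedModType R) (m : nat) (e : 'I_m -> E)
  (co : 'I_m -> {linear E -> R}).
Hypothesis coK : forall v, v = \sum_i co i v *: e i.
Hypothesis co_le : forall i v, `|co i v| <= `|v|.

Lemma co_continuous i : continuous (co i).
Proof.
apply: bounded_linear_continuous; exists 1; split; first exact: num_real.
move=> M M1; near=> z; apply: le_trans (co_le i z) _.
near: z; apply: filterS (near_dist_lt 0 (lt_trans ltr01 M1)) => z.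
by rewrite subr0 => /ltW.
Unshelve. all: by end_near. Qed.

Lemma diff_coordE (f : E -> R) x v : differentiable f x ->
  'd f x v = \sum_i co i v * 'D_(e i) f x.
Proof.
move=> df; rewrite [in LHS](coK v) linear_sum; apply: eq_bigr => i _.
by rewrite linearZ /= deriveE.
Qed.

Fixpoint iter_derive (l : seq 'I_m) (f : E -> R) : E -> R :=
  if l is i :: l' then iter_derive l' ('D_(e i) f) else f.

Variable D : set E.
Hypothesis oD : open D.

Lemma near_D z : D z -> \forall y \near z, D y.
Proof. by move=> Dz; exact: (open_nbhs_nbhs (conj oD Dz)). Qed.

Lemma iter_derive_ext l f g : (forall z, D z -> f z = g z) -> forall z, D z -> iter_derive l f z = iter_derive l g z.
Proof.
elim: l f g => [|i l IH] f g fg //=; apply: IH => z Dz.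
by apply: near_eq_derive; apply: filterS (near_D Dz) => y /fg.
Qed.

Lemma iter_derive_scale l c f : (forall r, class_C r D f) ->
  forall z, D z -> iter_derive l (fun z => c * f z) z = c * iter_derive l f z.
Proof.
elim: l f => [|i l IH] f Cf z Dz //=.
rewrite (@iter_derive_ext l _ (fun z => c * 'D_(e i) f z))//; last first.
  move=> y Dy; have df := class_C_differentiable (Cf 1) Dy.
  have [d _] : is_derive y (e i) f ('d f y (e i)) by exact: is_derive_diff.
  have [_ ->] := is_derive_scale c (is_derive_diff (e i) df).
  by rewrite deriveE.
by rewrite IH// => r; exact: class_C_derive (Cf r.+1).
Qed.

(** Locally uniform domination by 2^-j of all iterated derivatives along the
    basis vectors. *)
Definition summable (g : nat -> E -> R) := forall l x, D x -> exists d N, 0 < d /\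
  forall y j, `|y - x| < d -> (N <= j)%N -> `|iter_derive l (g j) y| <= 1 / 2 ^+ j.

Definition series_sum (g : nat -> E -> R) (x : E) := limn (partial_sum (fun j => g j x)).

Lemma summable_derive g i : summable g -> summable (fun j => 'D_(e i) (g j)).
Proof. by move=> sg l x Dx; exact: (sg (i :: l) x Dx). Qed.

Lemma series_sum_cvg g x : summable g -> D x ->
  partial_sum (fun j => g j x) @ \oo --> series_sum g x.
Proof.
move=> sg Dx; have [d [N [d0 H]]] := sg [::] x Dx.
have [//|+ _] := @partial_sum_tail R (fun j => g j x) N 1; last exact.
by move=> j Nj; apply: (H x j) => //; rewrite subrr normr0.
Qed.

(** The tail of the series is Lipschitz with constant m / 2^K by the mean
    value theorem, and its finite part is differentiable. *)
Lemma series_sum_differentiable g x : (forall j r, class_C r D (g j)) -> summable g -> D x ->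
  differentiable (series_sum g) x /\
  forall v, 'D_v (series_sum g) x = \sum_i co i v * series_sum (fun j => 'D_(e i) (g j)) x.
Proof.
move=> Cg sg Dx.
pose S i := series_sum (fun j => 'D_(e i) (g j)) x.
pose L v := \sum_i co i v * S i.
have linL : linear L.
  move=> a u v; rewrite /L scaler_sumr -big_split /=; apply: eq_bigr => i _.
  by rewrite linearP /= mulrDl -mulrA.
pose LL : {linear E -> R} := HB.pack L (GRing.isLinear.Build R E R *:%R L linL).
have cL : continuous LL.
  move=> z; rewrite /LL /= /L.
  have := @continuous_lincomb R E R m S (fun i => co i) z.
  by apply; move=> i; exact: co_continuous.
have [d0 [N0 [d00 H0]]] := sg [::] x Dx.
have /choice[dN HdN] (i : 'I_m) : exists dN : R * nat, 0 < dN.1 /\ forall y j,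
    `|y - x| < dN.1 -> (dN.2 <= j)%N -> `|'D_(e i) (g j) y| <= 1 / 2 ^+ j.
  by have [d [N [dp H]]] := sg [:: i] x Dx; exists (d, N).
have [dD dD0 HD] : exists2 d, 0 < d & forall y, `|y - x| < d -> D y.
  have /nbhs_ballP[d /= d0' H] := near_D Dx; exists d => // y yx.
  by apply: H; rewrite -ball_normE /= distrC.
pose N := (N0 + \sum_i (dN i).2)%N.
have [d [dp dle dle0 dlei]] : exists d, [/\ 0 < d, d <= dD, d <= d0 & forall i, d <= (dN i).1].
  near (0 : R)^'+ => d; exists d; split.
  - by near: d; exact: nbhs_right_gt.
  - by near: d; exact: nbhs_right_le.
  - by near: d; exact: nbhs_right_le.
  near: d; apply: filter_forall => i.
  by apply: nbhs_right_le; case: (HdN i).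
have N0N : (N0 <= N)%N by exact: leq_addr.
have NiN i : ((dN i).2 <= N)%N.
  by rewrite /N (bigD1 i)//= addnCA leq_addr.
have lip y j : `|y - x| < d -> (N <= j)%N -> `|g j y - g j x| <= (m%:R * `|y - x|) / 2 ^+ j.
  move=> yd Nj.
  have seg (t : R) : 0 <= t <= 1 -> `|x + t *: (y - x) - x| < d.
    move=> /andP[t0 t1]; rewrite addrAC subrr add0r normrZ ger0_norm//.
    by apply: le_lt_trans yd; rewrite ler_piMl.
  have dg (t : R) : 0 <= t <= 1 -> differentiable (g j) (x + t *: (y - x)).
    move=> /seg td; apply: (class_C_differentiable (Cg j 1)); apply: HD.
    exact: lt_le_trans td dle.
  have [c c01 Ec] := @MVT_le R (fun t => g j (x + t *: (y - x)))
    (fun t => 'd (g j) (x + t *: (y - x)) (y - x)) 0 1 ler01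
    (fun t t01 => is_derive_line (dg t t01)).
  rewrite scale1r subrKC scale0r addr0 subr0 mulr1 in Ec.
  rewrite Ec (diff_coordE _ (dg c c01)); apply: le_trans (ler_norm_sum _ _ _) _.
  apply: le_trans (_ : \sum_(i < m) `|y - x| / 2 ^+ j <= _); last first.
    by rewrite sumr_const card_ord -[leLHS]mulr_natl mulrA.
  apply: ler_sum => i _; rewrite normrM ler_pM// -[leRHS]mul1r.
  apply: (HdN i).2; first exact: lt_le_trans (seg c c01) (dlei i).
  exact: leq_trans (NiN i) Nj.
have cg y : `|y - x| < d -> partial_sum (fun j => g j y) @ \oo --> series_sum g y.
  by move=> yd; apply: series_sum_cvg => //; apply: HD; exact: lt_le_trans dle.
have x0d : `|x - x| < d by rewrite subrr normr0.
have tail y K : `|y - x| < d -> (N <= K)%N ->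
    `|partial_sum (fun j => g j y - g j x) K - (series_sum g y - series_sum g x)| <= 2 * (m%:R * `|y - x|) / 2 ^+ K.
  move=> yd NK; have [|_ /(_ K NK)] := @partial_sum_tail R (fun j => g j y - g j x) N (m%:R * `|y - x|).
    by move=> j Nj; exact: lip.
  rewrite (_ : limn _ = series_sum g y - series_sum g x)//; apply: cvg_lim => //.
  rewrite (_ : partial_sum _ = fun N => partial_sum (fun j => g j y) N - partial_sum (fun j => g j x) N).
    by apply: cvgB; exact: cg.
  by apply/funext => k; rewrite /partial_sum sumrB.
have tailS i K : (N <= K)%N -> `|partial_sum (fun j => 'D_(e i) (g j) x) K - S i| <= 2 * 1 / 2 ^+ K.
  move=> NK; have [|_ /(_ K NK)//] := @partial_sum_tail R (fun j => 'D_(e i) (g j) x) N 1.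
  move=> j Nj; apply: (HdN i).2; last exact: leq_trans (NiN i) Nj.
  exact: lt_le_trans x0d (dlei i).
have [dG DG] : differentiable (series_sum g) x /\ 'd (series_sum g) x = LL :> (E -> R).
  apply: is_diff_eps cL _ => ep ep0.
  (* K is such that the tail takes at most half of the error allowed *)
  have [K [NK HK]] : exists K, (N <= K)%N /\ 4 * m%:R / 2 ^+ K <= ep / 2 :> R.
    pose b := Num.bound (4 * m%:R / (ep / 2)).
    exists (N + b)%N; split; first exact: leq_addr.
    rewrite ler_pdivrMr ?exprn_gt0// -ler_pdivrMl ?divr_gt0// mulrC.
    have := archi_boundP (divr_ge0 (mulr_ge0 (ler0n R 4) (ler0n R m)) (ltW (divr_gt0 ep0 (ltr0Sn R 1)))).
    move=> /ltW/le_trans; apply; rewrite -natrX ler_nat.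
    by apply: leq_trans (ltnW (ltn_expl (N + b) _)) => //; exact: leq_addl.
  pose sK := fun y => partial_sum (fun j => g j y) K.
  have dsK : differentiable sK x /\ 'd sK x = (fun v => \sum_i co i v * partial_sum (fun j => 'D_(e i) (g j) x) K) :> (E -> R).
    have dgj j : differentiable (g j) x by exact: class_C_differentiable (Cg j 1%N) Dx.
    have dd : differentiable sK x.
      apply: (@class_C_differentiable R E 0 D) Dx.
      by apply: class_C_sum => // j _; exact: Cg.
    split=> //; apply/funext => v; rewrite -deriveE//.
    rewrite (@derive_val _ _ _ _ _ _ _ (is_derive_bigsum _ (fun j _ => is_derive_diff v (dgj j)))).
    rewrite (eq_bigr (fun j => \sum_i co i v * 'D_(e i) (g j) x)); last first.
      by move=> j _; exact: diff_coordE.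
    by rewrite exchange_big; apply: eq_bigr => i _; rewrite -mulr_sumr.
  have [dK DK] := dsK.
  have ep2 : 0 < ep / 2 by rewrite divr_gt0.
  have := diff_eps dK ep2; apply: filterS2 (near_dist_lt x dp) => y yd Hy.
  have h1 := tail y K yd NK.
  have h2 : `|'d sK x (y - x) - L (y - x)| <= 2 * (m%:R * `|y - x|) / 2 ^+ K.
    rewrite DK /L -sumrB; apply: le_trans (ler_norm_sum _ _ _) _.
    apply: le_trans (_ : \sum_(i < m) `|y - x| * (2 * 1 / 2 ^+ K) <= _); last first.
      rewrite sumr_const card_ord -[leLHS]mulr_natl le_eqVlt; apply/orP; left; apply/eqP; ring.
    apply: ler_sum => i _; rewrite -mulrBr normrM ler_pM//; exact: tailS.
  have E1 : series_sum g y - series_sum g x - LL (y - x) =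
      - (partial_sum (fun j => g j y - g j x) K - (series_sum g y - series_sum g x))
      + (sK y - sK x - 'd sK x (y - x)) + ('d sK x (y - x) - L (y - x)).
    have -> : partial_sum (fun j => g j y - g j x) K = sK y - sK x by rewrite /partial_sum sumrB.
    rewrite /LL /=; ring.
  rewrite E1; apply: le_trans (ler_normD _ _) _.
  apply: le_trans (lerD (ler_normD _ _) (lexx _)) _; rewrite normrN.
  have h3 := ler_wpM2r (normr_ge0 (y - x)) HK.
  have E2 : 4 * m%:R / 2 ^+ K * `|y - x| = 2 * (m%:R * `|y - x|) / 2 ^+ K + 2 * (m%:R * `|y - x|) / 2 ^+ K.
    by field; rewrite expf_neq0.
  rewrite E2 in h3; move: h1 h2 h3 Hy; set A := 2 * _ / _; lra.
by split=> // v; rewrite deriveE// DG.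
Unshelve. all: by end_near. Qed.

Lemma series_sum_derive_cvg g x v : (forall j r, class_C r D (g j)) -> summable g -> D x ->
  partial_sum (fun j => 'D_v (g j) x) @ \oo --> 'D_v (series_sum g) x.
Proof.
move=> Cg sg Dx; have [_ ->] := series_sum_differentiable Cg sg Dx.
rewrite (_ : partial_sum _ = fun K => \sum_i co i v * partial_sum (fun j => 'D_(e i) (g j) x) K); last first.
  apply/funext => K; rewrite /partial_sum.
  rewrite (eq_bigr (fun j => \sum_i co i v * 'D_(e i) (g j) x)); last first.
    move=> j _; have dg := class_C_differentiable (Cg j 1%N) Dx.
    by rewrite deriveE// diff_coordE.
  by rewrite exchange_big; apply: eq_bigr => i _; rewrite -mulr_sumr.
elim: (index_enum _) => [|i s IH].
  rewrite big_nil (_ : (fun K => _) = cst 0); first exact: cvg_cst.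
  by apply/funext => K; rewrite big_nil.
rewrite big_cons (_ : (fun K => _) = fun K => co i v * partial_sum (fun j => 'D_(e i) (g j) x) K +
    \sum_(i <- s) co i v * partial_sum (fun j => 'D_(e i) (g j) x) K); last first.
  by apply/funext => K; rewrite big_cons.
apply: cvgD => //; apply: cvgM; first exact: cvg_cst.
by apply: series_sum_cvg => //; exact: summable_derive.
Qed.

Lemma series_sum_smooth g r : (forall j r, class_C r D (g j)) -> summable g ->
  class_C r D (series_sum g).
Proof.
elim: r g => [|r IH] g Cg sg.
  move=> z Dz; apply/differentiable_continuous.
  by have [] := series_sum_differentiable Cg sg Dz.
split=> [z Dz|v]; first by have [] := series_sum_differentiable Cg sg Dz.
apply: (@class_C_ext _ _ _ _ (fun z => \sum_i co i v * series_sum (fun j => 'D_(e i) (g j)) z)) => //.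
  by move=> z Dz; have [_ ->] := series_sum_differentiable Cg sg Dz.
apply: class_C_sum => // i _; apply: class_CZ => //; apply: IH.
  by move=> j k; exact: class_C_derive.
exact: summable_derive.
Qed.

Lemma iter_derive_bounded (K : set E) k f : compact K -> K `<=` D -> (forall r, class_C r D f) ->
  exists2 C, 0 <= C & forall l x, (size l <= k)%N -> K x -> `|iter_derive l f x| <= C.
Proof.
move=> cK KD; elim: k f => [|k IH] f Cf.
  have /compact_bounded[M [_ HM]] : compact (f @` K).
    apply: continuous_compact cK; apply: continuous_in_subspaceT => z.
    by rewrite inE => /KD Dz; exact: Cf 0%N z Dz.
  exists (Num.max 0 (M + 1)); first by rewrite le_max lexx.
  move=> [|//] x _ Kx /=; rewrite le_max; apply/orP; right.
  by apply: HM; [rewrite ltrDl|exists x].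
have [C0 C00 H0] := IH f Cf.
have /choice[C HC] (i : 'I_m) : exists C, 0 <= C /\ forall l x, (size l <= k)%N -> K x ->
    `|iter_derive l ('D_(e i) f) x| <= C.
  have [|C C0' H] := IH ('D_(e i) f); last by exists C.
  by move=> r; exact: class_C_derive.
exists (C0 + \sum_i C i).
  by rewrite addr_ge0// sumr_ge0// => i _; case: (HC i).
move=> [|i l] x sl Kx.
  by rewrite (le_trans (H0 [::] x _ Kx))// lerDl sumr_ge0// => i _; case: (HC i).
apply: le_trans ((HC i).2 l x sl Kx) _; rewrite (bigD1 i)//= addrCA lerDl.
by rewrite addr_ge0// sumr_ge0// => j _; case: (HC j).
Qed.

Variable Kx : nat -> set E.
Hypotheses (cKx : forall j, compact (Kx j)) (KxD : forall j, Kx j `<=` D)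
  (Kx_near : forall x, D x -> exists d N, 0 < d /\
     forall y j, `|y - x| < d -> (N <= j)%N -> Kx j y).

Lemma summable_small (f : nat -> E -> R) : (forall j r, class_C r D (f j)) ->
  exists2 del : nat -> R, forall j, 0 < del j &
    forall c : nat -> R, (forall j, 0 <= c j <= del j) -> summable (fun j z => c j * f j z).
Proof.
move=> Cf.
have /choice[C HC] j : exists C, 0 <= C /\ forall l x, (size l <= j)%N -> Kx j x ->
    `|iter_derive l (f j) x| <= C.
  by have [C C0 H] := iter_derive_bounded j (@cKx j) (@KxD j) (Cf j); exists C.
have C1 j : 0 < (1 + C j) * 2 ^+ j.
  by rewrite mulr_gt0 ?exprn_gt0// ltr_wpDr//; case: (HC j).
exists (fun j => ((1 + C j) * 2 ^+ j)^-1); first by move=> j; rewrite invr_gt0.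
move=> c Hc l x Dx; have [d [N [d0 H]]] := Kx_near Dx.
exists d, (N + size l)%N; split=> // y j yx Nj.
have Ky : Kx j y by apply: H yx _; exact: leq_trans (leq_addr _ _) Nj.
rewrite (iter_derive_scale l (c j) (Cf j) (KxD Ky)) normrM.
have /andP[c0 cd] := Hc j; rewrite ger0_norm//.
have Cy : `|iter_derive l (f j) y| <= 1 + C j.
  apply: le_trans ((HC j).2 l y _ Ky) _; last by rewrite lerDr.
  exact: leq_trans (leq_addl _ _) Nj.
apply: le_trans (ler_pM c0 (normr_ge0 _) cd Cy) _.
by rewrite invfM mulrAC mulVf ?gt_eqF// ltr_wpDr//; case: (HC j).
Qed.

End Gluing.

(** The k-th coefficient makes the k-th partial sum for the index k nonzero;
    the later ones are too small to cancel it. *)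
Lemma generic_coefficients (R : realType) (a : nat -> nat -> R) (del : nat -> R) :
  (forall k, a k k != 0) -> (forall j, 0 < del j) ->
  exists c : nat -> R, (forall j, 0 < c j <= del j) /\
    forall k l, partial_sum (fun j => c j * a k j) @ \oo --> l -> l != 0.
Proof.
move=> akk del0.
pose S (s : seq R) k := \sum_(0 <= j < k.+1) s`_j * a k j.
pose good s := forall k, (k < size s)%N -> S s k != 0.
pose P s c := [/\ 0 < c <= del (size s), good (rcons s c) &
  forall k, (k < size s)%N -> c * `|a k (size s)| <= `|S s k| / 4 * 2 ^+ k / 2 ^+ size s].
have Srcons s c k : (k < size s)%N -> S (rcons s c) k = S s k.
  move=> ks; apply: eq_big_nat => j /andP[_ jk]; rewrite nth_rcons.
  by rewrite (leq_trans jk ks).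
have Slast s c : S (rcons s c) (size s) = \sum_(0 <= j < size s) s`_j * a (size s) j + c * a (size s) (size s).
  rewrite /S big_nat_recr//= nth_rcons ltnn eqxx; congr (_ + _).
  by apply: eq_big_nat => j /andP[_ js]; rewrite nth_rcons js.
have /choice[next Hnext] s : exists c, good s -> P s c.
  have [gs|] := pselect (good s); last by exists 0.
  set n := size s.
  have [eta [eta0 etad etak]] : exists eta, [/\ 0 < eta, eta <= del n &
      forall k : 'I_n, eta * `|a k n| <= `|S s k| / 4 * 2 ^+ k / 2 ^+ n].
    near (0 : R)^'+ => eta; exists eta; split.
    - by near: eta; exact: nbhs_right_gt.
    - by near: eta; exact: nbhs_right_le.
    near: eta; apply: filter_forall => k.
    set B := _ / _; have B0 : 0 < B.
      by rewrite /B !mulr_gt0 ?invr_gt0 ?exprn_gt0// normr_gt0 gs.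
    have A0 : 0 < `|a k n| + 1 by rewrite ltr_wpDl.
    have := @nbhs_right_le R 0 (B / (`|a k n| + 1)) (divr_gt0 B0 A0).
    have := @nbhs_right_gt R 0; apply: filterS2 => t t0.
    rewrite ler_pdivlMr//; apply: le_trans; rewrite ler_wpM2l ?(ltW t0)//.
    by rewrite lerDl.
  have done c : 0 < c <= eta -> S (rcons s c) n != 0 -> P s c.
    move=> /andP[c0 ce] Sn; split.
    - by rewrite c0 (le_trans ce).
    - move=> k; rewrite size_rcons ltnS leq_eqVlt => /predU1P[->//|ks].
      by rewrite Srcons// gs.
    move=> k ks; apply: le_trans (etak (Ordinal ks)).
    by rewrite ler_wpM2r.
  (* eta and eta / 2 cannot both annihilate the sum, as a n n <> 0 *)
  have [Se|Se] := eqVneq (S (rcons s eta) n) 0; last first.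
    by exists eta => _; apply: done => //; rewrite eta0 lexx.
  exists (eta / 2) => _; apply: done; first by lra.
  apply/eqP => S2; move: Se S2; rewrite /n !Slast => Se S2.
  have /eqP : eta / 2 * a n n = 0 by rewrite /n; lra.
  by rewrite mulf_eq0 (negbTE (akk n)) orbF; apply/negP; rewrite gt_eqF// divr_gt0.
pose pre := fix pre n := if n is n'.+1 then rcons (pre n') (next (pre n')) else [::].
have spre n : size (pre n) = n by elim: n => //= n IH; rewrite size_rcons IH.
have gpre n : good (pre n).
  by elim: n => [//|n IH] /=; have [] := Hnext _ IH.
have Ppre n := Hnext _ (gpre n).
pose c j := next (pre j).
have nthpre n j : (j < n)%N -> (pre n)`_j = c j.
  elim: n => [//|n IH]; rewrite ltnS leq_eqVlt /= nth_rcons spre => /predU1P[->|jn].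
    by rewrite ltnn eqxx.
  by rewrite jn IH.
have SE n k : (k < n)%N -> S (pre n) k = partial_sum (fun j => c j * a k j) k.+1.
  by move=> kn; apply: eq_big_nat => j /andP[_ jk]; rewrite nthpre// (leq_trans jk).
exists c; split.
  by move=> j; have [] := Ppre j; rewrite spre.
move=> k l cl; set s := partial_sum _ in cl; pose b := s k.+1.
have b0 : b != 0 by rewrite /b /s -(SE k.+1)//; apply: gpre; rewrite spre.
have [|H /(_ _ (leqnn k.+1))] := @partial_sum_tail R (fun j => c j * a k j) k.+1 (`|b| / 4 * 2 ^+ k).
  move=> j kj; have [/andP[cj0 _] _] := Ppre j.
  rewrite spre => /(_ k kj); rewrite SE// => Hj.
  by rewrite normrM gtr0_norm.
have -> : limn s = l by exact: cvg_lim cl.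
rewrite -/s -/b => Hl; apply/eqP => l0; move: Hl; rewrite l0 subr0.
have -> : 2 * (`|b| / 4 * 2 ^+ k) / 2 ^+ k.+1 = `|b| / 4.
  by rewrite exprS; field; rewrite expf_neq0.
have b1 : 0 < `|b| by rewrite normr_gt0.
by move=> Hl; lra.
Unshelve. all: by end_near. Qed.

Section Glue.
Variables (R : realType) (E : normedModType R) (m : nat) (e : 'I_m -> E)
  (co : 'I_m -> {linear E -> R}).
Hypothesis coK : forall v, v = \sum_i co i v *: e i.
Hypothesis co_le : forall i v, `|co i v| <= `|v|.
Variable D : set E.
Hypothesis oD : open D.
Variable Kx : nat -> set E.
Hypotheses (cKx : forall j, compact (Kx j)) (KxD : forall j, Kx j `<=` D)
  (Kx_near : forall x, D x -> exists d N, 0 < d /\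
     forall y j, `|y - x| < d -> (N <= j)%N -> Kx j y).

(** The coefficients are bounded by the derivatives on compact sets, which
    makes the series smooth, and chosen generically. *)
Lemma countable_gluing (f : nat -> E -> R) (x u : nat -> E) :
  (forall j r, class_C r D (f j)) -> (forall k, D (x k)) ->
  (forall k, 'd (f k) (x k) (u k) != 0) ->
  exists G : E -> R, [/\ forall r, class_C r D G,
    forall z v, D z -> (forall j, 'd (f j) z v = 0) -> 'd G z v = 0 &
    forall k, 'd G (x k) (u k) != 0].
Proof.
move=> Cf Dx fxu.
have df j z (Dz : D z) : differentiable (f j) z := class_C_differentiable (Cf j 1%N) Dz.
have [del del0 Hdel] := @summable_small _ _ _ e _ oD _ cKx KxD Kx_near _ Cf.
have [|c [Hc Hl]] := @generic_coefficients R (fun k j => 'd (f j) (x k) (u k)) del _ del0.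
  by [].
pose g j z := c j * f j z.
have sg : summable e D g.
  by apply: Hdel => j; have /andP[/ltW-> ->] := Hc j.
have Cg j r : class_C r D (g j) by exact: class_CZ.
have Dg z v : D z -> partial_sum (fun j => c j * 'd (f j) z v) @ \oo --> 'd (series_sum g) z v.
  move=> Dz; have [dG _] := series_sum_differentiable coK co_le oD Cg sg Dz.
  rewrite -deriveE//.
  rewrite (_ : partial_sum _ = partial_sum (fun j => 'D_v (g j) z)); first exact: (series_sum_derive_cvg coK co_le oD).
  congr partial_sum; apply/funext => j.
  by have [_ ->] := is_derive_scale (c j) (is_derive_diff v (df j z Dz)).
exists (series_sum g); split.
- by move=> r; exact: (series_sum_smooth coK co_le oD).
- move=> z v Dz fz; have := Dg z v Dz.
  rewrite (_ : partial_sum _ = cst 0); first by move=> /(@cvg_lim _ _ _ _ _)<-//; rewrite lim_cst.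
  by apply/funext => K; rewrite /partial_sum big1// => j _; rewrite fz mulr0.
by move=> k; apply: Hl (Dg _ _ (Dx k)).
Qed.

End Glue.

(** * Phase spaces *)

Lemma closed_norm_le (R : realType) (V : normedModType R) (a : R) :
  closed [set x : V | `|x| <= a].
Proof.
move=> z cz /=; rewrite leNgt; apply/negP => az.
have d0 : 0 < `|z| - a by rewrite subr_gt0.
have [y [/= ya yz]] := cz _ (near_dist_lt z d0).
have := ler_normD (z - y) y; rewrite subrK distrC.
by move: yz ya; set b := `|_|; set c := `|_|; set d := `|_|; lra.
Qed.

Section PhaseSpace.
Variables (R : realType) (n : nat).
Local Notation E := ('rV[R]_n * 'rV[R]_n)%type.
Implicit Types (z v : E) (f : E -> R) (D : set E).

Definition coord (k : 'I_(n + n)) z : R :=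
  match fintype.split k with inl i => z.1 0 i | inr i => z.2 0 i end.

Lemma coord_linear k : linear (coord k).
Proof. by move=> a u v; rewrite /coord; case: (fintype.split k) => i; rewrite /= !mxE. Qed.

HB.instance Definition _ k := GRing.isLinear.Build R E R *:%R (coord k) (coord_linear k).

Definition coord_vec (k : 'I_(n + n)) : E :=
  match fintype.split k with inl i => (delta_mx 0 i, 0) | inr i => (0, delta_mx 0 i) end.

Lemma coord_vecK v : v = \sum_k coord k v *: coord_vec k.
Proof.
case: v => a b; rewrite big_split_ord /=.
rewrite (eq_bigr (fun i => (a 0 i *: delta_mx 0 i, 0) : E)); last first.
  move=> i _; rewrite /coord /coord_vec (unsplitK (inl i)) /=.
  by congr pair; rewrite scaler0.
rewrite [X in _ + X](eq_bigr (fun i => (0, b 0 i *: delta_mx 0 i) : E)); last first.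
  move=> i _; rewrite /coord /coord_vec (unsplitK (inr i)) /=.
  by congr pair; rewrite scaler0.
have H1 (F : 'I_n -> 'rV[R]_n) : \sum_i ((F i, 0) : E) = (\sum_i F i, 0).
  by elim/big_rec2: _ => //= i x y _ ->; congr pair; rewrite add0r.
have H2 (F : 'I_n -> 'rV[R]_n) : \sum_i ((0, F i) : E) = (0, \sum_i F i).
  by elim/big_rec2: _ => //= i x y _ ->; congr pair; rewrite add0r.
by rewrite H1 H2 -!row_sum_delta; congr pair; rewrite /= ?addr0 ?add0r.
Qed.

Lemma coord_le k v : `|coord k v| <= `|v|.
Proof.
rewrite /coord prod_normE le_max; case: (fintype.split k) => i; apply/orP; [left|right];
exact: rV_norm_coord.
Qed.

Lemma phase_coord_continuous k : continuous (coord k).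
Proof. exact: (co_continuous coord_le). Qed.

Lemma coord_q (i : 'I_n) : coord (lshift n i) = (fun z : E => z.1 0 i).
Proof. by apply/funext => z; rewrite /coord (unsplitK (inl i)). Qed.

Lemma coord_p (i : 'I_n) : coord (rshift n i) = (fun z : E => z.2 0 i).
Proof. by apply/funext => z; rewrite /coord (unsplitK (inr i)). Qed.

Lemma is_derive_q z v (i : 'I_n) : is_derive z v (fun z : E => z.1 0 i) (v.1 0 i).
Proof. by have := is_derive_linear z v (@phase_coord_continuous (lshift n i)); rewrite /= coord_q. Qed.

Lemma is_derive_p z v (i : 'I_n) : is_derive z v (fun z : E => z.2 0 i) (v.2 0 i).
Proof. by have := is_derive_linear z v (@phase_coord_continuous (rshift n i)); rewrite /= coord_p. Qed.

Lemma class_C_q r D (i : 'I_n) : open D -> class_C r D (fun z : E => z.1 0 i).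
Proof. by move=> oD; rewrite -coord_q; apply: class_C_linear => //; exact: phase_coord_continuous. Qed.

Lemma class_C_p r D (i : 'I_n) : open D -> class_C r D (fun z : E => z.2 0 i).
Proof. by move=> oD; rewrite -coord_p; apply: class_C_linear => //; exact: phase_coord_continuous. Qed.

Lemma open_gt0 f : class_C 0 setT f -> open [set z | 0 < f z].
Proof.
move=> cf; apply: (@open_comp _ _ f [set r | 0 < r]); last exact: open_gt.
by move=> x _; exact: cf.
Qed.

(** Points of the ball of radius j at distance at least 1/(j+1) from the
    complement of D. *)
Definition inner D (j : nat) : set E :=
  [set z | `|z| <= j%:R /\ forall y, `|y - z| < j.+1%:R^-1 -> D y].

Lemma inner_sub D j : inner D j `<=` D.
Proof. by move=> z [_]; apply; rewrite subrr normr0. Qed.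

Lemma inner_compact D j : compact (inner D j).
Proof.
have cB : compact [set x : 'rV[R]_n | `|x| <= j%:R].
  case: n => [|k].
    rewrite (_ : [set x | _] = [set 0]); first exact: compact_set1.
    apply/seteqP; split=> x /= _; first by apply/rowP; case.
    by rewrite (_ : x = 0) ?normr0//; apply/rowP; case.
  apply: bounded_closed_compact.
    exists j%:R; split; first exact: num_real.
    by move=> M jM x /= /le_trans; apply; exact: ltW.
  exact: closed_norm_le.
apply: (@subclosed_compact _ _ ([set x | `|x| <= j%:R] `*` [set x | `|x| <= j%:R])).
- apply: closedI; first exact: closed_norm_le.
  move=> z cz y yz; pose d := j.+1%:R^-1 - `|y - z|.
  have d0 : 0 < d by rewrite subr_gt0.
  have [z' [Hz' /= z'z]] := cz _ (near_dist_lt z d0).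
  apply: Hz'; have := ler_normD (y - z) (z - z'); rewrite addrA subrK => /le_lt_trans; apply.
  by rewrite distrC in z'z; move: z'z; rewrite /d; set a := `|_|; set b := `|_|; set i := j.+1%:R^-1; lra.
- exact: compact_setX.
by move=> z [/= + _]; rewrite prod_normE ge_max => /andP[].
Qed.

Lemma inner_near D z : open D -> D z -> exists d N, 0 < d /\
  forall y j, `|y - z| < d -> (N <= j)%N -> inner D j y.
Proof.
move=> oD Dz; have /nbhs_ballP[r /= r0 Hr] := open_nbhs_nbhs (conj oD Dz).
pose d := Num.min 1 (r / 2).
have d0 : 0 < d by rewrite lt_min ltr01 divr_gt0.
pose N := (Num.bound (`|z| + 1) + Num.bound (2 / r))%N.
exists d, N; split=> // y j; rewrite lt_min => /andP[yz1 yzr] Nj; split.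
  have : `|z| + 1 < j%:R.
    apply: lt_le_trans (archi_boundP _) _; first by rewrite addr_ge0.
    by rewrite ler_nat (leq_trans _ Nj)// leq_addr.
  have := ler_normD z (y - z); rewrite addrC subrK.
  by move: yz1; set a := `|y - z|; set b := `|y|; set c := `|z|; lra.
move=> x xy; apply: Hr; rewrite -ball_normE /= distrC.
have h : j.+1%:R^-1 <= r / 2.
  have : 2 / r <= j.+1%:R.
    apply: le_trans (ltW (archi_boundP _)) _; first by rewrite divr_ge0// ltW.
    by rewrite ler_nat (leq_trans _ (leqW Nj))// leq_addl.
  rewrite ler_pdivrMr// => h; rewrite -[_^-1]mul1r ler_pdivrMr// mulrAC.
  by rewrite ler_pdivlMr// mul1r mulrC.
have := ler_normD (x - y) (y - z); rewrite addrA subrK.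
by move: yzr xy h; set a := `|_|; set b := `|_|; set c := j.+1%:R^-1; set e := `|_|; lra.
Qed.

Definition ratv (q : 'rV[rat]_n * 'rV[rat]_n) : E :=
  (map_mx ratr q.1, map_mx ratr q.2).

Lemma ratv_dense z (e : R) : 0 < e -> exists q, `|ratv q - z| < e.
Proof.
move=> e0; have H (x : 'rV[R]_n) : exists q : 'rV[rat]_n, `|map_mx ratr q - x| < e.
  have /choice[q Hq] (i : 'I_n) : exists q : rat, `|ratr q - x 0 i| < e.
    have [|q] := @rat_in_itvoo R (x 0 i - e) (x 0 i + e); first by lra.
    rewrite in_itv /= => /andP[q1 q2]; exists q; rewrite ltr_norml; apply/andP; lra.
  by exists (\row_i q i); apply: rV_norm_lt => // i; rewrite !mxE.
have [q1 H1] := H z.1; have [q2 H2] := H z.2.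
by exists (q1, q2); rewrite prod_normE gt_max /= H1 H2.
Qed.

(** The countably many functions are indexed by the balls with rational
    centre and radius 1/(N+1); P f x u is meant to imply that f varies along u
    at x. *)
Lemma dense_gluing D (P : (E -> R) -> E -> E -> Prop) : open D ->
  (forall f x u, P f x u -> [/\ D x, 'd f x u != 0 & forall r, class_C r D f]) ->
  (forall z e, D z -> 0 < e -> exists f x u, P f x u /\ `|x - z| < e) ->
  exists G : E -> R, [/\ forall r, class_C r D G,
    forall z v, D z -> (forall f x u, P f x u -> 'd f z v = 0) -> 'd G z v = 0 &
    forall z e, D z -> 0 < e -> exists f x u, [/\ P f x u, `|x - z| < e & 'd G x u != 0]].
Proof.
move=> oD HP dP.
have [[z0 Dz0]|Dn] := pselect (exists z, D z); last first.
  exists (fun=> 0); split=> [r|z v Dz|z e Dz]; first exact: class_C_cst.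
  - by case: Dn; exists z.
  by case: Dn; exists z.
have [f0 [x0 [u0 [P0 _]]]] := dP z0 1 Dz0 ltr01.
pose T : countType := ('rV[rat]_n * 'rV[rat]_n * nat)%type.
have /choice[dat Hdat] (t : option T) : exists d : (E -> R) * E * E, P d.1.1 d.1.2 d.2 /\
    forall q N, t = Some (q, N) ->
    (exists f x u, P f x u /\ `|x - ratv q| < N.+1%:R^-1) -> `|d.1.2 - ratv q| < N.+1%:R^-1.
  case: t => [[q N]|]; last by exists (f0, x0, u0).
  have [[f [x [u [Pf xq]]]]|nP] := pselect (exists f x u, P f x u /\ `|x - ratv q| < N.+1%:R^-1).
    by exists (f, x, u); split=> // _ _ [<- <-].
  by exists (f0, x0, u0); split=> // _ _ [<- <-].
pose c k := dat (unpickle k).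
have Pc k : P (c k).1.1 (c k).1.2 (c k).2 by have [] := Hdat (unpickle k).
have [|||G [CG G0 Gne]] := @countable_gluing R E (n + n) coord_vec coord coord_vecK coord_le D oD
  (inner D) (@inner_compact D) (@inner_sub D) (fun z => @inner_near D z oD)
  (fun k => (c k).1.1) (fun k => (c k).1.2) (fun k => (c k).2).
- by move=> j; have [] := HP _ _ _ (Pc j).
- by move=> j; have [] := HP _ _ _ (Pc j).
- by move=> j; have [] := HP _ _ _ (Pc j).
exists G; split=> // [z v Dz H|z e Dz e0]; first by apply: G0 => // j; exact: H (Pc j).
pose N := Num.bound (2 / e); have N0 : 0 < N.+1%:R^-1 :> R by rewrite invr_gt0.
have h2 : 0 < N.+1%:R^-1 / 2 :> R by rewrite divr_gt0.
have [q Hq] := ratv_dense z h2; have [f [x [u [Pf xz]]]] := dP z _ Dz h2.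
have [Pt /(_ _ _ erefl) Ht] := Hdat (Some (q, N)).
have near_q : `|(dat (Some (q, N))).1.2 - ratv q| < N.+1%:R^-1.
  apply: Ht; exists f, x, u; split=> //.
  have := ler_normD (x - z) (z - ratv q); rewrite addrA subrK.
  by move: Hq xz; rewrite [`|ratv q - z|]distrC; set a := `|_|; set b := `|_|; set d := N.+1%:R^-1; set e' := `|_|; lra.
have E1 : c (pickle ((q, N) : T)) = dat (Some (q, N)) by rewrite /c pickleK.
exists (c (pickle ((q, N) : T))).1.1, (c (pickle ((q, N) : T))).1.2, (c (pickle ((q, N) : T))).2.
split=> //; rewrite E1; set x' := _.1.2 in near_q *.
have Ne : N.+1%:R^-1 <= e / 2.
  have : 2 / e <= N.+1%:R.
    apply: le_trans (ltW (archi_boundP _)) _; first by rewrite divr_ge0// ltW.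
    by rewrite ler_nat.
  rewrite ler_pdivrMr// => h; rewrite -[_^-1]mul1r ler_pdivrMr// mulrAC.
  by rewrite ler_pdivlMr// mul1r mulrC.
have := ler_normD (x' - ratv q) (ratv q - z); rewrite addrA subrK.
by move: Hq near_q Ne N0; set a := `|_|; set b := `|_|; set d := N.+1%:R^-1; set e' := `|_|; lra.
Qed.

Lemma is_derive_comp_rV m (f : 'rV[R]_m -> R) (p : 'I_m -> E -> R) (dp : 'I_m -> R) z v :
  differentiable f (\row_i p i z) -> (forall i, differentiable (p i) z) ->
  (forall i, is_derive z v (p i) (dp i)) ->
  is_derive z v (fun z => f (\row_i p i z)) ('d f (\row_i p i z) (\row_i dp i)).
Proof.
move=> df dfp Hp.
have pE y : \sum_i p i y *: delta_mx 0 i = \row_i p i y :> 'rV[R]_m.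
  by rewrite [RHS]row_sum_delta; apply: eq_bigr => i _; rewrite mxE.
have [dP DP] := @differentiable_lincomb R E _ m (fun i => delta_mx 0 i : 'rV[R]_m) p z dfp.
have -> : (fun z => f (\row_i p i z)) = f \o (fun x => \sum_i p i x *: delta_mx 0 i).
  by apply/funext => y /=; rewrite pE.
rewrite -pE in df; have D' := differentiable_comp dP df.
apply: DeriveDef; first exact: diff_derivable.
rewrite deriveE// diff_comp//= -(deriveE v dP) DP pE; congr ('d f _ _).
rewrite [RHS]row_sum_delta; apply: eq_bigr => i _.
by have [_ ->] := Hp i; rewrite mxE.
Qed.

(** The bracket with G is the derivative along this vector, see [poissonE]. *)
Definition ham_vec (G : E -> R) z : E :=
  (\row_i 'D_((0, delta_mx 0 i) : E) G z, \row_i - 'D_((delta_mx 0 i, 0) : E) G z).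

Lemma poissonE F G z : differentiable F z -> poisson F G z = 'd F z (ham_vec G z).
Proof.
move=> dF; rewrite [in RHS](coord_vecK (ham_vec G z)) linear_sum big_split_ord /= -big_split.
apply: eq_bigr => i _; rewrite /= !linearZ /coord /coord_vec (unsplitK (inl i)) (unsplitK (inr i)) /=.
by rewrite !mxE !(deriveE _ dF) /GRing.scale /= mulrN mulNr mulrC; congr (_ - _); rewrite mulrC.
Qed.

Lemma poisson_antisym (F G : E -> R) z : poisson F G z = - poisson G F z.
Proof.
by rewrite /poisson -sumrN; apply: eq_bigr => i _; rewrite opprB; congr (_ - _); rewrite mulrC.
Qed.

Lemma near_poisson (F G F' G' : E -> R) z : (\forall y \near z, F y = F' y) ->
  (\forall y \near z, G y = G' y) -> poisson F G z = poisson F' G' z.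
Proof.
move=> FF GG; apply: eq_bigr => i _.
by rewrite !(near_eq_derive _ FF) !(near_eq_derive _ GG).
Qed.

Lemma liouville_ext D (H H' : E -> R) : open D -> (forall z, D z -> H z = H' z) ->
  liouville_integrable D H -> liouville_integrable D H'.
Proof.
move=> oD HH [F [SF FH FF dn]]; exists F; split=> // j z Dz.
rewrite -(FH j z Dz).
have FE : \forall y \near z, F j y = F j y by exact: filterE.
by apply: (near_poisson FE); apply: filterS (open_nbhs_nbhs (conj oD Dz)) => y /HH.
Qed.

Lemma dense_closure D (I : set E) :
  (forall z e, D z -> 0 < e -> exists x, [/\ D x, I x & `|x - z| < e]) -> D `<=` closure (D `&` I).
Proof.
move=> H z Dz B /nbhs_ballP[e /= e0 eB].
have [x [Dx Ix xz]] := H z e Dz e0; exists x; split=> //.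
by apply: eB; rewrite -ball_normE /= distrC.
Qed.

End PhaseSpace.

(** * The anisotropic Kepler problem *)

Section ContinuousAt.
Variables (R : realType) (E : normedModType R) (x : E).
Implicit Types f g : E -> R.

Lemma continuousM_at f g : {for x, continuous f} -> {for x, continuous g} ->
  {for x, continuous (fun y => f y * g y)}.
Proof. by move=> cf cg; apply: cvgM; [exact: cf|exact: cg]. Qed.

Lemma continuousD_at f g : {for x, continuous f} -> {for x, continuous g} ->
  {for x, continuous (fun y => f y + g y)}.
Proof. by move=> cf cg; apply: cvgD; [exact: cf|exact: cg]. Qed.

Lemma continuousB_at f g : {for x, continuous f} -> {for x, continuous g} ->
  {for x, continuous (fun y => f y - g y)}.
Proof. by move=> cf cg; apply: cvgB; [exact: cf|exact: cg]. Qed.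

Lemma continuousV_at f : f x != 0 -> {for x, continuous f} ->
  {for x, continuous (fun y => (f y)^-1)}.
Proof. by move=> f0 cf; apply: cvgV; [exact: f0|exact: cf]. Qed.

Lemma near_distP (P : set E) : (\forall y \near x, P y) ->
  exists2 d, 0 < d & forall y, `|y - x| < d -> P y.
Proof.
move=> /nbhs_ballP[d /= d0 Hd]; exists d => // y yx.
by apply: Hd; rewrite -ball_normE /= distrC.
Qed.

End ContinuousAt.

Section ReducedProblem.
Variables (R : realType) (M al : R).
Hypotheses (M0 : M != 0) (al0 : al != 0).
Local Notation E := ('rV[R]_3 * 'rV[R]_3)%type.
Implicit Types (z v : E).

Definition wsq z : R := z.1 0 0 ^+ 2 + z.1 0 1 ^+ 2.
Definition dist z : R := Num.sqrt (wsq z + z.1 0 2 ^+ 2).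

Definition hred z : R :=
  (z.2 0 0 ^+ 2 + z.2 0 1 ^+ 2) / (2 * M) + z.2 0 2 ^+ 2 / (16 * al) + 8 * al * M / dist z.
Definition lred z : R := z.1 0 0 * z.2 0 1 - z.1 0 1 * z.2 0 0.
Definition Dred : set E := [set z | 0 < wsq z /\ z.1 0 2 != 0].

Definition dhred z v : R := (z.2 0 0 * v.2 0 0 + z.2 0 1 * v.2 0 1) / M +
  z.2 0 2 * v.2 0 2 / (8 * al) -
  8 * al * M * (z.1 0 0 * v.1 0 0 + z.1 0 1 * v.1 0 1 + z.1 0 2 * v.1 0 2) / dist z ^+ 3.
Definition dlred z v : R :=
  v.1 0 0 * z.2 0 1 + z.1 0 0 * v.2 0 1 - v.1 0 1 * z.2 0 0 - z.1 0 1 * v.2 0 0.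

Let oT : open [set: E] := openT.

Lemma class_C_wsq r (D : set E) : open D -> class_C r D wsq.
Proof. by move=> oD; apply: class_CD => //; apply: class_CX => //; exact: class_C_q. Qed.

Lemma open_Dred : open Dred.
Proof.
apply: openI; first by apply: open_gt0; exact: class_C_wsq.
rewrite (_ : (fun z => _) = [set z : E | 0 < z.1 0 2 ^+ 2]).
  by apply: open_gt0; apply: class_CX => //; exact: class_C_q.
by apply/seteqP; split=> z /=; rewrite lt_def sqr_ge0 andbT sqrf_eq0.
Qed.

Lemma dist2_gt0 z : Dred z -> 0 < wsq z + z.1 0 2 ^+ 2.
Proof. by move=> [w0 _]; rewrite ltr_wpDr// sqr_ge0. Qed.

Lemma dist_gt0 z : Dred z -> 0 < dist z.
Proof. by move=> /dist2_gt0; rewrite /dist sqrtr_gt0. Qed.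

Lemma class_C_dist r : class_C r Dred dist.
Proof.
have oD := open_Dred.
apply: (@class_C_comp_real R E r Dred [set x | 0 < x] Num.sqrt) => //.
- by apply: class_CD => //; [exact: class_C_wsq|apply: class_CX => //; exact: class_C_q].
- by move=> z /dist2_gt0.
exact: class_C_sqrt.
Qed.

Lemma class_C_hred r : class_C r Dred hred.
Proof.
have oD := open_Dred.
have Cp i : class_C r Dred (fun z : E => z.2 0 i ^+ 2) by apply: class_CX => //; exact: class_C_p.
apply: class_CD => //; last first.
  apply: class_CZ => //; apply: class_CV => //; last exact: class_C_dist.
  by move=> z /dist_gt0; rewrite lt0r => /andP[].
by apply: class_CD => //; apply: class_CM => //; try exact: class_C_cst; exact: class_CD.
Qed.

Lemma class_C_lred r : class_C r Dred lred.
Proof.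
have oD := open_Dred.
have Cp i : class_C r Dred (fun z : E => z.2 0 i) by exact: class_C_p.
have Cq i : class_C r Dred (fun z : E => z.1 0 i) by exact: class_C_q.
by apply: class_CB => //; exact: class_CM.
Qed.

Lemma is_derive_wsq z v : is_derive z v wsq (2 * (z.1 0 0 * v.1 0 0 + z.1 0 1 * v.1 0 1)).
Proof.
apply: (is_derive_eq (is_derive_add (is_derive_exp 2 (is_derive_q z v 0))
  (is_derive_exp 2 (is_derive_q z v 1)))).
by rewrite /=; ring.
Qed.

Lemma is_derive_dist z v : Dred z -> is_derive z v dist
  ((z.1 0 0 * v.1 0 0 + z.1 0 1 * v.1 0 1 + z.1 0 2 * v.1 0 2) / dist z).
Proof.
move=> Dz; have s0 := dist2_gt0 Dz; have d0 := dist_gt0 Dz.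
have D2 := is_derive_add (is_derive_wsq z v) (is_derive_exp 2 (is_derive_q z v 2)).
have df : differentiable (fun z : E => wsq z + z.1 0 2 ^+ 2) z.
  apply: (@class_C_differentiable R E 0 setT) => //.
  by apply: class_CD => //; [exact: class_C_wsq|apply: class_CX => //; exact: class_C_q].
have Ds : is_derive (wsq z + z.1 0 2 ^+ 2) (1 : R) Num.sqrt (2 * dist z)^-1.
  exact: is_derive1_sqrt s0.
apply: (is_derive_eq (@is_derive_comp_real R E Num.sqrt _ z v _ _ Ds df D2)).
by rewrite -/(dist z) /=; field; rewrite gt_eqF.
Qed.

Lemma is_derive_hred z v : Dred z -> is_derive z v hred (dhred z v).
Proof.
move=> Dz; have d0 := dist_gt0 Dz; have d0' : dist z != 0 by rewrite gt_eqF.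
have Dp i := is_derive_exp 2 (is_derive_p z v i).
have H1 := is_derive_scale (2 * M)^-1 (is_derive_add (Dp 0) (Dp 1)).
have H2 := is_derive_scale (16 * al)^-1 (Dp 2).
have H3 := is_derive_scale (8 * al * M) (is_derive_inv d0' (is_derive_dist v Dz)).
have H := is_derive_add (is_derive_add H1 H2) H3.
rewrite (_ : hred = fun y : E => (2 * M)^-1 * (y.2 0 0 ^+ 2 + y.2 0 1 ^+ 2) +
  (16 * al)^-1 * y.2 0 2 ^+ 2 + 8 * al * M * (dist y)^-1); last first.
  by apply/funext => y; rewrite /hred mulrC [X in _ + X + _]mulrC.
apply: (is_derive_eq H); rewrite /dhred /=; field.
by rewrite M0 al0 d0'.
Qed.

Lemma is_derive_lred z v : is_derive z v lred (dlred z v).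
Proof.
have Dp i := is_derive_p z v i; have Dq i := is_derive_q z v i.
apply: (is_derive_eq (is_derive_sub (is_derive_mul (Dq 0) (Dp 1)) (is_derive_mul (Dq 1) (Dp 0)))).
by rewrite /dlred; ring.
Qed.

Lemma diff_hred z v : Dred z -> 'd hred z v = dhred z v.
Proof.
move=> Dz; rewrite -deriveE; last exact: class_C_differentiable (class_C_hred 1) Dz.
by have [_ ->] := is_derive_hred v Dz.
Qed.

Lemma diff_lred z v : Dred z -> 'd lred z v = dlred z v.
Proof.
move=> Dz; rewrite -deriveE; last exact: class_C_differentiable (class_C_lred 1) Dz.
by have [_ ->] := is_derive_lred z v.
Qed.

Lemma ham_hred z : Dred z -> let X := ham_vec hred z in
  [/\ X.1 0 0 = z.2 0 0 / M, X.1 0 1 = z.2 0 1 / M & X.1 0 2 = z.2 0 2 / (8 * al)] /\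
  forall i, X.2 0 i = 8 * al * M * z.1 0 i / dist z ^+ 3.
Proof.
move=> Dz; have Dh v := @derive_val _ _ _ _ _ _ _ (is_derive_hred v Dz).
split; first by split; rewrite mxE Dh /dhred !mxE /=; ring.
move=> i; rewrite mxE Dh /dhred !mxE /=; case: i => -[|[|[|//]]] i3.
- rewrite (_ : Ordinal i3 = 0) ?eqxx /=; [ring|exact: val_inj].
- rewrite (_ : Ordinal i3 = 1) ?eqxx /=; [ring|exact: val_inj].
- rewrite (_ : Ordinal i3 = 2) ?eqxx /=; [ring|exact: val_inj].
Qed.

Lemma ham_lred z : let X := ham_vec lred z in
  [/\ X.1 0 0 = - z.1 0 1, X.1 0 1 = z.1 0 0 & X.1 0 2 = 0] /\
  [/\ X.2 0 0 = - z.2 0 1, X.2 0 1 = z.2 0 0 & X.2 0 2 = 0].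
Proof.
have Dh v := @derive_val _ _ _ _ _ _ _ (is_derive_lred z v).
by split; split; rewrite mxE Dh /dlred !mxE /=; ring.
Qed.

(** Invariants of the rotations about the vertical axis; eps = 1 or -1 reflects
    the half-space under consideration to z > 0. *)
Definition rot_inv (eps : R) (i : 'I_5) z : R :=
  match val i with
  | 0%N => wsq z
  | 1%N => (z.1 0 0 * z.2 0 0 + z.1 0 1 * z.2 0 1) / M
  | 2%N => (z.2 0 0 ^+ 2 + z.2 0 1 ^+ 2) / M ^+ 2
  | 3%N => eps * z.1 0 2
  | _ => eps * z.2 0 2 / (8 * al)
  end.

Definition drot_inv (eps : R) z v (i : 'I_5) : R :=
  match val i with
  | 0%N => 2 * (z.1 0 0 * v.1 0 0 + z.1 0 1 * v.1 0 1)
  | 1%N => (v.1 0 0 * z.2 0 0 + z.1 0 0 * v.2 0 0 + v.1 0 1 * z.2 0 1 + z.1 0 1 * v.2 0 1) / M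
  | 2%N => 2 * (z.2 0 0 * v.2 0 0 + z.2 0 1 * v.2 0 1) / M ^+ 2
  | 3%N => eps * v.1 0 2
  | _ => eps * v.2 0 2 / (8 * al)
  end.

Definition rot_invs eps z : 'rV[R]_5 := \row_i rot_inv eps i z.

Lemma rot_invsE eps z : [/\ rot_invs eps z 0 cxi = wsq z,
  rot_invs eps z 0 ceta = (z.1 0 0 * z.2 0 0 + z.1 0 1 * z.2 0 1) / M,
  rot_invs eps z 0 czeta = (z.2 0 0 ^+ 2 + z.2 0 1 ^+ 2) / M ^+ 2 &
  rot_invs eps z 0 cz = eps * z.1 0 2 /\ rot_invs eps z 0 cy = eps * z.2 0 2 / (8 * al)].
Proof. by do 2?split; rewrite mxE /rot_inv [val _](@inordK 4). Qed.

Lemma class_C_rot_inv r (D : set E) eps i : open D -> class_C r D (rot_inv eps i).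
Proof.
move=> oD.
have Cp i' : class_C r D (fun z : E => z.2 0 i') by exact: class_C_p.
have Cq i' : class_C r D (fun z : E => z.1 0 i') by exact: class_C_q.
have CX2 i' : class_C r D (fun z : E => z.2 0 i' ^+ 2) by exact: class_CX.
have Cc (a : R) : class_C r D (fun z : E => a) by exact: class_C_cst.
case: i => -[|[|[|[|k]]]] ik; rewrite /rot_inv /=.
- exact: class_C_wsq.
- by apply: class_CM => //; apply: class_CD => //; exact: class_CM.
- by apply: class_CM => //; exact: class_CD.
- exact: class_CZ.
- by apply: class_CM => //; exact: class_CZ.
Qed.

Lemma is_derive_rot_inv eps i z v : is_derive z v (rot_inv eps i) (drot_inv eps z v i).
Proof.
have Dp j := is_derive_p z v j; have Dq j := is_derive_q z v j.
have mulc (f : E -> R) (a b : R) : is_derive z v f a -> is_derive z v (fun y : E => f y * b) (a * b).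
  move=> H; apply: (is_derive_eq (is_derive_mul H (is_derive_const z v b))).
  by rewrite mulr0 addr0.
case: i => -[|[|[|[|k]]]] ik; rewrite /rot_inv /drot_inv /=.
- exact: is_derive_wsq.
- apply: (is_derive_eq (mulc _ _ M^-1 (is_derive_add (is_derive_mul (Dq 0) (Dp 0)) (is_derive_mul (Dq 1) (Dp 1))))).
  by rewrite addrA.
- apply: (is_derive_eq (mulc _ _ (M ^- 2) (is_derive_add (is_derive_exp 2 (Dp 0)) (is_derive_exp 2 (Dp 1))))).
  by rewrite /=; ring.
- exact: is_derive_scale.
- by apply: mulc; exact: is_derive_scale.
Qed.

(** The half-spaces z > 0 and z < 0 are disjoint open parts of the domain, so
    an integral living on one of them extends by 0 to the other. *)
Definition locf eps (f : 'rV[R]_5 -> R) z : R := if 0 < eps * z.1 0 2 then f (rot_invs eps z) else 0.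

Lemma open_side eps : open [set z : E | 0 < eps * z.1 0 2].
Proof. by apply: open_gt0; apply: class_CZ => //; exact: class_C_q. Qed.

Lemma near_side eps z : 0 < eps * z.1 0 2 -> \forall y \near z, 0 < eps * (y : E).1 0 2.
Proof. by move=> ez; apply: open_nbhs_nbhs; split; first exact: open_side. Qed.

Lemma side_opp eps z : eps != 0 -> Dred z -> ~~ (0 < eps * z.1 0 2) -> 0 < - eps * z.1 0 2.
Proof.
move=> e0 [_ z0]; rewrite -leNgt mulNr oppr_gt0 => h.
by rewrite lt_neqAle h mulf_neq0.
Qed.

Lemma Om_rot_invs eps z : Dred z -> 0 < eps * z.1 0 2 -> Om (rot_invs eps z).
Proof. by move=> [w0 _] ez; have [E1 _ _ [E2 _]] := rot_invsE eps z; rewrite /Om /= E1 E2. Qed.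

Lemma class_C_locf eps f r : eps != 0 -> class_C r (@Om R) f -> class_C r Dred (locf eps f).
Proof.
move=> e0 Cf; apply: class_C_local => z Dz.
have [ez|ez] := boolP (0 < eps * z.1 0 2).
  exists (Dred `&` [set z : E | 0 < eps * z.1 0 2]); split=> //.
    by apply: openI; [exact: open_Dred|exact: open_side].
  have oD : open (Dred `&` [set z : E | 0 < eps * z.1 0 2]).
    by apply: openI; [exact: open_Dred|exact: open_side].
  apply: (@class_C_ext _ _ _ _ (fun z => f (\row_i rot_inv eps i z))) => //.
    by move=> y [_ /= ey]; rewrite /locf ey.
  apply: class_C_comp_rV Cf => //; first by move=> i; exact: class_C_rot_inv.
  by move=> y [Dy /= ey]; exact: Om_rot_invs.
exists (Dred `&` [set z : E | 0 < - eps * z.1 0 2]).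
have oD : open (Dred `&` [set z : E | 0 < - eps * z.1 0 2]).
  by apply: openI; [exact: open_Dred|exact: open_side].
split=> //; first by split=> //; exact: side_opp.
apply: (@class_C_ext _ _ _ _ (fun=> 0)) => //; last exact: class_C_cst.
by move=> y [_ /=]; rewrite mulNr oppr_gt0 => /ltW h; rewrite /locf ltNge h.
Qed.

Lemma diff_locf eps f z v : eps != 0 -> class_C 1 (@Om R) f -> Dred z ->
  'd (locf eps f) z v = if 0 < eps * z.1 0 2 then 'd f (rot_invs eps z) (\row_i drot_inv eps z v i) else 0.
Proof.
move=> e0 Cf Dz; have iter_derive : differentiable (locf eps f) z.
  exact: class_C_differentiable (class_C_locf e0 Cf) Dz.
rewrite -deriveE//; case: ifPn => ez.
  have near_eq : \forall y \near z, locf eps f y = f (\row_i rot_inv eps i y).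
    apply: filterS (near_side ez) => y ey.
    by rewrite /locf ey.
  rewrite (near_eq_derive _ near_eq).
  apply: (@derive_val _ _ _ _ _ _ _ (@is_derive_comp_rV R 3 5 f (rot_inv eps) (drot_inv eps z v) z v _ _ _)).
  - exact: class_C_differentiable Cf (Om_rot_invs Dz ez).
  - by move=> i; apply: (@class_C_differentiable R E 0 setT) => //; exact: class_C_rot_inv.
  - by move=> i; exact: is_derive_rot_inv.
have ez' := side_opp e0 Dz ez.
rewrite (@near_eq_derive _ _ _ _ (cst 0)) ?derive_cst//.
apply: filterS (near_side ez') => y.
by rewrite mulNr oppr_gt0 => /ltW h; rewrite /locf ltNge h.
Qed.

Lemma drot_inv_ham_lred eps z i : drot_inv eps z (ham_vec lred z) i = 0.
Proof.
have [[E1 E2 E3] [E4 E5 E6]] := ham_lred z.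
by case: i => -[|[|[|[|k]]]] ik; rewrite /drot_inv /= ?E1 ?E2 ?E3 ?E4 ?E5 ?E6; ring.
Qed.

Lemma rho_rot_invs eps z : eps ^+ 2 = 1 -> rho (rot_invs eps z) = dist z.
Proof.
by move=> e1; have [E1 _ _ [E2 _]] := rot_invsE eps z; rewrite /rho E1 E2 exprMn e1 mul1r.
Qed.

(** Changing the time to y is dividing by dy/dt = M z / rho^3. *)
Lemma drot_inv_ham_hred eps z : eps ^+ 2 = 1 -> Dred z ->
  \row_i drot_inv eps z (ham_vec hred z) i =
  (M * (eps * z.1 0 2) / dist z ^+ 3) *: field (8 * al) M (rot_invs eps z).
Proof.
move=> e1 Dz; have [[E1 E2 E3] E4] := ham_hred Dz.
have e0 : eps != 0 by rewrite -sqrf_eq0 e1 oner_eq0.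
have z0 : z.1 0 2 != 0 by case: Dz.
have d0 : dist z != 0 by rewrite gt_eqF// dist_gt0.
have [F1 F2 F3 [F4 F5]] := rot_invsE eps z.
apply/rowP => i; rewrite !mxE /fcomp /sig F1 F2 F3 F4 F5 rho_rot_invs//.
case: i => -[|[|[|[|k]]]] ik; rewrite /drot_inv /= ?E1 ?E2 ?E3 ?E4.
- by field; rewrite ?M0 ?e0 ?z0 ?d0 ?al0.
- by rewrite /wsq; field; rewrite ?M0 ?e0 ?z0 ?d0 ?al0.
- by field; rewrite ?M0 ?e0 ?z0 ?d0 ?al0.
- by field; rewrite ?M0 ?e0 ?z0 ?d0 ?al0.
- by field; rewrite ?M0 ?d0 ?al0.
Qed.

Lemma amom2_rot_invs eps z : amom2 (rot_invs eps z) = (lred z / M) ^+ 2.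
Proof.
have [E1 E2 E3 _] := rot_invsE eps z; rewrite /amom2 E1 E2 E3 /wsq /lred.
by field.
Qed.

(** The invariants determine the state up to a rotation: rescale w, and
    recompose v from its radial and angular components, the latter with the sign
    of the angular momentum of z. *)
Lemma lift_rot_invs eps z (e : R) : eps ^+ 2 = 1 -> Dred z -> lred z != 0 -> 0 < e ->
  exists2 d, 0 < d & forall x, `|x - rot_invs eps z| < d -> @Om R x -> 0 < amom2 x ->
    exists z', [/\ rot_invs eps z' = x, Dred z' & `|z' - z| < e].
Proof.
move=> e1 [xi0 zz0] l0 ep0; have [E1 E2 E3 [E4 E5]] := rot_invsE eps z.
have eps0 : eps != 0 by rewrite -sqrf_eq0 e1 oner_eq0.
have xi_neq0 : wsq z != 0 by rewrite gt_eqF.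
pose V := 'rV[R]_5; pose x0 := rot_invs eps z.
pose s (x : V) : R := Num.sqrt (x 0 cxi / wsq z).
pose a (x : V) : R := x 0 ceta / (s x * wsq z).
pose b (x : V) : R := Num.sg (lred z / M) * Num.sqrt (amom2 x) / (s x * wsq z).
pose Lq (x : V) (i : 'I_3) : R :=
  match val i with 0%N => s x * z.1 0 0 | 1%N => s x * z.1 0 1 | _ => eps * x 0 cz end.
pose Lp (x : V) (i : 'I_3) : R :=
  match val i with
  | 0%N => M * (a x * z.1 0 0 - b x * z.1 0 1)
  | 1%N => M * (a x * z.1 0 1 + b x * z.1 0 0)
  | _ => 8 * al * eps * x 0 cy end.
have s0 : s x0 = 1 by rewrite /s /x0 E1 divff// sqrtr1.
have b0 : b x0 = lred z / M / wsq z.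
  rewrite /b s0 mul1r; congr (_ / _); rewrite /x0 amom2_rot_invs sqrtr_sqr.
  by rewrite -numEsg.
have a0 : a x0 = (z.1 0 0 * z.2 0 0 + z.1 0 1 * z.2 0 1) / M / wsq z by rewrite /a s0 mul1r /x0 E2.
have Lq0 i : Lq x0 i = z.1 0 i.
  case: i => -[|[|[|//]]] ik; rewrite /Lq /= ?s0 ?mul1r.
  - by congr (z.1 _ _); exact: val_inj.
  - by congr (z.1 _ _); exact: val_inj.
  by rewrite /x0 E4 mulrA -expr2 e1 mul1r; congr (z.1 _ _); exact: val_inj.
have Lp0 i : Lp x0 i = z.2 0 i.
  case: i => -[|[|[|//]]] ik; rewrite /Lp /= ?a0 ?b0.
  - rewrite (_ : Ordinal ik = 0); last exact: val_inj.
    have : wsq z != 0 by []. rewrite /wsq /lred => w0; field.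
    by rewrite w0.
  - rewrite (_ : Ordinal ik = 1); last exact: val_inj.
    have : wsq z != 0 by []. rewrite /wsq /lred => w0; field.
    by rewrite w0.
  rewrite /x0 E5 (_ : Ordinal ik = 2); last exact: val_inj.
  rewrite -[RHS]mul1r -e1; by field; rewrite ?M0 ?al0.
have cc i : {for x0, continuous (fun x : V => x 0 i)} by exact: rV_continuous_coord.
have cM := @continuousM_at R V x0; have cD := @continuousD_at R V x0.
have cB := @continuousB_at R V x0.
have cK (c : R) : {for x0, continuous (fun=> c : R)} by exact: cst_continuous.
have cs : {for x0, continuous s}.
  apply: (@continuous_comp _ _ _ (fun x : V => x 0 cxi / wsq z) Num.sqrt); last exact: sqrt_continuous.
  exact: cM.
have ci : {for x0, continuous (fun x => (s x * wsq z)^-1)}.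
  apply: (@continuousV_at R V); first by rewrite s0 mul1r.
  exact: cM.
have ca : {for x0, continuous a} by exact: cM.
have cb : {for x0, continuous b}.
  apply: (cM) => //; apply: (cM) => //.
  apply: (@continuous_comp _ _ _ (@amom2 R) Num.sqrt); last exact: sqrt_continuous.
  by apply: (@class_C_continuous R V 0 setT) => //; exact: class_C_amom2.
have cq i : {for x0, continuous (Lq ^~ i)}.
  by case: i => -[|[|[|//]]] ik; rewrite /Lq /=; exact: cM.
have cp i : {for x0, continuous (Lp ^~ i)}.
  case: i => -[|[|[|//]]] ik; rewrite /Lp /=.
  - by apply: (cM) => //; apply: cB; exact: cM.
  - by apply: (cM) => //; apply: cD; exact: cM.
  exact: cM.
have nq : \forall x \near x0, forall i, `|Lq x i - z.1 0 i| < e.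
  apply: (@filter_forall V 'I_3 (fun i x => `|Lq x i - z.1 0 i| < e) (nbhs x0)) => i.
  have := cq i _ (near_dist_lt (Lq x0 i) ep0); rewrite Lq0; exact.
have np : \forall x \near x0, forall i, `|Lp x i - z.2 0 i| < e.
  apply: (@filter_forall V 'I_3 (fun i x => `|Lp x i - z.2 0 i| < e) (nbhs x0)) => i.
  have := cp i _ (near_dist_lt (Lp x0 i) ep0); rewrite Lp0; exact.
have [d d0 Hd] := @near_distP R V x0 _ (filterI nq np).
exists d => // x xd [xz xxi] am.
have [Hq Hp] : (forall i, `|Lq x i - z.1 0 i| < e) /\ (forall i, `|Lp x i - z.2 0 i| < e).
  exact: Hd.
have s2 : s x ^+ 2 = x 0 cxi / wsq z by rewrite sqr_sqrtr// divr_ge0// ltW.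
have sx0 : s x != 0 by rewrite -sqrf_eq0 s2 mulf_neq0 ?invr_eq0// gt_eqF.
pose z' : E := (\row_i Lq x i, \row_i Lp x i).
have Z : [/\ z'.1 0 0 = s x * z.1 0 0, z'.1 0 1 = s x * z.1 0 1 & z'.1 0 2 = eps * x 0 cz] /\
  [/\ z'.2 0 0 = M * (a x * z.1 0 0 - b x * z.1 0 1),
      z'.2 0 1 = M * (a x * z.1 0 1 + b x * z.1 0 0) & z'.2 0 2 = 8 * al * eps * x 0 cy].
  by split; split; rewrite mxE.
have [[q0 q1 q2] [p0 p1 p2]] := Z.
have wsq' : wsq z' = x 0 cxi.
  rewrite /wsq q0 q1 !exprMn -mulrDr -/(wsq z) s2; exact: divfK.
exists z'; split.
- apply/rowP => i; rewrite mxE.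
  case: i => -[|[|[|[|[|//]]]]] ik; rewrite /rot_inv /=.
  + by rewrite (_ : Ordinal ik = cxi)//; apply: val_inj; rewrite /= inordK.
  + rewrite (_ : Ordinal ik = ceta); last by apply: val_inj; rewrite /= inordK.
    have -> : z'.1 0 0 * z'.2 0 0 + z'.1 0 1 * z'.2 0 1 = M * (s x * wsq z) * a x.
      by rewrite q0 q1 p0 p1 /wsq; ring.
    by rewrite /a; field; rewrite xi_neq0 sx0 M0.
  + rewrite (_ : Ordinal ik = czeta); last by apply: val_inj; rewrite /= inordK.
    have -> : z'.2 0 0 ^+ 2 + z'.2 0 1 ^+ 2 = M ^+ 2 * (wsq z * (a x ^+ 2 + b x ^+ 2)).
      by rewrite p0 p1 /wsq; ring.
    have b2 : b x ^+ 2 = amom2 x / (s x ^+ 2 * wsq z ^+ 2).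
      rewrite /b !exprMn exprVn sqr_sqrtr ?(ltW am)// exprMn sqr_sg mulf_neq0 ?invr_eq0//.
      by rewrite mul1r.
    rewrite b2 /a s2 expr_div_n exprMn s2 /amom2.
    by field; rewrite xi_neq0 M0 gt_eqF.
  + rewrite (_ : Ordinal ik = cz); last by apply: val_inj; rewrite /= inordK.
    by rewrite q2 mulrA -expr2 e1 mul1r.
  rewrite (_ : Ordinal ik = cy); last by apply: val_inj; rewrite /= inordK.
  by rewrite p2 -[RHS]mul1r -e1; field; rewrite ?M0 ?al0.
- split; rewrite ?wsq'//= q2 mulf_neq0//; by rewrite gt_eqF.
by rewrite prod_normE gt_max; apply/andP; split; apply: rV_norm_lt => // i; rewrite !mxE.
Qed.

End ReducedProblem.

(** * Integrability of the anisotropic Kepler problem *)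

Section ReducedIntegrability.
Variables (R : realType) (M al : R).
Hypotheses (M0 : M != 0) (al0 : al != 0).
Local Notation E := ('rV[R]_3 * 'rV[R]_3)%type.
Implicit Types (z v : E).
Local Notation hred := (hred M al).

Lemma near_right_neq (a : R) : \forall t \near 0^'+, t != a.
Proof.
have [a0|a0] := leP a 0.
  apply: filterS (nbhs_right_gt 0) => t t0; rewrite gt_eqF//.
  exact: le_lt_trans t0.
by apply: filterS (nbhs_right_lt a0) => t ta; rewrite lt_eqF.
Qed.

(** Adding t (- w_1, w_0, 1) to the momentum changes L by t |w|^2 and p_z
    by t. *)
Lemma generic_near z (e : R) : Dred z -> 0 < e ->
  exists z', [/\ Dred z', lred z' != 0, z'.2 0 2 != 0 & `|z' - z| < e].
Proof.
move=> [w0 z0] e0; have w0' : wsq z != 0 by rewrite gt_eqF.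
pose d : 'rV[R]_3 := \row_i (if i == 0 then - z.1 0 1 else if i == 1 then z.1 0 0 else 1).
have d1 : 0 < `|d| + 1 by rewrite ltr_wpDl.
near (0 : R)^'+ => t.
have t0 : 0 < t by near: t; exact: nbhs_right_gt.
have tl : t != - lred z / wsq z by near: t; exact: near_right_neq.
have tp : t != - z.2 0 2 by near: t; exact: near_right_neq.
have te : t < e / (`|d| + 1) by near: t; apply: nbhs_right_lt; exact: divr_gt0.
exists (z.1, z.2 + t *: d); split=> //.
- have -> : lred (z.1, z.2 + t *: d) = lred z + t * wsq z.
    by rewrite /lred /wsq !mxE /=; ring.
  apply: contraNneq tl => h; apply/eqP/(mulIf w0'); rewrite divfK//; lra.
- by rewrite !mxE /= mulr1 addrC addr_eq0.
rewrite prod_normE /= subrr normr0 gt_max e0 /= addrAC subrr add0r normrZ gtr0_norm//.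
rewrite ltr_pdivlMr// in te; apply: le_lt_trans te.
by rewrite ler_wpM2l ?(ltW t0)// lerDl.
Unshelve. all: by end_near. Qed.

(** A first integral f of the flow and of the rotations, and a vector u along
    which it varies while the energy and the angular momentum do not. *)
Definition good_integral (f : E -> R) z (u : E) : Prop :=
  [/\ Dred z /\ z.2 0 2 != 0, 'd f z u != 0, forall r, class_C r (@Dred R) f,
      forall y, Dred y -> 'd f y (ham_vec hred y) = 0 /\ 'd f y (ham_vec (@lred R) y) = 0 &
      dhred M al z u = 0 /\ dlred z u = 0].

(** At a point found by [local_integral], f varies like eta when y is fixed.
    The vector u moves p_w along w, which changes eta but not the angular
    momentum, and z so as to compensate the change of energy. *)
Lemma good_integral_near z (e : R) : Dred z -> 0 < e ->
  exists f z' u, good_integral f z' u /\ `|z' - z| < e.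
Proof.
move=> Dz e0; have e2 : 0 < e / 2 by rewrite divr_gt0.
have [z0 [Dz0 l0 p0 zz0]] := generic_near Dz e2.
pose eps : R := Num.sg (z0.1 0 2).
have eps2 : eps ^+ 2 = 1 by rewrite sqr_sg; case: Dz0 => _ ->.
have eps0 : eps != 0 by rewrite -sqrf_eq0 eps2 oner_eq0.
have sd : 0 < eps * z0.1 0 2 by rewrite -normrEsg normr_gt0; case: Dz0.
have [d d0 Hd] := lift_rot_invs M0 al0 eps2 Dz0 l0 e2.
have la : 8 * al != 0 :> R by rewrite mulf_neq0.
have Ox0 := Om_rot_invs M al Dz0 sd.
have am0 : 0 < amom2 (rot_invs M al eps z0).
  by rewrite amom2_rot_invs// exprn_even_gt0//= mulf_neq0 ?invr_eq0.
have y0 : rot_invs M al eps z0 0 cy != 0.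
  have [_ _ _ [_ ->]] := rot_invsE M al eps z0.
  by rewrite !mulf_neq0 ?invr_eq0.
have [x1 [f [C [[xd Ox1 am1 y1 C0] [fC f0 fw]]]]] := local_integral la M0 Ox0 am0 y0 d0.
have [z' [zx Dz' z'z]] := Hd x1 xd Ox1 am1.
have sd' : 0 < eps * z'.1 0 2.
  by have [_ _ _ [<- _]] := rot_invsE M al eps z'; rewrite zx; case: Ox1.
have zn : z'.1 0 2 != 0 by case: Dz'.
have dn : dist z' != 0 by rewrite gt_eqF// dist_gt0.
(* the variation of z that compensates the change of energy when p_w moves along w *)
pose dz := dist z' ^+ 3 * (z'.1 0 0 * z'.2 0 0 + z'.1 0 1 * z'.2 0 1) / (8 * al * M ^+ 2 * z'.1 0 2).
pose u : E := (\row_i (if i == 2 then dz else 0), \row_i (if i == 2 then 0 else z'.1 0 i)).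
have [U0 U1 U2] : [/\ u.1 0 0 = 0, u.1 0 1 = 0 & u.1 0 2 = dz] by split; rewrite mxE.
have [V0 V1 V2] : [/\ u.2 0 0 = z'.1 0 0, u.2 0 1 = z'.1 0 1 & u.2 0 2 = 0] by split; rewrite mxE.
exists (locf M al eps f), z', u; split; last first.
  by have := ler_normD (z' - z0) (z0 - z); rewrite addrA subrK; move: z'z zz0; lra.
split.
- split=> //.
  have [_ _ _ [_ H]] := rot_invsE M al eps z'; move: y1; rewrite -zx H.
  by apply: contraNneq => ->; rewrite mulr0 mul0r.
- rewrite diff_locf// sd' zx fw; last by rewrite mxE /drot_inv [val _](@inordK 4)//= V2; ring.
  rewrite mxE /drot_inv [val _](@inordK 4)//= U0 U1 V0 V1 mulf_neq0// mulf_neq0 ?invr_eq0//.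
  by rewrite !mul0r add0r addr0 -!expr2; case: Dz' => w0 _; rewrite gt_eqF.
- by move=> r; exact: class_C_locf.
- move=> y Dy; rewrite !diff_locf//; case: ifP => // ey; split.
    by rewrite drot_inv_ham_hred// linearZ /= f0 ?scaler0//; exact: Om_rot_invs.
  rewrite (_ : \row_i _ = 0) ?linear0//; apply/rowP => i.
  by rewrite !mxE drot_inv_ham_lred.
by split; rewrite /dhred /dlred ?U0 ?U1 ?U2 ?V0 ?V1 ?V2 /dz; field; rewrite ?M0 ?al0 ?zn ?dn.
Qed.

Lemma sum3 (V : zmodType) (F : 'I_3 -> V) : \sum_i F i = F 0 + F 1 + F 2.
Proof.
rewrite !big_ord_recr big_ord0 /= add0r.
by congr (F _ + F _ + F _); exact: val_inj.
Qed.

Lemma ord3P (P : 'I_3 -> Prop) : P 0 -> P 1 -> P 2 -> forall i, P i.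
Proof.
move=> P0 P1 P2 [[|[|[|//]]] ik].
- by rewrite (_ : Ordinal ik = 0)//; exact: val_inj.
- by rewrite (_ : Ordinal ik = 1)//; exact: val_inj.
by rewrite (_ : Ordinal ik = 2)//; exact: val_inj.
Qed.

Theorem reduced_integrable : liouville_integrable (@Dred R) hred.
Proof.
have oD := @open_Dred R.
have [||G [CG G0 Gn]] := @dense_gluing R 3 (@Dred R) good_integral oD.
- by move=> f x u [[Dx _] fx Cf _ _].
- by move=> z e Dz e0; exact: good_integral_near.
have dG z : Dred z -> differentiable G z by exact: class_C_differentiable (CG 1).
have dH z : Dred z -> differentiable hred z.
  by exact: class_C_differentiable (class_C_hred M al 1).
have dL z : Dred z -> differentiable (@lred R) z.
  by exact: class_C_differentiable (class_C_lred R 1).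
have GH z : Dred z -> poisson G hred z = 0.
  move=> Dz; rewrite poissonE; last exact: dG.
  by apply: G0 => // f x u [_ _ _ H _]; case: (H z Dz).
have GL z : Dred z -> poisson G (@lred R) z = 0.
  move=> Dz; rewrite poissonE; last exact: dG.
  by apply: G0 => // f x u [_ _ _ H _]; case: (H z Dz).
have LH z : Dred z -> poisson (@lred R) hred z = 0.
  move=> Dz; rewrite poissonE; last exact: dL.
  rewrite diff_lred//; have [[E1 E2 E3] E4] := ham_hred M0 al0 Dz.
  by rewrite /dlred E1 E2 !E4; ring.
have self (F : E -> R) z : poisson F F z = 0.
  have := poisson_antisym F F z; lra.
pose F (i : 'I_3) : E -> R := match val i with 0%N => hred | 1%N => @lred R | _ => G end.
exists F; split.
- apply: ord3P => r; [exact: class_C_hred|exact: class_C_lred|exact: CG].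
- apply: ord3P => z Dz; [exact: self|exact: LH|exact: GH].
- apply: ord3P; apply: ord3P => z Dz; rewrite /F /=.
  + exact: self.
  + by rewrite poisson_antisym LH ?oppr0.
  + by rewrite poisson_antisym GH ?oppr0.
  + exact: LH.
  + exact: self.
  + by rewrite poisson_antisym GL ?oppr0.
  + exact: GH.
  + exact: GL.
  + exact: self.
apply: dense_closure => z e Dz e0.
have [f [x [u [[[Dx px] _ _ _ [hu lu]] xz Gu]]]] := Gn z e Dz e0.
exists x; split=> // a Ha.
have {}Ha v : a 0 * dhred M al x v + a 1 * dlred x v + a 2 * 'd G x v = 0.
  by have := Ha v; rewrite sum3 /F /= diff_hred// diff_lred.
have a2 : a 2 = 0.
  have := Ha u; rewrite hu lu !mulr0 !add0r => /eqP.
  by rewrite mulf_eq0 (negbTE Gu) orbF => /eqP.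
have a0 : a 0 = 0.
  have := Ha (0, delta_mx 0 2); rewrite a2 mul0r addr0 /dhred /dlred !mxE /=.
  move=> h; have /eqP : a 0 * (x.2 0 2 / (8 * al)) = 0 by rewrite -[RHS]h; ring.
  by rewrite mulf_eq0 mulf_eq0 (negbTE px) invr_eq0 mulf_eq0 (negbTE al0) /= pnatr_eq0 !orbF => /eqP.
apply: ord3P => //.
have := Ha (0, \row_i (if i == 0 then - x.1 0 1 else if i == 1 then x.1 0 0 else 0)).
rewrite a2 a0 !mul0r addr0 add0r /dlred !mxE /= => h.
have /eqP : a 1 * wsq x = 0 by rewrite -[RHS]h /wsq; ring.
by rewrite mulf_eq0 orbC gt_eqF /= => [/eqP|]; [|case: Dx].
Qed.

End ReducedIntegrability.

(** * Newtonian forces *)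

Section Newton.
Variables (R : realType) (N d : nat).
Implicit Types (m : 'rV[R]_N) (q v : 'M[R]_(N, d)).

Definition gap q (i j : 'I_N) : R := enorm (row i q - row j q).

Lemma gapE q i j : gap q i j = Num.sqrt (\sum_k (q i k - q j k) ^+ 2).
Proof. by congr Num.sqrt; apply: eq_bigr => k _; rewrite !mxE. Qed.

Lemma gap_sym q i j : gap q i j = gap q j i.
Proof. by rewrite !gapE; congr Num.sqrt; apply: eq_bigr => k _; rewrite -sqrrN opprB. Qed.

Lemma gap_diag q i : gap q i i = 0.
Proof. by rewrite gapE big1 ?sqrtr0// => k _; rewrite subrr expr0n. Qed.

Lemma gap2_gt0 q i j : row i q != row j q -> 0 < \sum_k (q i k - q j k) ^+ 2.
Proof.
move=> qij; rewrite lt_def sumr_ge0 ?andbT; last by move=> k _; rewrite sqr_ge0.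
apply: contraNneq qij => /psumr_eq0P H; apply/eqP/rowP => k; rewrite !mxE.
apply/eqP; rewrite -subr_eq0 -sqrf_eq0; apply/eqP/H => // l _; exact: sqr_ge0.
Qed.

Lemma entry_linear i k : linear (fun q : 'M[R]_(N, d) => q i k).
Proof. by move=> a x y; rewrite !mxE. Qed.

Definition entry i k : {linear 'M[R]_(N, d) -> R} :=
  HB.pack (fun q : 'M[R]_(N, d) => q i k) (GRing.isLinear.Build R _ R *:%R _ (entry_linear i k)).

Lemma entry_continuous i k : continuous (entry i k).
Proof. exact: coord_continuous. Qed.

Lemma is_derive_entry q v i k : is_derive q v (fun q => q i k) (v i k).
Proof. exact: (is_derive_linear q v (@entry_continuous i k)). Qed.

Lemma class_C_entry r D i k : open D -> class_C r D (fun q : 'M[R]_(N, d) => q i k).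
Proof. by move=> oD; exact: (class_C_linear r oD (@entry_continuous i k)). Qed.

Lemma is_derive_gap_inv q v i j : row i q != row j q ->
  is_derive q v (fun q => (gap q i j)^-1)
    (- (\sum_k (q i k - q j k) * (v i k - v j k)) / gap q i j ^+ 3).
Proof.
move=> qij; have s0 := gap2_gt0 qij.
have D2 : is_derive q v (fun q => \sum_k (q i k - q j k) ^+ 2)
    (\sum_k 2 * (q i k - q j k) * (v i k - v j k)).
  apply: is_derive_bigsum => k _.
  exact: (is_derive_exp 2 (is_derive_sub (is_derive_entry q v i k) (is_derive_entry q v j k))).
have df : differentiable (fun q => \sum_k (q i k - q j k) ^+ 2) q.
  apply: (@class_C_differentiable R _ 0 setT) => //.
  apply: class_C_sum => [|k _]; first exact: openT.
  by apply: class_CX; [exact: openT|apply: class_CB; try exact: openT; exact: class_C_entry openT].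
have g0 : gap q i j != 0 by rewrite gapE gt_eqF// sqrtr_gt0.
have Ds : is_derive (\sum_k (q i k - q j k) ^+ 2) (1 : R) Num.sqrt (2 * gap q i j)^-1.
  by rewrite gapE; exact: is_derive1_sqrt s0.
have Dg := @is_derive_comp_real R _ Num.sqrt _ q v _ _ Ds df D2.
have H := @is_derive_inv R _ (fun q => Num.sqrt (\sum_k (q i k - q j k) ^+ 2)) q v _ _ Dg.
rewrite (_ : (fun q => _) = fun q => (Num.sqrt (\sum_k (q i k - q j k) ^+ 2))^-1); last first.
  by apply/funext => y; rewrite gapE.
apply: (is_derive_eq (H _)); first by rewrite -gapE.
rewrite -gapE (eq_bigr (fun k => 2 * ((q i k - q j k) * (v i k - v j k)))); last first.
  by move=> k _; rewrite mulrA.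
rewrite -mulr_sumr; field; exact: g0.
Qed.

(** Differentiating a sum over pairs with respect to the position of body i
    leaves the sum over the other bodies. *)
Lemma sum_lt_antisym (F : 'I_N -> 'I_N -> R) i : (forall a b, F a b = - F b a) ->
  \sum_(a < N) \sum_(b < N | (a < b)%N) F a b * ((a == i)%:R - (b == i)%:R) = \sum_b F i b.
Proof.
move=> asym; pose G (a b : 'I_N) : R := (a < b)%:R.
have GG a b : G a b * F a b + G b a * F a b = F a b.
  rewrite /G -mulrDl; have [ab|ba|/val_inj ab] := ltngtP a b; rewrite ?add0r ?addr0 ?mul1r//.
  have h : F a a = 0 by have := asym a a; lra.
  by rewrite -ab h mulr0.
transitivity (\sum_a \sum_b (G a b * F a b * (a == i)%:R - G a b * F a b * (b == i)%:R)).
  apply: eq_bigr => a _; rewrite big_mkcond; apply: eq_bigr => b _; rewrite -mulrBr /G.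
  by case: ifP => _; rewrite ?mul1r ?mul0r.
under eq_bigr do rewrite sumrB; rewrite sumrB [X in _ - X]exchange_big /= -sumrB.
rewrite (bigD1 i)//= [X in _ + X]big1 ?addr0 => [|a /negbTE ai]; last first.
  by rewrite -sumrB big1// => b _; rewrite ai !mulr0 subrr.
rewrite -sumrB; apply: eq_bigr => b _; rewrite eqxx !mulr1 -[RHS]GG.
by rewrite -mulrN -asym.
Qed.

Lemma sum_lt_sym (F : 'I_N -> 'I_N -> R) : (forall a b, F a b = F b a) -> (forall a, F a a = 0) ->
  \sum_a \sum_b F a b = 2 * \sum_(a < N) \sum_(b < N | (a < b)%N) F a b.
Proof.
move=> sym F0; pose G (a b : 'I_N) : R := (a < b)%:R.
have GG a b : F a b = G a b * F a b + G b a * F b a.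
  rewrite -[in X in _ + X]sym /G -mulrDl.
  have [ab|ba|/val_inj ab] := ltngtP a b; rewrite ?add0r ?addr0 ?mul1r//.
  by rewrite ab F0 mulr0.
have E1 : \sum_(a < N) \sum_(b < N | (a < b)%N) F a b = \sum_a \sum_b G a b * F a b.
  apply: eq_bigr => a _; rewrite big_mkcond; apply: eq_bigr => b _; rewrite /G.
  by case: ifP => _; rewrite ?mul1r ?mul0r.
rewrite E1 mulrC mulrDr mulr1 [X in _ = _ + X]exchange_big -big_split.
by apply: eq_bigr => a _; rewrite -big_split; apply: eq_bigr => b _; exact: GG.
Qed.

(** The term j = i vanishes, as 0 / 0 = 0. *)
Definition accel m q (i : 'I_N) (k : 'I_d) : R :=
  - \sum_j m 0 j * (q i k - q j k) / gap q i j ^+ 3.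

Lemma scaled_gradientE m q i k : collision_free q -> m 0 i != 0 ->
  scaled_gradient m q i k = accel m q i k.
Proof.
move=> cf mi; rewrite mxE.
pose F a b := m 0 a * m 0 b * (q a k - q b k) / gap q a b ^+ 3.
have H : is_derive q (delta_mx i k) (potential m)
    (\sum_(a < N) \sum_(b < N | (a < b)%N) - F a b * ((a == i)%:R - (b == i)%:R)).
  apply: is_derive_bigsum => a _; apply: is_derive_bigsum => b ab.
  have nab : row a q != row b q by apply: cf; rewrite neq_ltn ab.
  apply: (is_derive_eq (is_derive_scale (m 0 a * m 0 b) (is_derive_gap_inv (delta_mx i k) nab))).
  rewrite (bigD1 k)//= [X in _ + X]big1 => [|l /negbTE lk]; last first.
    by rewrite !mxE lk !andbF subrr mulr0.
  by rewrite !mxE eqxx !andbT /F addr0; ring.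
have -> := @derive_val _ _ _ _ _ _ _ H.
rewrite sum_lt_antisym; last first.
  by move=> a b; rewrite /F gap_sym; ring.
rewrite /accel mulr_sumr -sumrN; apply: eq_bigr => b _; rewrite /F.
by rewrite mulrN !mulrA mulVf// mul1r.
Qed.

End Newton.

(** * Rings with an axial pair *)

Lemma sum2 (V : zmodType) (F : 'I_2 -> V) : \sum_i F i = F 0 + F 1.
Proof.
rewrite !big_ord_recr big_ord0 /= add0r.
by congr (F _ + F _); exact: val_inj.
Qed.

Lemma ord2P (P : 'I_2 -> Prop) : P 0 -> P 1 -> forall i, P i.
Proof.
move=> P0 P1 [[|[|//]] ik].
- by rewrite (_ : Ordinal ik = 0)//; exact: val_inj.
by rewrite (_ : Ordinal ik = 1)//; exact: val_inj.
Qed.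

Lemma polar (R : realType) (a b : R) : exists beta theta, a = beta * cos theta /\ b = beta * sin theta.
Proof.
pose r := Num.sqrt (a ^+ 2 + b ^+ 2).
have s0 : 0 <= a ^+ 2 + b ^+ 2 by rewrite addr_ge0// sqr_ge0.
have r2 : r ^+ 2 = a ^+ 2 + b ^+ 2 by rewrite sqr_sqrtr.
have [r0|r0] := eqVneq r 0.
  exists 0, 0; rewrite !mul0r; move: r2; rewrite r0 expr0n /= => /esym/eqP.
  by rewrite paddr_eq0 ?sqr_ge0// !sqrf_eq0 => /andP[/eqP-> /eqP->].
have rp : 0 < r by rewrite lt_def r0 sqrtr_ge0.
have q1 : (a / r) ^+ 2 <= 1.
  by rewrite expr_div_n ler_pdivrMr ?exprn_gt0// mul1r r2 lerDl sqr_ge0.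
have a1 : -1 <= a / r <= 1 by move: q1; set x := a / r => q1; apply/andP; split; nra.
have sE : sin (acos (a / r)) = `|b| / r.
  rewrite sin_acos//; apply/eqP.
  rewrite -(@eqrXn2 _ 2) ?sqrtr_ge0 ?divr_ge0 ?(ltW rp)// sqr_sqrtr ?subr_ge0//.
  rewrite !expr_div_n real_normK ?num_real//; apply/eqP.
  have -> : a ^+ 2 = r ^+ 2 - b ^+ 2 by rewrite r2 addrK.
  by field.
have [b0|b0] := leP 0 b.
  exists r, (acos (a / r)); rewrite acosK// sE ger0_norm//; split; field; exact: r0.
exists r, (- acos (a / r)); rewrite cosN sinN acosK// sE ltr0_norm//; split; field; exact: r0.
Qed.

Section RelativeEquilibria.
Variables (R : realType) (n : nat) (m : 'rV[R]_n) (c : 'M[R]_(n, 2)) (al : R).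
Local Notation M := (total_mass m).
Hypotheses (m_neq0 : forall i, m 0 i != 0) (al0 : al != 0) (M0 : M != 0).
Hypothesis c_free : collision_free c.
Hypothesis c_unit : forall i, c i 0 ^+ 2 + c i 1 ^+ 2 = 1.
Hypothesis c_com : forall k, \sum_j m 0 j * c j k = 0.
Hypothesis c_ae : forall i k, \sum_j m 0 j * (c i k - c j k) / gap c i j ^+ 3 = al * c i k.

Local Notation mm := (row_mx m (\row_(i < 3) [:: - al; 4 * al; 4 * al]`_i)).

(** The plane is identified with the complex numbers: the ring is c multiplied
    by x_0 + i x_1, and x_2 is the height of the axial pair. *)
Definition ring_pos (x : 'rV[R]_3) : 'M[R]_(n + 3, 3) :=
  \matrix_(i, k) match fintype.split i with
  | inl j => if k == 0 then x 0 0 * c j 0 - x 0 1 * c j 1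
             else if k == 1 then x 0 0 * c j 1 + x 0 1 * c j 0 else 0
  | inr j => if k == 2 then (if j == 1 then x 0 2 else if j == 2 then - x 0 2 else 0) else 0
  end.

Lemma ring_pos_l x j : [/\ ring_pos x (lshift 3 j) 0 = x 0 0 * c j 0 - x 0 1 * c j 1,
  ring_pos x (lshift 3 j) 1 = x 0 0 * c j 1 + x 0 1 * c j 0 & ring_pos x (lshift 3 j) 2 = 0].
Proof. by split; rewrite mxE (unsplitK (inl j)). Qed.

Lemma ring_pos_r x : [/\ forall k, ring_pos x (rshift n 0) k = 0,
  forall j, ring_pos x (rshift n j) 0 = 0, forall j, ring_pos x (rshift n j) 1 = 0,
  ring_pos x (rshift n 1) 2 = x 0 2 & ring_pos x (rshift n 2) 2 = - x 0 2].
Proof.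
by split=> [k|j|j||]; rewrite mxE ?(unsplitK (inr _))//=; case: ifP.
Qed.

Lemma ring_mass_l j : mm 0 (lshift 3 j) = m 0 j.
Proof. by rewrite row_mxEl. Qed.

Lemma ring_mass_r : [/\ mm 0 (rshift n 0) = - al, mm 0 (rshift n 1) = 4 * al & mm 0 (rshift n 2) = 4 * al].
Proof. by split; rewrite row_mxEr mxE. Qed.

Lemma ring_mass_neq0 i : mm 0 i != 0.
Proof.
rewrite -(fintype.splitK i); case: (fintype.split i) => j /=; first by rewrite ring_mass_l.
have [E0 E1 E2] := ring_mass_r; have al4 : 4 * al != 0 by rewrite mulf_neq0// pnatr_eq0.
by move: j; apply: ord3P; rewrite ?E0 ?E1 ?E2 ?oppr_eq0.
Qed.

Let wq (x : 'rV[R]_3) := x 0 0 ^+ 2 + x 0 1 ^+ 2.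

Lemma gap_ll x i j : gap (ring_pos x) (lshift 3 i) (lshift 3 j) = Num.sqrt (wq x) * gap c i j.
Proof.
have [A0 A1 A2] := ring_pos_l x i; have [B0 B1 B2] := ring_pos_l x j.
rewrite !gapE sum3 sum2 A0 A1 A2 B0 B1 B2 -sqrtrM; last by rewrite addr_ge0// sqr_ge0.
by congr Num.sqrt; rewrite /wq; ring.
Qed.

Lemma gap_l0 x i : gap (ring_pos x) (lshift 3 i) (rshift n 0) = Num.sqrt (wq x).
Proof.
have [A0 A1 A2] := ring_pos_l x i; have [B _ _ _ _] := ring_pos_r x.
rewrite gapE sum3 A0 A1 A2 !B; congr Num.sqrt; rewrite -[RHS]mulr1 -(c_unit i) /wq; ring.
Qed.

Lemma gap_l1 x i : gap (ring_pos x) (lshift 3 i) (rshift n 1) = Num.sqrt (wq x + x 0 2 ^+ 2).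
Proof.
have [A0 A1 A2] := ring_pos_l x i; have [B C D F G] := ring_pos_r x.
rewrite gapE sum3 A0 A1 A2 C D F; congr Num.sqrt; rewrite -[wq x]mulr1 -(c_unit i) /wq; ring.
Qed.

Lemma gap_l2 x i : gap (ring_pos x) (lshift 3 i) (rshift n 2) = Num.sqrt (wq x + x 0 2 ^+ 2).
Proof.
have [A0 A1 A2] := ring_pos_l x i; have [B C D F G] := ring_pos_r x.
rewrite gapE sum3 A0 A1 A2 C D G; congr Num.sqrt; rewrite -[wq x]mulr1 -(c_unit i) /wq; ring.
Qed.

Lemma gap_r x : [/\ gap (ring_pos x) (rshift n 0) (rshift n 1) = `|x 0 2|,
  gap (ring_pos x) (rshift n 0) (rshift n 2) = `|x 0 2| &
  gap (ring_pos x) (rshift n 1) (rshift n 2) = 2 * `|x 0 2|].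
Proof.
have [B C D F G] := ring_pos_r x.
rewrite !gapE !sum3 !C !D !B F G !subrr !expr0n /= !add0r opprK sqrrN.
rewrite (_ : x 0 2 + x 0 2 = 2 * x 0 2); last by ring.
by rewrite !sqrtr_sqr normrM (ger0_norm (ler0n R 2)).
Qed.

(** Pair the equilibrium equations with the positions; the unit circle enters
    through 2 c_i.(c_i - c_j) = |c_i - c_j|^2. *)
Lemma double_potential : \sum_i \sum_j m 0 i * m 0 j / gap c i j = 2 * al * M.
Proof.
(* the terms with i = j vanish on both sides, as the inverse of 0 is 0 *)
have E1 i j : m 0 i * m 0 j / gap c i j =
    2 * (\sum_k m 0 i * c i k * (m 0 j * (c i k - c j k) / gap c i j ^+ 3)).
  rewrite sum2; have g2 : gap c i j ^+ 2 = 2 * (c i 0 * (c i 0 - c j 0) + c i 1 * (c i 1 - c j 1)).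
    rewrite gapE sqr_sqrtr; last by apply: sumr_ge0 => k _; exact: sqr_ge0.
    rewrite sum2; have := c_unit i; have := c_unit j; set a := c i 0; set b := c i 1.
    set a' := c j 0; set b' := c j 1; move=> h1 h2.
    have -> : (a - a') ^+ 2 + (b - b') ^+ 2 =
      2 * (a * (a - a') + b * (b - b')) + (a' ^+ 2 + b' ^+ 2) - (a ^+ 2 + b ^+ 2) by ring.
    by rewrite h1 h2; ring.
  have [g0|g0] := eqVneq (gap c i j) 0.
    by rewrite g0 expr0n /= invr0 !mulr0 addr0 mulr0.
  have -> : (gap c i j)^-1 = gap c i j ^+ 2 / gap c i j ^+ 3 by field.
  by rewrite g2; ring.
under eq_bigr => i _ do (under eq_bigr do rewrite E1; rewrite -mulr_sumr exchange_big /=).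
rewrite -mulr_sumr -mulrA; congr (2 * _).
rewrite /total_mass mulr_sumr; apply: eq_bigr => i _.
under eq_bigr do rewrite -mulr_sumr c_ae.
by rewrite sum2 -[RHS]mulr1 -(c_unit i); ring.
Qed.

(** The ring, its central mass and the axial pair have potential
    (alpha M - alpha M) / |w| + 8 alpha M / rho, and the three masses on the axis
    contribute - 8 alpha^2 / |z| + 8 alpha^2 / |z|. *)
Lemma ring_potential x : 0 < wq x -> x 0 2 != 0 ->
  potential mm (ring_pos x) = 8 * al * M / Num.sqrt (wq x + x 0 2 ^+ 2).
Proof.
move=> w0 z0; pose F a b := mm 0 a * mm 0 b / gap (ring_pos x) a b.
have V2 : 2 * potential mm (ring_pos x) = \sum_a \sum_b F a b.
  rewrite sum_lt_sym//; first by move=> a b; rewrite /F gap_sym [mm 0 a * _]mulrC.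
  by move=> a; rewrite /F gap_diag invr0 mulr0.
have s0 : Num.sqrt (wq x) != 0 by rewrite gt_eqF// sqrtr_gt0.
have r0 : Num.sqrt (wq x + x 0 2 ^+ 2) != 0.
  by rewrite gt_eqF// sqrtr_gt0 ltr_wpDr// sqr_ge0.
have a0 : `|x 0 2| != 0 by rewrite normr_eq0.
have [m0 m1 m2] := ring_mass_r; have [g01 g02 g12] := gap_r x.
have LL : \sum_i \sum_j F (lshift 3 i) (lshift 3 j) = 2 * al * M / Num.sqrt (wq x).
  rewrite -double_potential mulr_suml; apply: eq_bigr => i _; rewrite mulr_suml.
  by apply: eq_bigr => j _; rewrite /F !ring_mass_l gap_ll invfM; ring.
set s := Num.sqrt (wq x) in s0 LL *; set r := Num.sqrt (_ + _) in r0 *.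
have LR : \sum_i \sum_j F (lshift 3 i) (rshift n j) = M * (8 * al / r - al / s).
  rewrite /total_mass mulr_suml; apply: eq_bigr => i _.
  by rewrite sum3 /F ring_mass_l m0 m1 m2 gap_l0 gap_l1 gap_l2 -/s -/r; ring.
have RL : \sum_i \sum_j F (rshift n i) (lshift 3 j) = M * (8 * al / r - al / s).
  rewrite exchange_big -LR; apply: eq_bigr => i _; apply: eq_bigr => j _.
  by rewrite /F gap_sym [mm 0 _ * _]mulrC.
have RR : \sum_i \sum_j F (rshift n i) (rshift n j) = 0.
  rewrite !sum3 /F !gap_diag m0 m1 m2.
  rewrite (gap_sym _ (rshift n 1) (rshift n 0)) (gap_sym _ (rshift n 2) (rshift n 0)).
  rewrite (gap_sym _ (rshift n 2) (rshift n 1)) g01 g02 g12 !invr0.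
  by field.
have : 2 * potential mm (ring_pos x) = 2 * (8 * al * M / r).
  rewrite V2 big_split_ord /=.
  under eq_bigr do rewrite big_split_ord /=.
  under [X in _ + X]eq_bigr do rewrite big_split_ord /=.
  rewrite !big_split /= LL LR RL RR; field; by rewrite s0 r0.
by move=> h; lra.
Qed.

(** By the equilibrium equations the ring feels the axial pair only, whose
    force is radial in the plane; by the centre of mass condition the force of
    the ring on the bodies of the axis is along the axis. *)
Lemma ring_accel x : 0 < wq x -> x 0 2 != 0 ->
  exists x', forall i k, accel mm (ring_pos x) i k = ring_pos x' i k.
Proof.
move=> w0 z0; have [m0 m1 m2] := ring_mass_r; have [g01 g02 g12] := gap_r x.
have s0 : Num.sqrt (wq x) != 0 by rewrite gt_eqF// sqrtr_gt0.
have r0 : Num.sqrt (wq x + x 0 2 ^+ 2) != 0.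
  by rewrite gt_eqF// sqrtr_gt0 ltr_wpDr// sqr_ge0.
have a0 : `|x 0 2| != 0 by rewrite normr_eq0.
set s := Num.sqrt (wq x) in s0 *; set r := Num.sqrt (wq x + _) in r0 *.
pose la := - (8 * al) / r ^+ 3.
pose mu := - (M * x 0 2 / r ^+ 3 - al * x 0 2 / `|x 0 2| ^+ 3 + 4 * al * (x 0 2 + x 0 2) / (2 * `|x 0 2|) ^+ 3).
pose x' : 'rV[R]_3 := \row_k (if k == 2 then mu else la * x 0 k).
have [E0 E1 E2] : [/\ x' 0 0 = la * x 0 0, x' 0 1 = la * x 0 1 & x' 0 2 = mu].
  by split; rewrite mxE.
exists x' => i; rewrite -(fintype.splitK i); case: (fintype.split i) => {}i /=.
  have [A0 A1 A2] := ring_pos_l x i; have [A0' A1' A2'] := ring_pos_l x' i.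
  have [B C D F G] := ring_pos_r x.
  have pc k k' y z : \sum_j m 0 j * (y * (c i k - c j k) + z * (c i k' - c j k')) / (s * gap c i j) ^+ 3 =
      (y * al * c i k + z * al * c i k') / s ^+ 3.
    rewrite -[y * al * _]mulrA -[z * al * _]mulrA -!c_ae !mulr_sumr -big_split mulr_suml.
    by apply: eq_bigr => j _; rewrite /= exprMn invfM; ring.
  apply: ord3P; rewrite /accel big_split_ord sum3 /= m0 m1 m2 gap_l0 gap_l1 gap_l2 -/s -/r.
  - rewrite A0 A0' !C E0 E1 (eq_bigr (fun j => m 0 j * (x 0 0 * (c i 0 - c j 0) + - x 0 1 * (c i 1 - c j 1)) / (s * gap c i j) ^+ 3)); last first.
      by move=> j _; have [-> _ _] := ring_pos_l x j; rewrite ring_mass_l gap_ll -/s; congr (_ * _ / _); ring.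
    by rewrite pc /la; field; rewrite s0 r0.
  - rewrite A1 A1' !D E0 E1 (eq_bigr (fun j => m 0 j * (x 0 0 * (c i 1 - c j 1) + x 0 1 * (c i 0 - c j 0)) / (s * gap c i j) ^+ 3)); last first.
      by move=> j _; have [_ -> _] := ring_pos_l x j; rewrite ring_mass_l gap_ll -/s; congr (_ * _ / _); ring.
    by rewrite pc /la; field; rewrite s0 r0.
  rewrite A2 A2' B F G big1 => [|j _]; last by have [_ _ ->] := ring_pos_l x j; rewrite subrr mulr0 mul0r.
  by field; rewrite r0.
have [B C D F G] := ring_pos_r x; have [B' C' D' F' G'] := ring_pos_r x'.
have com0 t : \sum_j m 0 j * (0 - ring_pos x (lshift 3 j) 0) / t = 0.
  rewrite (eq_bigr (fun j => - (x 0 0 / t) * (m 0 j * c j 0) + (x 0 1 / t) * (m 0 j * c j 1))).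
    by rewrite big_split /= -!mulr_sumr !c_com !mulr0 addr0.
  by move=> j _; have [-> _ _] := ring_pos_l x j; ring.
have com1 t : \sum_j m 0 j * (0 - ring_pos x (lshift 3 j) 1) / t = 0.
  rewrite (eq_bigr (fun j => - (x 0 0 / t) * (m 0 j * c j 1) - (x 0 1 / t) * (m 0 j * c j 0))).
    by rewrite sumrB /= -!mulr_sumr !c_com !mulr0 subr0.
  by move=> j _; have [_ -> _] := ring_pos_l x j; ring.
have gs (a b : 'I_(n + 3)) (t : R) : gap (ring_pos x) a b = t -> gap (ring_pos x) b a = t by rewrite gap_sym.
have sumL (j : 'I_3) t k : (forall i, gap (ring_pos x) (rshift n j) (lshift 3 i) = t) ->
    \sum_(i < n) mm 0 (lshift 3 i) * (ring_pos x (rshift n j) k - ring_pos x (lshift 3 i) k) /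
      gap (ring_pos x) (rshift n j) (lshift 3 i) ^+ 3 =
    \sum_(i < n) m 0 i * (ring_pos x (rshift n j) k - ring_pos x (lshift 3 i) k) / t ^+ 3.
  by move=> H; apply: eq_bigr => l _; rewrite ring_mass_l H.
have sum2z z t : \sum_(i < n) m 0 i * (z - ring_pos x (lshift 3 i) 2) / t = M * z / t.
  rewrite /total_mass !mulr_suml; apply: eq_bigr => l _.
  by have [_ _ ->] := ring_pos_l x l; rewrite subr0.
move: i; apply: ord3P => k; rewrite /accel big_split_ord sum3 /= m0 m1 m2.
- rewrite (sumL 0 s k); last by move=> l; apply: gs; rewrite gap_l0.
  rewrite g01 g02 B'; move: k; apply: ord3P.
  + by rewrite !C com0; ring.
  + by rewrite !D com1; ring.
  by rewrite !B F G sum2z; ring.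
- rewrite (sumL 1 r k); last by move=> l; apply: gs; rewrite gap_l1.
  rewrite (gs _ _ _ g01) g12 gap_diag; move: k; apply: ord3P.
  + by rewrite !C C' com0; ring.
  + by rewrite !D D' com1; ring.
  by rewrite F F' B G sum2z E2 /mu; ring.
rewrite (sumL 2 r k); last by move=> l; apply: gs; rewrite gap_l2.
rewrite (gs _ _ _ g02) (gs _ _ _ g12) gap_diag; move: k; apply: ord3P.
+ by rewrite !C C' com0; ring.
+ by rewrite !D D' com1; ring.
by rewrite G G' B F sum2z E2 /mu; ring.
Qed.

End RelativeEquilibria.

(** * Reduction of the ring problem *)

Lemma diag_invmx (R : realType) n (d : 'rV[R]_n) : (forall i, d 0 i != 0) ->
  diag_mx d \in unitmx /\ invmx (diag_mx d) = diag_mx (\row_i (d 0 i)^-1).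
Proof.
move=> d0; have H : diag_mx d *m diag_mx (\row_i (d 0 i)^-1) = 1%:M.
  rewrite mulmx_diag; apply/matrixP => i j; rewrite !mxE.
  by case: eqP => // _; rewrite divff.
have [U _] := mulmx1_unit H; split=> //.
by rewrite -[LHS]mulmx1 -H mulmxA mulVmx// mul1mx.
Qed.

Lemma diag_quad (R : realType) n (p d : 'rV[R]_n) :
  (p *m diag_mx d *m p^T) 0 0 = \sum_i d 0 i * p 0 i ^+ 2.
Proof.
rewrite mxE; apply: eq_bigr => i _; rewrite mul_mx_diag !mxE; ring.
Qed.

Section RelativeEquilibria.
Variables (R : realType) (n : nat) (m : 'rV[R]_n) (c : 'M[R]_(n, 2)) (al : R).
Local Notation M := (total_mass m).
Hypotheses (m_neq0 : forall i, m 0 i != 0) (al0 : al != 0) (M0 : M != 0).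
Hypothesis c_free : collision_free c.
Hypothesis c_unit : forall i, c i 0 ^+ 2 + c i 1 ^+ 2 = 1.
Hypothesis c_com : forall k, \sum_j m 0 j * c j k = 0.
Hypothesis c_ae : forall i k, \sum_j m 0 j * (c i k - c j k) / gap c i j ^+ 3 = al * c i k.

Local Notation mm := (row_mx m (\row_(i < 3) [:: - al; 4 * al; 4 * al]`_i)).
Local Notation ring_pos := (ring_pos c).

Definition ring_frame (a : 'I_3) : 'M[R]_(n + 3, 3) := ring_pos (delta_mx 0 a).

Lemma lincomb_ring_frame x : lincomb ring_frame x = ring_pos x.
Proof.
apply/matrixP => i k; rewrite /lincomb summxE sum3 /ring_frame !mxE.
case: (fintype.split i) => j; rewrite /=.
  by case: ifP => _; first ring; case: ifP => _; ring.
by case: ifP => _; last ring; case: ifP => _; first ring; case: ifP => _; ring.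
Qed.

Lemma some_body : exists i : 'I_n, True.
Proof.
have [//|nex] := pselect (exists i : 'I_n, True); case/negP: M0.
by rewrite /total_mass big1// => i _; case: nex; exists i.
Qed.

Lemma sumsq_eq0 (a b : R) : a ^+ 2 + b ^+ 2 = 0 -> a = 0 /\ b = 0.
Proof. by move/eqP; rewrite paddr_eq0 ?sqr_ge0// !sqrf_eq0 => /andP[/eqP-> /eqP->]. Qed.

Lemma ring_pos_inj : injective ring_pos.
Proof.
move=> x y xy; have [i _] := some_body.
have [A0 A1 _] := ring_pos_l c x i; have [B0 B1 _] := ring_pos_l c y i.
have [_ _ _ A2 _] := ring_pos_r c x; have [_ _ _ B2 _] := ring_pos_r c y.
rewrite xy B0 in A0; rewrite xy B1 in A1.
have [h0 h1] : x 0 0 - y 0 0 = 0 /\ x 0 1 - y 0 1 = 0.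
  apply: sumsq_eq0.
  rewrite -[LHS]mulr1 -(c_unit i).
  have -> : ((x 0 0 - y 0 0) ^+ 2 + (x 0 1 - y 0 1) ^+ 2) * (c i 0 ^+ 2 + c i 1 ^+ 2) =
    ((x 0 0 * c i 0 - x 0 1 * c i 1) - (y 0 0 * c i 0 - y 0 1 * c i 1)) ^+ 2 +
    ((x 0 0 * c i 1 + x 0 1 * c i 0) - (y 0 0 * c i 1 + y 0 1 * c i 0)) ^+ 2 by ring.
  by rewrite A0 A1 !subrr expr0n addr0.
apply/rowP; apply: ord3P; first by apply/eqP; rewrite -subr_eq0 h0.
  by apply/eqP; rewrite -subr_eq0 h1.
by rewrite -A2 xy B2.
Qed.

Lemma row_eqE N d (q : 'M[R]_(N, d)) i j : row i q = row j q -> forall k, q i k = q j k.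
Proof. by move=> /rowP H k; have := H k; rewrite !mxE. Qed.

Lemma ring_collision_free x :
  collision_free (ring_pos x) <-> 0 < x 0 0 ^+ 2 + x 0 1 ^+ 2 /\ x 0 2 != 0.
Proof.
have [i0 _] := some_body; have [B C D F G] := ring_pos_r c x; split=> [cf|[w0 z0]].
  split.
    rewrite lt_def addr_ge0 ?sqr_ge0// andbT.
    have := cf (lshift 3 i0) (rshift n 0); rewrite eq_lrshift => /(_ isT).
    apply: contraNneq => /sumsq_eq0[x0 x1]; apply/eqP/rowP => k; rewrite ![row _ _ _ _]mxE B.
    have [A0 A1 A2] := ring_pos_l c x i0; move: k; apply: ord3P => //.
      by rewrite A0 x0 x1 !mul0r subrr.
    by rewrite A1 x0 x1 !mul0r addr0.
  have := cf (rshift n 1) (rshift n 0); rewrite eq_rshift => /(_ isT).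
  apply: contraNneq => x2; apply/eqP/rowP => k; rewrite ![row _ _ _ _]mxE B.
  by move: k; apply: ord3P; rewrite ?C ?D ?F.
have LR i j : row (lshift 3 i) (ring_pos x) != row (rshift n j) (ring_pos x).
  have [A0 A1 A2] := ring_pos_l c x i; move: j; apply: ord3P; apply/eqP => /row_eqE H.
  - have := H 0; have := H 1; rewrite A0 A1 !B => h1 h0; move: w0.
    rewrite -[X in _ < X]mulr1 -(c_unit i).
    have -> : (x 0 0 ^+ 2 + x 0 1 ^+ 2) * (c i 0 ^+ 2 + c i 1 ^+ 2) =
      (x 0 0 * c i 0 - x 0 1 * c i 1) ^+ 2 + (x 0 0 * c i 1 + x 0 1 * c i 0) ^+ 2 by ring.
    by rewrite h0 h1 expr0n addr0 ltxx.
  - by have := H 2; rewrite A2 F => h; rewrite -h eqxx in z0.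
  by have := H 2; rewrite A2 G => h; move: z0; rewrite -oppr_eq0 -h eqxx.
move=> i j; rewrite -(fintype.splitK i) -(fintype.splitK j).
case: (fintype.split i) => {}i; case: (fintype.split j) => {}j /=.
- rewrite eq_lshift => ij; apply/eqP => /row_eqE H.
  have := c_free ij; move/eqP; apply.
  have := H 0; have := H 1; have [-> -> _] := ring_pos_l c x i; have [-> -> _] := ring_pos_l c x j.
  move=> h1 h0; have [|a b] := @sumsq_eq0 (c i 0 - c j 0) (c i 1 - c j 1).
    apply: (mulfI (lt0r_neq0 w0)); rewrite mulr0.
    have -> : (x 0 0 ^+ 2 + x 0 1 ^+ 2) * ((c i 0 - c j 0) ^+ 2 + (c i 1 - c j 1) ^+ 2) =
      ((x 0 0 * c i 0 - x 0 1 * c i 1) - (x 0 0 * c j 0 - x 0 1 * c j 1)) ^+ 2 +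
      ((x 0 0 * c i 1 + x 0 1 * c i 0) - (x 0 0 * c j 1 + x 0 1 * c j 0)) ^+ 2 by ring.
    by rewrite h0 h1 !subrr expr0n addr0.
  by apply/rowP => k; rewrite !mxE; apply/eqP; rewrite -subr_eq0; move: k; apply: ord2P; rewrite ?a ?b.
- by move=> _; exact: LR.
- by move=> _; rewrite eq_sym; exact: LR.
rewrite eq_rshift => ij; apply/eqP => /row_eqE/(_ 2)/eqP; apply/negP.
move: ij; have z2 : x 0 2 != - x 0 2 by apply: contra_neq z0 => h; lra.
have nz : - x 0 2 != 0 by rewrite oppr_eq0.
pose t (k : 'I_3) := ring_pos x (rshift n k) 2; rewrite -/(t i) -/(t j).
have [t0 t1 t2] : [/\ t 0 = 0, t 1 = x 0 2 & t 2 = - x 0 2] by rewrite /t B F G.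
clearbody t; clear -t0 t1 t2 z0 z2 nz; move: i j.
apply: ord3P; apply: ord3P; rewrite ?t0 ?t1 ?t2 ?eqxx// => _; rewrite eq_sym //.
Qed.

Definition ring_space : set 'M[R]_(n + 3, 3) :=
  [set q : 'M[R]_(n + 3, 3) |
          [/\ [/\ q (rshift n 0) 0 = 0, q (rshift n 0) 1 = 0 & q (rshift n 0) 2 = 0],
              q (rshift n 1) 0 = 0 /\ q (rshift n 1) 1 = 0,
              q (rshift n 2) 0 = 0 /\ q (rshift n 2) 1 = 0,
              q (rshift n 1) 2 + q (rshift n 2) 2 = 0
            & (forall i : 'I_n, q (lshift 3 i) 2 = 0) /\
              exists beta theta : R, forall i : 'I_n,
                q (lshift 3 i) 0 = beta * (c *m (rotation theta)^T) i 0 /\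
                q (lshift 3 i) 1 = beta * (c *m (rotation theta)^T) i 1]].

Lemma rotationE theta i : (c *m (rotation theta)^T) i 0 = c i 0 * cos theta - c i 1 * sin theta /\
  (c *m (rotation theta)^T) i 1 = c i 0 * sin theta + c i 1 * cos theta.
Proof. by split; rewrite mxE sum2 !mxE /= ?mulrN. Qed.

Lemma range_ring_pos : range ring_pos = ring_space.
Proof.
apply/seteqP; split=> [_ [x _ <-]|q [[q00 q01 q02] [q10 q11] [q20 q21] q3 [ql [beta [theta Hq]]]]].
  have [B C D F G] := ring_pos_r c x; rewrite /ring_space /=; split=> //.
    by rewrite F G subrr.
  split; first by move=> i; have [_ _ ->] := ring_pos_l c x i.
  have [beta [theta [xb xt]]] := polar (x 0 0) (x 0 1).
  exists beta, theta => i; have [-> -> _] := ring_pos_l c x i; have [-> ->] := rotationE theta i.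
  by rewrite xb xt; split; ring.
pose x : 'rV[R]_3 := \row_k (if k == 0 then beta * cos theta else
  if k == 1 then beta * sin theta else q (rshift n 1) 2).
have [E0 E1 E2] : [/\ x 0 0 = beta * cos theta, x 0 1 = beta * sin theta & x 0 2 = q (rshift n 1) 2].
  by split; rewrite mxE.
exists x => //; have [B C D F G] := ring_pos_r c x.
apply/matrixP => i; rewrite -(fintype.splitK i); case: (fintype.split i) => {}i /=.
  have [A0 A1 A2] := ring_pos_l c x i; have [h0 h1] := Hq i; have [r0 r1] := rotationE theta i.
  apply: ord3P; rewrite ?A0 ?A1 ?A2 ?E0 ?E1 ?h0 ?h1 ?r0 ?r1 ?ql//; ring.
move: i; apply: ord3P; apply: ord3P; rewrite ?B ?C ?D ?F ?G ?E2//.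
by apply/eqP; rewrite eq_sym -addr_eq0 addrC q3.
Qed.

Lemma kinetic_ring_frame : kinetic_matrix mm ring_frame = diag_mx (\row_k (if k == 2 then 8 * al else M)).
Proof.
have [m0 m1 m2] := ring_mass_r m al.
have pd (a b : 'I_3) : \sum_(i < n + 3) mm 0 i * (\sum_(l < 3) ring_frame a i l * ring_frame b i l) =
    \sum_(i < n) m 0 i * ((delta_mx 0 a : 'rV[R]_3) 0 0 * (delta_mx 0 b : 'rV[R]_3) 0 0 +
        (delta_mx 0 a : 'rV[R]_3) 0 1 * (delta_mx 0 b : 'rV[R]_3) 0 1) +
    8 * al * (delta_mx 0 a : 'rV[R]_3) 0 2 * (delta_mx 0 b : 'rV[R]_3) 0 2.
  rewrite big_split_ord /= sum3 m0 m1 m2; congr (_ + _).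
    apply: eq_bigr => i _; rewrite ring_mass_l sum3 /ring_frame.
    have [-> -> ->] := ring_pos_l c (delta_mx 0 a) i; have [-> -> ->] := ring_pos_l c (delta_mx 0 b) i.
    by rewrite -[X in _ = _ * X]mulr1 -(c_unit i); ring.
  rewrite !sum3 /ring_frame.
  have [B C D F G] := ring_pos_r c (delta_mx 0 a); have [B' C' D' F' G'] := ring_pos_r c (delta_mx 0 b).
  by rewrite !C !D !B F F' G G'; ring.
apply/matrixP => a b; rewrite mxE pd -mulr_suml -/(total_mass m).
by rewrite !mxE; move: a b; apply: ord3P; apply: ord3P; rewrite /=; ring.
Qed.

Theorem ring_integrable : restriction_integrable mm ring_space.
Proof.
exists 3, ring_frame; have [m0 m1 m2] := ring_mass_r m al.
have al8 : 8 * al != 0 by rewrite mulf_neq0// pnatr_eq0.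
have d0 (i : 'I_3) : (\row_(k < 3) (if k == 2 then 8 * al else M)) 0 i != 0 :> R by rewrite mxE; case: ifP.
have [Ku Ki] := diag_invmx d0; rewrite -kinetic_ring_frame in Ku Ki.
have lfE : lincomb ring_frame = ring_pos by apply/funext => x; exact: lincomb_ring_frame.
have psE : phase_space ring_frame = @Dred R.
  by apply/seteqP; split=> z; rewrite /phase_space /= lfE => /ring_collision_free.
split=> //.
- by split; rewrite lfE; [exact: ring_pos_inj|exact: range_ring_pos].
- move=> q; rewrite -range_ring_pos => -[x _ <-] cf.
  have [w0 z0] := (ring_collision_free x).1 cf.
  have [x' Hx'] := ring_accel c_unit c_com c_ae w0 z0.
  exists x' => //; apply/matrixP => i k.
  by rewrite scaled_gradientE ?Hx'//; exact: ring_mass_neq0.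
rewrite psE; apply: (liouville_ext (@open_Dred R) _ (reduced_integrable M0 al0)) => z [w0 z0].
rewrite /restricted_hamiltonian lfE ring_potential// Ki diag_quad sum3 !mxE /= /hred.
congr (_ + _); rewrite -?/(total_mass m); field; rewrite ?M0 ?al0//.
Qed.

End RelativeEquilibria.

Theorem circular_configuration_integrable (R : realType) (n : nat) (m : 'rV[R]_n) (c : 'M[R]_(n, 2)) (alpha : R) :
     (forall i, m 0 i != 0) ->
     alpha != 0 ->
     central_configuration m c ->
     (forall i, enorm (row i c) = 1) ->
     total_mass m != 0 ->
     center_of_mass m c = 0 ->
     absolute_equilibrium (row_mx m (const_mx (- alpha)) : 'rV[R]_(n + 1))
                          (col_mx c 0 : 'M[R]_(n + 1, 2)) ->
     restriction_integrable
       (row_mx m (\row_(i < 3) [:: - alpha; 4 * alpha; 4 * alpha]`_i)) (ring_space c).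
Proof.
move=> m0 al0 [a0 [cfree _]] c1 M0 com [cf [g ae]].
have cu i : c i 0 ^+ 2 + c i 1 ^+ 2 = 1.
  have := c1 i; rewrite /enorm sum2 !mxE => h.
  by rewrite -[LHS]sqr_sqrtr ?h ?expr1n// addr_ge0 ?sqr_ge0.
apply: ring_integrable => //.
  move=> k; move/eqP: com; rewrite scaler_eq0 invr_eq0 (negbTE M0) /= => /eqP/matrixP/(_ 0 k).
  by rewrite !mxE.
move=> i k; set q := col_mx c 0 in cf ae; set m' := row_mx m _ in ae.
have mi : m' 0 (lshift 1 i) != 0 by rewrite /m' row_mxEl.
have := ae (lshift 1 i); rewrite scale0r => /rowP/(_ k); rewrite mxE scaled_gradientE// mxE /accel.
have gl j : gap q (lshift 1 i) (lshift 1 j) = gap c i j.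
  by rewrite !gapE; congr Num.sqrt; apply: eq_bigr => l _; rewrite /q !col_mxEu.
have gr : gap q (lshift 1 i) (rshift n 0) = 1.
  rewrite gapE sum2 /q !col_mxEu !col_mxEd !mxE !subr0 cu; exact: sqrtr1.
rewrite big_split_ord big_ord1 /= gr expr1n divr1 /m' row_mxEr /q col_mxEu col_mxEd !mxE subr0.
under eq_bigr do rewrite row_mxEl col_mxEu.
move/eqP; rewrite oppr_eq0 mulNr subr_eq0 => /eqP <-.
by apply: eq_bigr => j _; rewrite -gl.
Qed.

(** * Two uncoupled planar Kepler problems *)

Lemma sum4 (V : zmodType) (F : 'I_4 -> V) : \sum_i F i = F 0 + F 1 + F 2 + F 3.
Proof.
rewrite !big_ord_recr big_ord0 /= add0r.
by congr (F _ + F _ + F _ + F _); exact: val_inj.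
Qed.

Lemma sum5 (V : zmodType) (F : 'I_5 -> V) : \sum_i F i = F 0 + F 1 + F 2 + F 3 + F 4.
Proof.
rewrite !big_ord_recr big_ord0 /= add0r.
by congr (F _ + F _ + F _ + F _ + F _); exact: val_inj.
Qed.

Lemma ord4P (P : 'I_4 -> Prop) : P 0 -> P 1 -> P 2 -> P 3 -> forall i, P i.
Proof.
move=> P0 P1 P2 P3 [[|[|[|[|//]]]] ik].
- by rewrite (_ : Ordinal ik = 0)//; exact: val_inj.
- by rewrite (_ : Ordinal ik = 1)//; exact: val_inj.
- by rewrite (_ : Ordinal ik = 2)//; exact: val_inj.
by rewrite (_ : Ordinal ik = 3)//; exact: val_inj.
Qed.

Lemma ord5P (P : 'I_5 -> Prop) : P 0 -> P 1 -> P 2 -> P 3 -> P 4 -> forall i, P i.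
Proof.
move=> P0 P1 P2 P3 P4 [[|[|[|[|[|//]]]]] ik].
- by rewrite (_ : Ordinal ik = 0)//; exact: val_inj.
- by rewrite (_ : Ordinal ik = 1)//; exact: val_inj.
- by rewrite (_ : Ordinal ik = 2)//; exact: val_inj.
- by rewrite (_ : Ordinal ik = 3)//; exact: val_inj.
by rewrite (_ : Ordinal ik = 4)//; exact: val_inj.
Qed.

Section TwoKepler.
Variable R : realType.
Local Notation E := ('rV[R]_4 * 'rV[R]_4)%type.
Implicit Types (z v : E) (a b : 'I_4).

Definition sqn a b z : R := z.1 0 a ^+ 2 + z.1 0 b ^+ 2.
Definition kep a b z : R := (z.2 0 a ^+ 2 + z.2 0 b ^+ 2) / 8 + (Num.sqrt (sqn a b z))^-1.
Definition ang a b z : R := z.1 0 a * z.2 0 b - z.1 0 b * z.2 0 a.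
Definition dkep a b z v : R := (z.2 0 a * v.2 0 a + z.2 0 b * v.2 0 b) / 4 -
  (z.1 0 a * v.1 0 a + z.1 0 b * v.1 0 b) / Num.sqrt (sqn a b z) ^+ 3.
Definition dang a b z v : R :=
  v.1 0 a * z.2 0 b + z.1 0 a * v.2 0 b - v.1 0 b * z.2 0 a - z.1 0 b * v.2 0 a.

Definition kdom a b : set E := [set z | 0 < sqn a b z].

Let oT : open [set: E] := openT.

Lemma class_C_sqn r (D : set E) a b : open D -> class_C r D (sqn a b).
Proof. by move=> oD; apply: class_CD => //; apply: class_CX => //; exact: class_C_q. Qed.

Lemma open_kdom a b : open (kdom a b).
Proof. by apply: open_gt0; exact: class_C_sqn. Qed.

Lemma class_C_kep r a b : class_C r (kdom a b) (kep a b).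
Proof.
have oD : open (kdom a b) by exact: open_kdom.
have Cp i : class_C r (kdom a b) (fun z : E => z.2 0 i ^+ 2) by apply: class_CX => //; exact: class_C_p.
apply: class_CD => //.
  by apply: class_CM => //; [exact: class_CD|exact: class_C_cst].
apply: class_CV => //; first by move=> z z0; rewrite gt_eqF// sqrtr_gt0.
apply: (@class_C_comp_real R E r (kdom a b) [set x | 0 < x] Num.sqrt) => //.
  exact: class_C_sqn.
exact: class_C_sqrt.
Qed.

Lemma class_C_ang r (D : set E) a b : open D -> class_C r D (ang a b).
Proof.
move=> oD.
have Cp i : class_C r D (fun z : E => z.2 0 i) by exact: class_C_p.
have Cq i : class_C r D (fun z : E => z.1 0 i) by exact: class_C_q.
by apply: class_CB => //; exact: class_CM.
Qed.

Lemma is_derive_kep a b z v : kdom a b z -> is_derive z v (kep a b) (dkep a b z v).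
Proof.
move=> z0; have s0 : Num.sqrt (sqn a b z) != 0 by rewrite gt_eqF// sqrtr_gt0.
have Dp i := is_derive_exp 2 (is_derive_p z v i).
have Dq i := is_derive_exp 2 (is_derive_q z v i).
have D2 := is_derive_add (Dq a) (Dq b).
have df : differentiable (sqn a b) z.
  by apply: (@class_C_differentiable R E 0 setT) => //; exact: class_C_sqn.
have Ds : is_derive (sqn a b z) (1 : R) Num.sqrt (2 * Num.sqrt (sqn a b z))^-1.
  exact: is_derive1_sqrt z0.
have Dr := @is_derive_comp_real R E Num.sqrt (sqn a b) z v _ _ Ds df D2.
have H := is_derive_add (is_derive_scale 8^-1 (is_derive_add (Dp a) (Dp b)))
  (@is_derive_inv R E (fun z => Num.sqrt (sqn a b z)) z v _ s0 Dr).
rewrite (_ : kep a b = fun y : E => 8^-1 * (y.2 0 a ^+ 2 + y.2 0 b ^+ 2) + (Num.sqrt (sqn a b y))^-1).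
  by apply: (is_derive_eq H); rewrite /dkep /=; field; exact: s0.
by apply/funext => y; rewrite /kep mulrC.
Qed.

Lemma is_derive_ang a b z v : is_derive z v (ang a b) (dang a b z v).
Proof.
have Dp i := is_derive_p z v i; have Dq i := is_derive_q z v i.
apply: (is_derive_eq (is_derive_sub (is_derive_mul (Dq a) (Dp b)) (is_derive_mul (Dq b) (Dp a)))).
by rewrite /dang; ring.
Qed.

Lemma poissonD (F G G' : E -> R) z : differentiable G z -> differentiable G' z ->
  poisson F (fun y => G y + G' y) z = poisson F G z + poisson F G' z.
Proof.
move=> dG dG'; rewrite /poisson -big_split; apply: eq_bigr => i _ /=.
have DD v : 'D_v (fun y => G y + G' y) z = 'D_v G z + 'D_v G' z.
  have [_ ->] := is_derive_add (is_derive_diff v dG) (is_derive_diff v dG').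
  by rewrite !deriveE.
have alg (a b b' c d d' : R) : a * (b + b') - c * (d + d') = a * b - c * d + (a * b' - c * d') by ring.
by rewrite !DD; exact: alg.
Qed.

Definition family4 (A B C D : E -> R) (i : 'I_4) : E -> R :=
  match val i with 0%N => A | 1%N => B | 2%N => C | _ => D end.

Lemma involution4 (A B C D : E -> R) z :
  poisson A B z = 0 -> poisson A C z = 0 -> poisson A D z = 0 ->
  poisson B C z = 0 -> poisson B D z = 0 -> poisson C D z = 0 ->
  forall i j, poisson (family4 A B C D i) (family4 A B C D j) z = 0.
Proof.
move=> AB AC AD BC BD CD.
have opp_fix (r : R) : r = - r -> r = 0 by lra.
have self (F : E -> R) : poisson F F z = 0 by apply: opp_fix; exact: poisson_antisym.
have flip (F G : E -> R) : poisson F G z = 0 -> poisson G F z = 0.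
  by move=> h; rewrite poisson_antisym h oppr0.
apply: ord4P; apply: ord4P;
  [exact: self|exact: AB|exact: AC|exact: AD|exact: flip|exact: self|exact: BC|exact: BD
  |exact: flip|exact: flip|exact: self|exact: CD|exact: flip|exact: flip|exact: flip|exact: self].
Qed.

(** The coordinates 0, 1 form a vector s and 2, 3 a vector t; for the five
    bodies, collisions occur at s = 0, t = 0, s + t = 0 and t = s. *)
Definition two_kepler_domain : set E :=
  [set z | [/\ 0 < sqn 0 1 z, 0 < sqn 2 3 z,
    0 < (z.1 0 0 + z.1 0 2) ^+ 2 + (z.1 0 1 + z.1 0 3) ^+ 2 &
    0 < (z.1 0 2 - z.1 0 0) ^+ 2 + (z.1 0 3 - z.1 0 1) ^+ 2]].

Definition two_kepler_energy z : R := kep 0 1 z + kep 2 3 z.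

Lemma open_two_kepler_domain : open two_kepler_domain.
Proof.
have Cq i : class_C 0 setT (fun z : E => z.1 0 i) by exact: class_C_q.
have -> : two_kepler_domain = kdom 0 1 `&` kdom 2 3 `&`
  [set z : E | 0 < (z.1 0 0 + z.1 0 2) ^+ 2 + (z.1 0 1 + z.1 0 3) ^+ 2] `&`
  [set z : E | 0 < (z.1 0 2 - z.1 0 0) ^+ 2 + (z.1 0 3 - z.1 0 1) ^+ 2].
  by apply/seteqP; split=> z [] => [? ? ? ?|[[? ?] ?] ?].
do !apply: openI; try exact: open_kdom; apply: open_gt0.
  by apply: class_CD => //; apply: class_CX => //; exact: class_CD.
by apply: class_CD => //; apply: class_CX => //; exact: class_CB.
Qed.

(** Where s.p_s and t.p_t do not vanish, moving p_s along s changes the first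
    energy only, and moving it across s changes the first angular momentum;
    adding small multiples of s and t to the momenta leads to such points. *)
Theorem two_kepler_integrable : liouville_integrable two_kepler_domain two_kepler_energy.
Proof.
have oD := open_two_kepler_domain.
have sub01 : two_kepler_domain `<=` kdom 0 1 by move=> z [].
have sub23 : two_kepler_domain `<=` kdom 2 3 by move=> z [].
have CK1 r : class_C r two_kepler_domain (kep 0 1) by apply: class_C_sub (class_C_kep r 0 1).
have CK2 r : class_C r two_kepler_domain (kep 2 3) by apply: class_C_sub (class_C_kep r 2 3).
have CL a b r : class_C r two_kepler_domain (ang a b) by exact: class_C_ang.
have dK1 z : two_kepler_domain z -> differentiable (kep 0 1) z by exact: class_C_differentiable (CK1 1%N).
have dK2 z : two_kepler_domain z -> differentiable (kep 2 3) z by exact: class_C_differentiable (CK2 1%N).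
have dL a b z : two_kepler_domain z -> differentiable (ang a b) z by exact: class_C_differentiable (CL a b 1%N).
have K1E z v : two_kepler_domain z -> 'D_v (kep 0 1) z = dkep 0 1 z v.
  by move=> /sub01 Dz; have [_ ->] := is_derive_kep v Dz.
have K2E z v : two_kepler_domain z -> 'D_v (kep 2 3) z = dkep 2 3 z v.
  by move=> /sub23 Dz; have [_ ->] := is_derive_kep v Dz.
have LE a b z v : 'D_v (ang a b) z = dang a b z v.
  by have [_ ->] := is_derive_ang a b z v.
have K1K2 z : two_kepler_domain z -> poisson (kep 0 1) (kep 2 3) z = 0.
  by move=> Dz; rewrite /poisson sum4 !K1E// !K2E// /dkep /= !mxE /=; ring.
have K1L1 z : two_kepler_domain z -> poisson (kep 0 1) (ang 0 1) z = 0.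
  by move=> Dz; rewrite /poisson sum4 !K1E// !LE// /dkep /dang /= !mxE /=; ring.
have K1L2 z : two_kepler_domain z -> poisson (kep 0 1) (ang 2 3) z = 0.
  by move=> Dz; rewrite /poisson sum4 !K1E// !LE// /dkep /dang /= !mxE /=; ring.
have K2L1 z : two_kepler_domain z -> poisson (kep 2 3) (ang 0 1) z = 0.
  by move=> Dz; rewrite /poisson sum4 !K2E// !LE// /dkep /dang /= !mxE /=; ring.
have K2L2 z : two_kepler_domain z -> poisson (kep 2 3) (ang 2 3) z = 0.
  by move=> Dz; rewrite /poisson sum4 !K2E// !LE// /dkep /dang /= !mxE /=; ring.
have L1L2 z : poisson (ang 0 1) (ang 2 3) z = 0.
  by rewrite /poisson sum4 !LE// /dang /= !mxE /=; ring.
pose F := family4 (kep 0 1) (ang 0 1) (kep 2 3) (ang 2 3).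
have FF i j z : two_kepler_domain z -> poisson (F i) (F j) z = 0.
  move=> Dz; apply: involution4; [exact: K1L1|exact: K1K2|exact: K1L2| |exact: L1L2|exact: K2L2].
  by rewrite poisson_antisym K2L1// oppr0.
exists F; split=> //.
- by apply: ord4P => r; rewrite /F /=; do ?[exact: CK1|exact: CK2|exact: CL].
- move=> j z Dz; rewrite /two_kepler_energy poissonD; [|exact: dK1|exact: dK2].
  by rewrite (FF j 0)// (FF j 2)// addr0.
apply: dense_closure => z e Dz e0.
have [s0 t0 st0 ts0] := Dz; have s0' : sqn 0 1 z != 0 by rewrite gt_eqF.
have t0' : sqn 2 3 z != 0 by rewrite gt_eqF.
pose dot a b (y : E) : R := y.1 0 a * y.2 0 a + y.1 0 b * y.2 0 b.
have d1 : 0 < `|z.1| + 1 by rewrite ltr_wpDl.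
near (0 : R)^'+ => t.
have tp : 0 < t by near: t; exact: nbhs_right_gt.
have t1 : t != - dot 0 1 z / sqn 0 1 z by near: t; exact: near_right_neq.
have t2 : t != - dot 2 3 z / sqn 2 3 z by near: t; exact: near_right_neq.
have te : t < e / (`|z.1| + 1) by near: t; apply: nbhs_right_lt; exact: divr_gt0.
pose x : E := (z.1, z.2 + t *: z.1).
have dE a b : dot a b x = dot a b z + t * sqn a b z by rewrite /dot /sqn !mxE /=; ring.
have n1 : dot 0 1 x != 0.
  by apply: contraNneq t1; rewrite dE => h; apply/eqP/(mulIf s0'); rewrite divfK//; lra.
have n2 : dot 2 3 x != 0.
  by apply: contraNneq t2; rewrite dE => h; apply/eqP/(mulIf t0'); rewrite divfK//; lra.
have Dx : two_kepler_domain x by [].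
exists x; split=> //; last first.
  rewrite prod_normE /= subrr normr0 gt_max e0 /= addrAC subrr add0r normrZ gtr0_norm//.
  rewrite ltr_pdivlMr// in te; apply: le_lt_trans te.
  by rewrite ler_wpM2l ?(ltW tp)// lerDl.
move=> a Ha.
have k1 v : 'd (kep 0 1) x v = dkep 0 1 x v by rewrite -deriveE; [exact: K1E|exact: dK1].
have k2 v : 'd (kep 2 3) x v = dkep 2 3 x v by rewrite -deriveE; [exact: K2E|exact: dK2].
have l1 v : 'd (ang 0 1) x v = dang 0 1 x v by rewrite -deriveE; [exact: LE|exact: dL].
have l2 v : 'd (ang 2 3) x v = dang 2 3 x v by rewrite -deriveE; [exact: LE|exact: dL].
have {}Ha v : a 0 * dkep 0 1 x v + a 1 * dang 0 1 x v + a 2 * dkep 2 3 x v + a 3 * dang 2 3 x v = 0.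
  by rewrite -k1 -k2 -l1 -l2 -[RHS](Ha v) sum4.
have Hp (p : 'rV[R]_4) : a 0 * ((x.2 0 0 * p 0 0 + x.2 0 1 * p 0 1) / 4) + a 1 * (x.1 0 0 * p 0 1 - x.1 0 1 * p 0 0) +
    a 2 * ((x.2 0 2 * p 0 2 + x.2 0 3 * p 0 3) / 4) + a 3 * (x.1 0 2 * p 0 3 - x.1 0 3 * p 0 2) = 0.
  have := Ha (0, p); rewrite /dkep /dang !mxE /= !mulr0 !mul0r !addr0 !mul0r !subr0 !add0r; exact.
have s0x : sqn 0 1 x != 0 by exact: s0'.
have t0x : sqn 2 3 x != 0 by exact: t0'.
have cancel (u c : R) : u * c = 0 -> c != 0 -> u = 0.
  by move=> /eqP; rewrite mulf_eq0 => /orP[/eqP//|/eqP->]; rewrite eqxx.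
pose vec (p0 p1 p2 p3 : R) : 'rV[R]_4 := \row_i [:: p0; p1; p2; p3]`_i.
have Hv p0 p1 p2 p3 : a 0 * ((x.2 0 0 * p0 + x.2 0 1 * p1) / 4) + a 1 * (x.1 0 0 * p1 - x.1 0 1 * p0) +
    a 2 * ((x.2 0 2 * p2 + x.2 0 3 * p3) / 4) + a 3 * (x.1 0 2 * p3 - x.1 0 3 * p2) = 0.
  by have := Hp (vec p0 p1 p2 p3); rewrite !mxE.
apply: ord4P.
- apply: (cancel _ (dot 0 1 x) _ n1); rewrite -[RHS](mulr0 4) -(Hv (x.1 0 0) (x.1 0 1) 0 0) /dot; by field.
- apply: (cancel _ (sqn 0 1 x) _ s0x); rewrite -[RHS](Hv (- x.1 0 1) (x.1 0 0) 0 0) /sqn.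
  have a0 : a 0 = 0.
    apply: (cancel _ (dot 0 1 x) _ n1); rewrite -[RHS](mulr0 4) -(Hv (x.1 0 0) (x.1 0 1) 0 0) /dot; by field.
  by rewrite a0; ring.
- apply: (cancel _ (dot 2 3 x) _ n2); rewrite -[RHS](mulr0 4) -(Hv 0 0 (x.1 0 2) (x.1 0 3)) /dot; by field.
have a2 : a 2 = 0.
  apply: (cancel _ (dot 2 3 x) _ n2); rewrite -[RHS](mulr0 4) -(Hv 0 0 (x.1 0 2) (x.1 0 3)) /dot; by field.
apply: (cancel _ (sqn 2 3 x) _ t0x); rewrite -[RHS](Hv 0 0 (- x.1 0 3) (x.1 0 2)) /sqn a2.
by ring.
Unshelve. all: by end_near. Qed.

End TwoKepler.

(** * The parallelogram with a central mass *)

Section FiveBodies.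
Variable R : realType.

Local Notation m5 := (\row_(i < 5) [:: - (1 / 4); 1; 1; 1; 1]`_i : 'rV[R]_5).

Definition ws (i : 'I_5) : R := [:: 0; 1; -1; -1; 1]`_i.
Definition wt (i : 'I_5) : R := [:: 0; 1; 1; -1; -1]`_i.
Definition spt (x : 'rV[R]_4) (k : 'I_2) : R := if k == 0 then x 0 0 else x 0 1.
Definition tpt (x : 'rV[R]_4) (k : 'I_2) : R := if k == 0 then x 0 2 else x 0 3.

(** The two pairs of opposite bodies are at the ends of the diagonals
    2 (s + t) and 2 (t - s) of a parallelogram, whose centre carries body 0. *)
Definition parallelogram (x : 'rV[R]_4) : 'M[R]_(5, 2) :=
  \matrix_(i, k) (ws i * spt x k + wt i * tpt x k).

Let sq2 (a b : R) := a ^+ 2 + b ^+ 2.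

Lemma parallelogram_gapE x i j : gap (parallelogram x) i j =
  Num.sqrt (sq2 ((ws i - ws j) * x 0 0 + (wt i - wt j) * x 0 2)
                ((ws i - ws j) * x 0 1 + (wt i - wt j) * x 0 3)).
Proof. by rewrite gapE sum2 !mxE; congr Num.sqrt; rewrite /spt /tpt /sq2 /=; ring. Qed.

Definition sdist (x : 'rV[R]_4) := Num.sqrt (sq2 (x 0 0) (x 0 1)).
Definition tdist (x : 'rV[R]_4) := Num.sqrt (sq2 (x 0 2) (x 0 3)).
Definition udist (x : 'rV[R]_4) := Num.sqrt (sq2 (x 0 0 + x 0 2) (x 0 1 + x 0 3)).
Definition vdist (x : 'rV[R]_4) := Num.sqrt (sq2 (x 0 2 - x 0 0) (x 0 3 - x 0 1)).

Lemma sqrt_double (a b : R) : a = 2 ^+ 2 * b -> Num.sqrt a = 2 * Num.sqrt b.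
Proof. by move=> ->; rewrite sqrtrM ?sqr_ge0// sqrtr_sqr ger0_norm. Qed.

Lemma parallelogram_gaps x (g := gap (parallelogram x)) :
  [/\ g 0 1 = udist x, g 0 2 = vdist x, g 0 3 = udist x & g 0 4 = vdist x] /\
  [/\ g 1 2 = 2 * sdist x, g 1 3 = 2 * udist x, g 1 4 = 2 * tdist x &
     [/\ g 2 3 = 2 * tdist x, g 2 4 = 2 * vdist x & g 3 4 = 2 * sdist x]].
Proof.
rewrite /g !parallelogram_gapE /ws /wt /=; split; last first.
  by split; [| | |split]; apply: sqrt_double; rewrite /sq2 /=; ring.
by split; rewrite /udist /vdist; congr Num.sqrt; rewrite /sq2 /=; ring.
Qed.

Lemma five_mass : [/\ m5 0 0 = - (1 / 4), m5 0 1 = 1, m5 0 2 = 1, m5 0 3 = 1 & m5 0 4 = 1].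
Proof. by split; rewrite mxE. Qed.

Lemma five_mass_neq0 i : m5 0 i != 0.
Proof.
have [E0 E1 E2 E3 E4] := five_mass; have q : - (1 / 4) != 0 :> R by lra.
by move: i; apply: ord5P; rewrite ?E0 ?E1 ?E2 ?E3 ?E4 ?oner_eq0.
Qed.

Definition noncollision (x : 'rV[R]_4) : Prop :=
  [/\ 0 < sq2 (x 0 0) (x 0 1), 0 < sq2 (x 0 2) (x 0 3),
      0 < sq2 (x 0 0 + x 0 2) (x 0 1 + x 0 3) & 0 < sq2 (x 0 2 - x 0 0) (x 0 3 - x 0 1)].

Lemma sdist_neq0 x : noncollision x -> [/\ sdist x != 0, tdist x != 0, udist x != 0 & vdist x != 0].
Proof. by move=> [? ? ? ?]; split; rewrite gt_eqF// sqrtr_gt0. Qed.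

Lemma gap_neqP N d (q : 'M[R]_(N, d)) i j : row i q != row j q <-> gap q i j != 0.
Proof.
split=> [ij|].
  by rewrite gapE gt_eqF// sqrtr_gt0; exact: gap2_gt0.
apply: contra_neq => ij; rewrite gapE big1 ?sqrtr0// => k _.
by rewrite (row_eqE ij) subrr expr0n.
Qed.

Lemma parallelogram_collision_free x : collision_free (parallelogram x) <-> noncollision x.
Proof.
have [[g01 g02 g03 g04] [g12 g13 g14 [g23 g24 g34]]] := parallelogram_gaps x; split=> [cf|].
  have pos_of (i j : 'I_5) (a : R) : i != j -> gap (parallelogram x) i j = 2 * Num.sqrt a -> 0 < a.
    move=> ij g; rewrite -sqrtr_gt0 lt_def sqrtr_ge0 andbT.
    by have /gap_neqP := cf i j ij; rewrite g; apply: contra_neq => ->; rewrite mulr0.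
  by split; [exact: (pos_of 1 2)|exact: (pos_of 1 4)|exact: (pos_of 1 3)|exact: (pos_of 2 4)].
move=> /sdist_neq0[s0 t0 u0 v0].
have n2 (a : R) : a != 0 -> 2 * a != 0 by move=> a0; rewrite mulf_neq0 ?pnatr_eq0.
apply: ord5P; apply: ord5P => // _; apply/gap_neqP;
  rewrite ?g01 ?g02 ?g03 ?g04 ?g12 ?g13 ?g14 ?g23 ?g24 ?g34 ?n2//;
  by rewrite gap_sym ?g01 ?g02 ?g03 ?g04 ?g12 ?g13 ?g14 ?g23 ?g24 ?g34 ?n2.
Qed.

(** The force of the opposite body, at twice the distance, is 1/4 of that of a
    unit mass at the centre, and the central mass cancels it. *)
Lemma parallelogram_accel x : noncollision x -> exists x', forall i k, accel m5 (parallelogram x) i k = parallelogram x' i k.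
Proof.
move=> /sdist_neq0[s0 t0 u0 v0].
have [[g01 g02 g03 g04] [g12 g13 g14 [g23 g24 g34]]] := parallelogram_gaps x.
have [m0 m1 m2 m3 m4] := five_mass.
pose x' : 'rV[R]_4 := \row_i (if (val i < 2)%N then - x 0 i / (4 * sdist x ^+ 3) else - x 0 i / (4 * tdist x ^+ 3)).
have spE k : spt x' k = - spt x k / (4 * sdist x ^+ 3) by rewrite /spt !mxE; case: ifP.
have tpE k : tpt x' k = - tpt x k / (4 * tdist x ^+ 3) by rewrite /tpt !mxE; case: ifP.
exists x' => i k; rewrite /accel sum5 m0 m1 m2 m3 m4 [in RHS]mxE spE tpE !mxE.
move: (spt x k) (tpt x k) => s t.
have gS (a b : 'I_5) (r : R) : gap (parallelogram x) a b = r -> gap (parallelogram x) b a = r by rewrite gap_sym.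
have g10 := gS _ _ _ g01; have g20 := gS _ _ _ g02; have g30 := gS _ _ _ g03; have g40 := gS _ _ _ g04.
have g21 := gS _ _ _ g12; have g31 := gS _ _ _ g13; have g41 := gS _ _ _ g14.
have g32 := gS _ _ _ g23; have g42 := gS _ _ _ g24; have g43 := gS _ _ _ g34.
have z3 : (0 ^+ 3)^-1 = 0 :> R by rewrite expr0n invr0.
move: i; apply: ord5P.
- by rewrite gap_diag z3 g01 g02 g03 g04 /ws /wt /=; field; rewrite s0 t0 u0 v0.
- by rewrite gap_diag z3 g10 g12 g13 g14 /ws /wt /=; field; rewrite s0 t0 u0.
- by rewrite gap_diag z3 g20 g21 g23 g24 /ws /wt /=; field; rewrite s0 t0 v0.
- by rewrite gap_diag z3 g30 g31 g32 g34 /ws /wt /=; field; rewrite s0 t0 u0.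
by rewrite gap_diag z3 g40 g41 g42 g43 /ws /wt /=; field; rewrite s0 t0 v0.
Qed.

Lemma parallelogram_potential x : noncollision x -> potential m5 (parallelogram x) = (sdist x)^-1 + (tdist x)^-1.
Proof.
move=> /sdist_neq0[s0 t0 u0 v0].
have [[g01 g02 g03 g04] [g12 g13 g14 [g23 g24 g34]]] := parallelogram_gaps x.
have [m0 m1 m2 m3 m4] := five_mass.
pose F (a b : 'I_5) := m5 0 a * m5 0 b / gap (parallelogram x) a b.
have -> : potential m5 (parallelogram x) = \sum_(a < 5) \sum_(b < 5 | (a < b)%N) F a b by [].
under eq_bigr do rewrite big_mkcond sum5.
rewrite sum5 /= !addr0 !add0r /F g01 g02 g03 g04 g12 g13 g14 g23 g24 g34 m0 m1 m2 m3 m4.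
by field; rewrite s0 t0 u0 v0.
Qed.

Definition parallelogram_frame (a : 'I_4) : 'M[R]_(5, 2) := parallelogram (delta_mx 0 a).

Lemma lincomb_parallelogram_frame x : lincomb parallelogram_frame x = parallelogram x.
Proof.
apply/matrixP => i k; rewrite /lincomb summxE sum4 /parallelogram_frame !mxE.
by move: k; apply: ord2P; rewrite /spt /tpt !mxE /=; ring.
Qed.

Definition parallelogram_space : set 'M[R]_(5, 2) := [set q : 'M[R]_(5, 2) |
       [/\ q 0 0 = 0 /\ q 0 1 = 0,
           q 1 0 + q 3 0 = 0 /\ q 1 1 + q 3 1 = 0
         & q 2 0 + q 4 0 = 0 /\ q 2 1 + q 4 1 = 0]].

Lemma range_parallelogram : range parallelogram = parallelogram_space.
Proof.
apply/seteqP; split=> [_ [x _ <-]|q [[h00 h01] [h13 h13'] [h24 h24']]].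
  by rewrite /parallelogram_space /= !mxE /ws /wt /=; do !split; ring.
pose x : 'rV[R]_4 := \row_i [:: (q 1 0 - q 2 0) / 2; (q 1 1 - q 2 1) / 2;
  (q 1 0 + q 2 0) / 2; (q 1 1 + q 2 1) / 2]`_i.
exists x => //; apply/matrixP => i k; rewrite mxE.
have -> : spt x k = (q 1 k - q 2 k) / 2 by move: k; apply: ord2P; rewrite /spt /= !mxE.
have -> : tpt x k = (q 1 k + q 2 k) / 2 by move: (k); apply: ord2P; rewrite /tpt /= !mxE.
have q0 : q 0 k = 0 by move: (k); apply: ord2P.
have q3 : q 1 k + q 3 k = 0 by move: (k); apply: ord2P.
have q4 : q 2 k + q 4 k = 0 by move: (k); apply: ord2P.
by move: i; apply: ord5P; rewrite /ws /wt /=; lra.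
Qed.

Lemma parallelogram_inj : injective parallelogram.
Proof.
move=> x y xy; have H i k : parallelogram x i k = parallelogram y i k by rewrite xy.
apply/rowP; apply: ord4P; [have := H 1 0; have := H 2 0|have := H 1 1; have := H 2 1
  |have := H 1 0; have := H 2 0|have := H 1 1; have := H 2 1];
rewrite !mxE /ws /wt /spt /tpt /= => h1 h2; lra.
Qed.

Lemma kinetic_parallelogram_frame : kinetic_matrix m5 parallelogram_frame = diag_mx (const_mx 4).
Proof.
have [m0 m1 m2 m3 m4] := five_mass.
apply/matrixP => a b; rewrite mxE sum5 m0 m1 m2 m3 m4 !sum2 /parallelogram_frame !mxE.
by move: a b; apply: ord4P; apply: ord4P; rewrite /ws /wt /spt /tpt !mxE /=; ring.
Qed.

Theorem five_body_integrable : restriction_integrable m5 parallelogram_space.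
Proof.
exists 4, parallelogram_frame.
have d0 (i : 'I_4) : (const_mx 4 : 'rV[R]_4) 0 i != 0 by rewrite mxE pnatr_eq0.
have [Ku Ki] := diag_invmx d0; rewrite -kinetic_parallelogram_frame in Ku Ki.
have lfE : lincomb parallelogram_frame = parallelogram by apply/funext => x; exact: lincomb_parallelogram_frame.
have psE : phase_space parallelogram_frame = @two_kepler_domain R.
  by apply/seteqP; split=> z; rewrite /phase_space /= lfE => /parallelogram_collision_free.
split=> //.
- by split; rewrite lfE; [exact: parallelogram_inj|exact: range_parallelogram].
- move=> q; rewrite -range_parallelogram => -[x _ <-] cf.
  have [x' Hx'] := parallelogram_accel ((parallelogram_collision_free x).1 cf).
  exists x' => //; apply/matrixP => i k.
  by rewrite scaled_gradientE ?Hx'//; exact: five_mass_neq0.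
rewrite psE; apply: (liouville_ext (@open_two_kepler_domain R) _ (two_kepler_integrable R)) => z Dz.
rewrite /restricted_hamiltonian lfE parallelogram_potential// Ki diag_quad sum4 !mxE /two_kepler_energy /kep.
rewrite -[Num.sqrt (sqn 0 1 z)]/(sdist z.1) -[Num.sqrt (sqn 2 3 z)]/(tdist z.1).
by move: (sdist z.1)^-1 (tdist z.1)^-1 => i j; field.
Qed.

End FiveBodies.

Theorem theorem5 (R : realType) :
  restriction_integrable
    (\row_(i < 5) [:: - (1 / 4); 1; 1; 1; 1]`_i)
    [set q : 'M[R]_(5, 2) |
       [/\ q 0 0 = 0 /\ q 0 1 = 0,
           q 1 0 + q 3 0 = 0 /\ q 1 1 + q 3 1 = 0
         & q 2 0 + q 4 0 = 0 /\ q 2 1 + q 4 1 = 0]]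
  /\
  (forall (n : nat) (m : 'rV[R]_n) (c : 'M[R]_(n, 2)) (alpha : R),
     (forall i, m 0 i != 0) ->
     alpha != 0 ->
     central_configuration m c ->
     (forall i, enorm (row i c) = 1) ->
     total_mass m != 0 ->
     center_of_mass m c = 0 ->
     absolute_equilibrium (row_mx m (const_mx (- alpha)) : 'rV[R]_(n + 1))
                          (col_mx c 0 : 'M[R]_(n + 1, 2)) ->
     restriction_integrable
       (row_mx m (\row_(i < 3) [:: - alpha; 4 * alpha; 4 * alpha]`_i))
       [set q : 'M[R]_(n + 3, 3) |
          [/\ [/\ q (rshift n 0) 0 = 0, q (rshift n 0) 1 = 0 & q (rshift n 0) 2 = 0],
              q (rshift n 1) 0 = 0 /\ q (rshift n 1) 1 = 0,
              q (rshift n 2) 0 = 0 /\ q (rshift n 2) 1 = 0,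
              q (rshift n 1) 2 + q (rshift n 2) 2 = 0
            & (forall i : 'I_n, q (lshift 3 i) 2 = 0) /\
              exists beta theta : R, forall i : 'I_n,
                q (lshift 3 i) 0 = beta * (c *m (rotation theta)^T) i 0 /\
                q (lshift 3 i) 1 = beta * (c *m (rotation theta)^T) i 1]]).
Proof.
split; first exact: five_body_integrable.
by move=> n m c alpha; exact: circular_configuration_integrable.
Qed.
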